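(* The equator map $u^*:B^n\to\mathbb{S}^n$, $u^*(x)=(x/|x|,0)$, is (i) a minimizing extrinsic $4$-harmonic map if $n\geq 15$; (ii) an unstable extrinsic $4$-harmonic map if $9\leq n<15$.
   Context: $B^n\subset\mathbb{R}^n$ is the Euclidean unit ball and $\mathbb{S}^n\subset\mathbb{R}^{n+1}=\mathbb{R}^n\times\mathbb{R}$ the unit sphere. $W^{4,2}(B^n,\mathbb{S}^n)=\{u\in W^{4,2}(B^n,\mathbb{R}^{n+1}) : u(x)\in\mathbb{S}^n \text{ for a.e. } x\}$. The extrinsic $4$-energy is defined on $W^{4,2}(B^n,\mathbb{S}^n)$ by $E_4^{\rm ext}(u)=\int_{B^n}|\Delta^2 u|^2\,dx$, where $\Delta$ acts componentwise and norms are Euclidean. A map $u\in W^{4,2}(B^n,\mathbb{S}^n)$ is extrinsic (weakly) $4$-harmonic if $\frac{d}{dt}E_4^{\rm ext}(u_t)\big|_{t=0}=0$ for all variations $u_t=\Pi(u+t\phi)$ with $\phi\in C_0^\infty(B^n,\mathbb{R}^{n+1})$, where $\Pi(y)=y/|y|$ is the nearest point projection onto $\mathbb{S}^n$. It is minimizing if $E_4^{\rm ext}(u)\leq E_4^{\rm ext}(v)$ for all $v\in W^{4,2}(B^n,\mathbb{S}^n)$ with $u-v\in W_0^{4,2}(B^n,\mathbb{R}^{n+1})$. An extrinsic $4$-harmonic map $u$ is stable if $\frac{d^2}{dt^2}E_4^{\rm ext}(u_t)\big|_{t=0}\geq 0$ for all variations $u_t$ of $u$ such that $u_t-u\in W_0^{4,2}(B^n,\mathbb{R}^{n+1})$,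 and unstable if it is not stable. *)

(* Defs.v *)
From HB Require Import structures.
From mathcomp Require Import all_boot all_order all_algebra.
From mathcomp Require Import all_classical all_reals all_analysis.

Set Implicit Arguments.
Unset Strict Implicit.
Unset Printing Implicit Defensive.

Import Order.TTheory GRing.Theory Num.Theory.
Import numFieldNormedType.Exports.

Local Open Scope classical_set_scope.
Local Open Scope ring_scope.

(* The product (= Borel) sigma-algebra on row vectors. *)
Section measurable_rV.
Context {R : realType} (n : nat).

Let coord : 'I_n -> 'rV[R]_n -> measurableTypeR R := fun i x => x ord0 i.

Let rV_set0 : g_sigma_preimage coord set0.
Proof. exact: sigma_algebra0. Qed.

Let rV_setC A : g_sigma_preimage coord A -> g_sigma_preimage coord (~` A).
Proof. exact: sigma_algebraC. Qed.

Let rV_bigcup (F : _^nat) : (forall i, g_sigma_preimage coord (F i)) ->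
  g_sigma_preimage coord (\bigcup_i (F i)).
Proof. exact: sigma_algebra_bigcup. Qed.

HB.instance Definition _ :=
  @isMeasurable.Build (measure_tuple_display R.-ocitv.-measurable.-sigma)
    'rV[R]_n (g_sigma_preimage coord) rV_set0 rV_setC rV_bigcup.

Lemma measurable_rV_coord (i : 'I_n) :
  measurable_fun [set: 'rV[R]_n] (fun x => x ord0 i : measurableTypeR R).
Proof.
move=> _ Y mY; rewrite setTI; apply: sub_sigma_algebra => /=.
rewrite -bigcup_seq/=; exists i => /=; first by rewrite mem_index_enum.
by exists Y => //; rewrite setTI.
Qed.

Lemma measurable_fun_rVP d (T : measurableType d) (f : T -> 'rV[R]_n) :
  (forall i, measurable_fun [set: T] (fun t => f t ord0 i : measurableTypeR R)) ->
  measurable_fun [set: T] f.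
Proof.
move=> mf _ A mA; rewrite setTI.
suff : g_sigma_preimage coord `<=` [set A | measurable (f @^-1` A)] by exact.
apply: smallest_sub.
  split=> /=.
  - by rewrite preimage_set0.
  - by move=> B mB; rewrite setTD preimage_setC; exact: measurableC.
  - by move=> B mB; rewrite preimage_bigcup; exact: bigcup_measurable.
rewrite -bigcup_seq; apply: bigcup_sub => i _ B [C mC <-] /=.
by rewrite setTI; have := mf i measurableT C mC; rewrite setTI.
Qed.

End measurable_rV.

Section sigma_finite_pack.
Context d (T : measurableType d) (R : realType).
Context (m : {measure set T -> \bar R}) (m_sf : sigma_finite setT m).

Let f : set T -> \bar R := m.

HB.instance Definition _ := Measure.on f.
HB.instance Definition _ := Measure_isSigmaFinite.Build _ _ _ f m_sf.

Definition sigma_finite_pack : {sigma_finite_measure set T -> \bar R} := f.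

End sigma_finite_pack.

Section lebesgue_measure_rV.
Context {R : realType}.

Definition rV_cons (n : nat) (p : measurableTypeR R * 'rV[R]_n) : 'rV[R]_n.+1 :=
  \row_i oapp (p.2 ord0) p.1 (unlift ord0 i).

Fixpoint lebesgue_measure_rV (n : nat) : set 'rV[R]_n -> \bar R :=
  if n is n'.+1 then
    pushforward (lebesgue_measure \x @lebesgue_measure_rV n')%E (@rV_cons n')
  else \d_(0 : 'rV[R]_0).

Let rV_uncons (n : nat) (x : 'rV[R]_n.+1) : measurableTypeR R * 'rV[R]_n :=
  (x ord0 ord0, \row_i x ord0 (lift ord0 i)).

Let rV_consK n : cancel (@rV_cons n) (@rV_uncons n).
Proof.
move=> [t y]; rewrite /rV_uncons/= mxE unlift_none/=; congr pair.
by apply/rowP => i; rewrite !mxE liftK.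
Qed.

Lemma measurable_rV_cons n : measurable_fun setT (@rV_cons n).
Proof.
apply: measurable_fun_rVP => i; rewrite /rV_cons.
case: (unliftP ord0 i) => [j ij|ij].
  rewrite (_ : (fun _ => _) = (fun y : 'rV[R]_n => y ord0 j) \o snd).
    by apply: measurableT_comp; [exact: measurable_rV_coord|exact: measurable_snd].
  by apply/funext => -[t y] /=; rewrite mxE ij liftK.
rewrite (_ : (fun _ => _) = fst); first exact: measurable_fst.
by apply/funext => -[t y] /=; rewrite mxE ij unlift_none.
Qed.

Let measurable_rV_uncons n : measurable_fun setT (@rV_uncons n).
Proof.
apply: measurable_fun_pair; first exact: measurable_rV_coord.
apply: measurable_fun_rVP => i.
rewrite (_ : (fun _ => _) = (fun x : 'rV[R]_n.+1 => x ord0 (lift ord0 i))).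
  exact: measurable_rV_coord.
by apply/funext => x; rewrite mxE.
Qed.

Let lebesgue_measure_rV_ex n :
  exists2 mu : {measure set 'rV[R]_n -> \bar R},
    @lebesgue_measure_rV n = mu & sigma_finite setT mu.
Proof.
elim: n => [|n [mu0 mu0E mu0_sf]].
  by exists \d_(0 : 'rV[R]_0) => //; exact: sigma_finiteT.
pose mu := sigma_finite_pack mu0_sf.
pose p := (lebesgue_measure \x mu)%E.
pose nu := pushforward p (@rV_cons n).
pose nu0 := measure_function_pushforward__canonical__measure_function_Measure
  (lebesgue_integral_fubini_product_measure1__canonical__measure_function_Measure
     (@lebesgue_measure R) mu) (@measurable_rV_cons n).
have [G GT Gfin] : sigma_finite setT p.
  have /sigma_finiteP[F [TF ndF Foo]] := sigma_finiteT (@lebesgue_measure R).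
  have /sigma_finiteP[G [TG ndG Goo]] := sigma_finiteT mu.
  exists (fun n => F n `*` G n).
    rewrite -setXTT TF TG predeqE => -[x y]; split.
      move=> [/= [m _ Fmx] [k _ Gky]]; exists (maxn m k) => //; split.
      - by move: x Fmx; exact/subsetPset/ndF/leq_maxl.
      - by move: y Gky; exact/subsetPset/ndG/leq_maxr.
    by move=> [m _ []/= ? ?]; split; exists m.
  move=> k; have [mF Fk] := Foo k; have [mG Gk] := Goo k.
  split; first exact: measurableX.
  by rewrite /p product_measure1E// lte_mul_pinfty// ge0_fin_numE.
have snu : sigma_finite setT nu.
  exists (fun k => @rV_uncons n @^-1` G k).
    by rewrite -preimage_bigcup -GT preimage_setT.
  move=> k; have [mG Goo] := Gfin k; split.
    by rewrite -[X in measurable X]setTI; exact: measurable_rV_uncons.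
  rewrite /nu /pushforward -comp_preimage (_ : _ \o _ = id) //.
  by apply/funext => x /=; exact: rV_consK.
by exists nu0 => //=; rewrite mu0E.
Qed.

Let mu0 n : @lebesgue_measure_rV n set0 = 0%E.
Proof. by have [mu ->] := lebesgue_measure_rV_ex n. Qed.

Let mu_ge0 n A : (0 <= @lebesgue_measure_rV n A)%E.
Proof. by have [mu ->] := lebesgue_measure_rV_ex n. Qed.

Let mu_sigma_additive n : semi_sigma_additive (@lebesgue_measure_rV n).
Proof.
have [mu ->] := lebesgue_measure_rV_ex n.
by move=> F mF tF mUF; exact: measure_semi_sigma_additive.
Qed.

HB.instance Definition _ n := isMeasure.Build _ _ _ (@lebesgue_measure_rV n)
  (mu0 n) (@mu_ge0 n) (@mu_sigma_additive n).

Let mu_sigma_finite n : sigma_finite setT (@lebesgue_measure_rV n).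
Proof. by have [mu ->] := lebesgue_measure_rV_ex n. Qed.

HB.instance Definition _ n := Measure_isSigmaFinite.Build _ _ _
  (@lebesgue_measure_rV n) (@mu_sigma_finite n).

Lemma lebesgue_measure_rV_box n (A : 'I_n -> set (measurableTypeR R)) :
  (forall i, measurable (A i)) ->
  lebesgue_measure_rV [set x : 'rV[R]_n | forall i, A i (x ord0 i)] =
  (\prod_(i < n) lebesgue_measure (A i))%E.
Proof.
elim: n A => [|n IHn] A mA.
  by rewrite big_ord0 /= diracE mem_set// => -[].
rewrite big_ord_recl -IHn// /= /pushforward.
rewrite -product_measure1E//; last first.
  rewrite (_ : mkset _ = \bigcap_(i in [set: 'I_n])
      ((fun x : 'rV[R]_n => x ord0 i) @^-1` A (lift ord0 i))).
    apply: fin_bigcap_measurable => // i _.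
    rewrite -[X in measurable X]setTI.
    by apply: measurable_rV_coord.
  by apply/seteqP; split => x /= xA i => [_|]; exact: xA.
congr (product_measure1 _ _ _); apply/seteqP; split => -[t y] /=.
  move=> tyA; split; first by have := tyA ord0; rewrite mxE unlift_none.
  by move=> i; have := tyA (lift ord0 i); rewrite mxE liftK.
move=> [tA yA] i; rewrite mxE; case: unliftP => [j ->|->] //=.
Qed.

End lebesgue_measure_rV.
Arguments lebesgue_measure_rV {R} n _ : simpl never.

Section euclidean.
Context {R : realType}.

(* The library norm on 'rV[R]_n is the sup norm. *)
Definition enorm n (x : 'rV[R]_n) : R := Num.sqrt (\sum_i x ord0 i ^+ 2).

Definition eball n : set 'rV[R]_n := [set x | enorm x < 1].

Definition esphere n : set 'rV[R]_n := [set y | enorm y = 1].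

Definition coordf n m (u : 'rV[R]_n -> 'rV[R]_m) (j : 'I_m) : 'rV[R]_n -> R :=
  fun x => u x ord0 j.

Definition sphere_proj n (y : 'rV[R]_n) : 'rV[R]_n := (enorm y)^-1 *: y.

End euclidean.

Section test_functions.
Context {R : realType} {n : nat}.
Implicit Types (f : 'rV[R]_n -> R) (s : seq 'I_n).

(* A multi-index is given as the list of the differentiation directions, so
   that its length is [size s]. *)
Definition iter_partial s f : 'rV[R]_n -> R :=
  foldr (fun i (g : 'rV[R]_n -> R) x => 'D_(delta_mx ord0 i) g x) f s.

Definition smooth f := forall s,
  continuous (iter_partial s f) /\
  forall i x, derivable (iter_partial s f) x (delta_mx ord0 i).

Definition test_fun f :=
  [/\ smooth f,
      compact (closure [set x | f x != 0])
    & closure [set x | f x != 0] `<=` @eball R n].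

Definition test_map m (phi : 'rV[R]_n -> 'rV[R]_m) :=
  forall j, test_fun (coordf phi j).

End test_functions.

Section sobolev.
Context {R : realType} {n : nat}.
Implicit Types (f g : 'rV[R]_n -> R) (s : seq 'I_n).

Local Notation mu := (@lebesgue_measure_rV R n).
Local Notation B := (@eball R n).

(* Measurability is Borel measurability; every Lebesgue measurable function is
   a.e. equal to a Borel measurable one. *)
Definition L2 f :=
  measurable_fun B f /\ mu.-integrable B (fun x => (f x ^+ 2)%:E).

Definition is_weak_partial s f g := forall phi, test_fun phi ->
  \int[mu]_(x in B) (f x * iter_partial s phi x) =
  (- 1) ^+ size s * \int[mu]_(x in B) (g x * phi x).

Definition sobolev k f :=
  L2 f /\ forall s, (size s <= k)%N -> exists2 g, L2 g & is_weak_partial s f g.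

(* An L2 weak partial derivative is unique up to a.e. equality on the ball;
   this picks a representative. *)
Definition weak_partial s f : 'rV[R]_n -> R :=
  get [set g | L2 g /\ is_weak_partial s f g].

Definition sobolev0 k f := sobolev k f /\
  forall e : R, 0 < e -> exists2 phi, test_fun phi &
    forall s, (size s <= k)%N ->
    (\int[mu]_(x in B) ((weak_partial s f x - iter_partial s phi x) ^+ 2)%:E
      < e%:E)%E.

End sobolev.

Section four_harmonic.
Context {R : realType} {n m : nat}.
Implicit Types u v phi : 'rV[R]_n -> 'rV[R]_m.

Local Notation mu := (@lebesgue_measure_rV R n).
Local Notation B := (@eball R n).

Definition sobolev_map k u := forall j, sobolev k (coordf u j).

Definition sobolev0_map k u := forall j, sobolev0 k (coordf u j).

Definition sobolev_sphere k u :=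
  sobolev_map k u /\ {ae mu, forall x, B x -> esphere (u x)}.

Definition bilaplacian u : 'rV[R]_n -> 'rV[R]_m := fun x =>
  \row_j \sum_(i < n) \sum_(k < n) weak_partial [:: i; i; k; k] (coordf u j) x.

Definition E4ext u : R := \int[mu]_(x in B) (enorm (bilaplacian u x) ^+ 2).

Definition sphere_variation u phi (t : R) : 'rV[R]_n -> 'rV[R]_m :=
  fun x => sphere_proj (u x + t *: phi x).

(* [E4ext] is a total function, meaningful on [sobolev_sphere 4] only; the
   condition on [t] near 0 says that the differentiated energies are genuine. *)
Definition four_harmonic u := sobolev_sphere 4 u /\
  forall phi, test_map phi ->
    (\forall t \near (0 : R), sobolev_sphere 4 (sphere_variation u phi t)) /\
    is_derive (0 : R) 1 (fun t => E4ext (sphere_variation u phi t)) 0.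

Definition minimizing u := sobolev_sphere 4 u /\
  forall v, sobolev_sphere 4 v -> sobolev0_map 4 (u \- v) ->
    E4ext u <= E4ext v.

Definition is_second_derivative (f : R -> R) (t l : R) :=
  (\forall s \near t, derivable f s 1) /\ is_derive t 1 (derive1 f) l.

(* The second derivative is quantified as a value [l] that exists, so that the
   failure of stability exhibits an actual negative second derivative. *)
Definition stable u := forall phi, test_map phi ->
  (\forall t \near (0 : R), sobolev0_map 4 (sphere_variation u phi t \- u)) ->
  forall l, is_second_derivative (fun t => E4ext (sphere_variation u phi t)) 0 l ->
    0 <= l.

End four_harmonic.

Definition equator_map {R : realType} (n : nat) (x : 'rV[R]_n) : 'rV[R]_(n + 1) :=
  row_mx ((enorm x)^-1 *: x) 0.

(* Main.v *)
(* Write rho = 1/|x| and u for the equator map. The components of u are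
   spherical harmonics of degree 1, which gives Delta^4 u = lambda rho^8 u with
   lambda = 105(n-1)(n-3)(n-5)(n-7), so integrations by parts turn
   <Delta^2 u, Delta^2 w> into lambda <rho^8 u, w>.

   Minimality: if v is sphere valued and w = u - v, then 2 u.w = |w|^2, hence
   E(v) - E(u) = |Delta^2 w|^2 - lambda |rho^4 w|^2, which is nonnegative by the
   Rellich inequality |Delta^2 w| >= K |rho^4 w|, K = n(n-4)(n+4)(n-8)/16, as soon
   as K^2 >= lambda, that is, n >= 15.

   Second variation: along phi it is
   2(|Delta^2(phi - (u.phi)u)|^2 + lambda <rho^8, (u.phi)^2 - |phi|^2>), and the
   first variation vanishes because u.(phi - (u.phi)u) = 0.

   Instability: for phi = (0, eta) the second variation is
   2(|Delta^2 eta|^2 - lambda |rho^4 eta|^2). Take eta equal to rho^((n-8)/2) on a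
   long annulus, where Delta^2 eta = K rho^4 eta; the transition regions
   contribute a bounded amount, whereas the plateau contributes K^2 - lambda < 0
   times a quantity that grows with the logarithm of the ratio of the radii. *)
Require Import Defs.
From HB Require Import structures.
From mathcomp Require Import all_boot all_order all_fingroup all_algebra.
From mathcomp Require Import all_classical all_reals all_analysis measurable_realfun.
From mathcomp Require Import ring lra.

Set Implicit Arguments.
Unset Strict Implicit.
Unset Printing Implicit Defensive.

Import Order.TTheory GRing.Theory Num.Theory.
Import numFieldNormedType.Exports.

Local Open Scope classical_set_scope.
Local Open Scope ring_scope.

(** * Symbol calculus *)

(** The obstacle is the singularity of u at the origin. All calculus runs in classes of functions
    whose derivatives of order j are O(rho^(k+j)) off the origin. Order 8 is still integrable
    because [n >= 9]; order 7 can be integrated by parts without a contribution of the origin, since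
    almost every line parallel to an axis misses it. As u has order 0, |Delta^2 u|^2 has order 8:
    there is no room to spare.

    A competitor is only a Sobolev map, so Green's identity and the Rellich inequality are proved
    for test functions and carried to w by L2 approximation. The weight rho^4 is unbounded, so it is
    truncated in the limit for the Rellich inequality, which then controls <rho^8 u, w> in the limit
    for Green's identity.

    For variations, the classes are extended to functions of (t, x) with bounds uniform in t; these
    provide the dominating functions for two differentiations under the integral.

    K is the factor of Delta^2 on eta = rho^((n-8)/2), the borderline power for which rho^8 eta^2 =
    rho^n just fails to be integrable. With X = n(n-8), K = X(n^2-16)/16 and lambda =
    105(X+7)(X+15), whence the threshold between 14 and 15. *)

Section directional.
Context {R : realType} {V : normedModType R}.
Implicit Types (f g : V -> R) (x v : V).

Lemma is_derive_fadd f g x v a b : is_derive x v f a -> is_derive x v g b ->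
  is_derive x v (fun z => f z + g z) (a + b).
Proof. by move=> fa gb; exact: is_deriveD. Qed.

Lemma is_derive_fopp f x v a : is_derive x v f a ->
  is_derive x v (fun z => - f z) (- a).
Proof. by move=> fa; exact: is_deriveN. Qed.

Lemma is_derive_fmul f g x v a b : is_derive x v f a -> is_derive x v g b ->
  is_derive x v (fun z => f z * g z) (a * g x + f x * b).
Proof.
move=> fa gb; have h := is_deriveM fa gb; apply: (is_derive_eq h).
by rewrite addrC; congr (_ + _); rewrite mulrC.
Qed.

Lemma is_derive_fsum (J : Type) (r : seq J) (F : J -> V -> R) (d : J -> R) x v :
  (forall j, is_derive x v (F j) (d j)) ->
  is_derive x v (fun z => \sum_(j <- r) F j z) (\sum_(j <- r) d j).
Proof.
move=> Fd; elim: r => [|j r IH].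
  rewrite big_nil (_ : (fun _ => _) = cst 0); first exact: is_derive_cst.
  by apply/funext => z; rewrite big_nil.
rewrite big_cons (_ : (fun _ => _) = fun z => F j z + \sum_(j <- r) F j z).
  exact: is_derive_fadd.
by apply/funext => z; rewrite big_cons.
Qed.

(** Restriction to a line makes the one-variable chain rule, the mean value theorem and the
    fundamental theorem of calculus available for directional derivatives. *)
Lemma is_derive_line f x v a :
  is_derive x v f a <-> is_derive (0 : R) 1 (fun h => f (h *: v + x)) a.
Proof.
have E : 'D_v f x = 'D_1 (fun h : R => f (h *: v + x)) 0.
  rewrite /derive; set g1 := fun h => h^-1 *: _; set g2 := fun h => h^-1 *: _.
  suff -> : g1 = g2 by [].
  rewrite funeqE /g1 /g2 => h /=.
  by rewrite addr0 scale0r add0r [_%:A]mulr1.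
split=> -[d e].
  have d' := (derivable1P f x v).1 d.
  by split => //; rewrite -E.
have d' := (derivable1P f x v).2 d.
by split => //; rewrite E.
Qed.

Lemma is_derive_fcomp (h : R -> R) f x v a b :
  is_derive (f x) 1 h a -> is_derive x v f b ->
  is_derive x v (fun z => h (f z)) (a * b).
Proof.
move=> ha /is_derive_line fb; apply/is_derive_line.
have := @is_derive1_comp _ h (fun t => f (t *: v + x)) 0 a b.
by rewrite /= scale0r add0r; apply.
Qed.

Lemma near_open_eq (Om : set V) f g x : open Om ->
  (forall z, Om z -> f z = g z) -> Om x -> \near x, f x = g x.
Proof.
move=> oO fg Ox.
have : \forall z \near x, Om z by exact: open_nbhs_nbhs.
by apply: filterS => z; exact: fg.
Qed.

End directional.

Section ck.
Context {R : realType} {V : normedModType R} {I : Type}.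
Variables (dir : I -> V) (o : I -> nat).

(* The order [k] stands for a growth rate of the functions, multiplicative
   under products; only the axioms below matter. *)
Record level := Level {
  lev_dom : set V;
  lev : nat -> (V -> R) -> Prop;
  lev_open : open lev_dom;
  lev_ext : forall k f g, (forall z, lev_dom z -> f z = g z) -> lev k f -> lev k g;
  lev_le : forall k l f, (k <= l)%N -> lev k f -> lev l f;
  lev_cst : forall c, lev 0 (cst c);
  lev_add : forall k f g, lev k f -> lev k g -> lev k (fun z => f z + g z);
  lev_mul : forall k l f g, lev k f -> lev l g -> lev (k + l) (fun z => f z * g z)
}.

Variable P : level.
Local Notation Om := (lev_dom P).
Implicit Types (N k : nat) (f g : V -> R).

(** A derivative along [dir i] raises the order by [o i]. The same recursion serves smooth functions
    ([o] is 0), functions singular at the origin ([o] is 1) and time-dependent families (0 in time,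
    1 in space). *)
Fixpoint ck N k f : Prop :=
  lev P k f /\
  if N is N'.+1 then
    forall i, (forall z, Om z -> derivable f z (dir i)) /\
              ck N' (k + o i) (fun z => 'D_(dir i) f z)
  else True.

Lemma ck_lev N k f : ck N k f -> lev P k f.
Proof. by case: N => [|N] []. Qed.

Lemma ck_derivable N k f i z : ck N.+1 k f -> Om z ->
  is_derive z (dir i) f ('D_(dir i) f z).
Proof. by move=> [_ /(_ i)[d _]] Oz; apply/derivableP/d. Qed.

Lemma ck_D N k f i : ck N.+1 k f -> ck N (k + o i) (fun z => 'D_(dir i) f z).
Proof. by move=> [_ /(_ i)[_]]. Qed.

Lemma ck_ext N k f g : (forall z, Om z -> f z = g z) -> ck N k f -> ck N k g.
Proof.
elim: N k f g => [|N IH] k f g fg [pf df].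
  by split => //; exact: lev_ext pf.
split; first exact: lev_ext pf.
move=> i; have [d c] := df i; split.
  move=> z Oz; have := d z Oz; apply: near_eq_derivable.
  exact: near_open_eq (@lev_open P) fg Oz.
apply: IH c => z Oz; apply: near_eq_derive.
exact: near_open_eq (@lev_open P) fg Oz.
Qed.

(** Enters the class through explicit derivatives, which need to be right on the domain only.
    Closure under products, inverses and roots is then an induction on [N] whose step is a
    differentiation rule. *)
Lemma ck_make N k f (d : I -> V -> R) : lev P k f ->
  (forall i, ck N (k + o i) (d i)) ->
  (forall i z, Om z -> is_derive z (dir i) f (d i z)) -> ck N.+1 k f.
Proof.
move=> pf dN fd; split => // i; split.
  by move=> z Oz; have [] := fd i z Oz.
by apply: ck_ext (dN i) => z Oz; have [_ ->] := fd i z Oz.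
Qed.

Lemma ck_le N k l f : (k <= l)%N -> ck N k f -> ck N l f.
Proof.
elim: N k l f => [|N IH] k l f kl [pf df]; split => //; do 1?exact: lev_le pf.
move=> i; have [d c] := df i; split => //.
by apply: IH c; rewrite leq_add2r.
Qed.

Lemma ckW N k f : ck N.+1 k f -> ck N k f.
Proof.
elim: N k f => [|N IH] k f [pf df]; first by split.
by split => // i; have [d c] := df i; split => //; exact: IH.
Qed.

Lemma ck_leN M N k f : (M <= N)%N -> ck N k f -> ck M k f.
Proof.
move=> MN; rewrite -(subnK MN); elim: (N - M)%N => // m IH.
by rewrite addSn => /ckW.
Qed.

Lemma ck_cst N (c : R) : ck N 0 (cst c).
Proof.
have H k c' : lev P k (cst c') by apply: lev_le (lev_cst _ _).
(* All orders at once, because the derivative, again a constant, has to be placed at order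
   [k + o i]. *)
suff : forall k, ck N k (cst c) by [].
elim: N c => [|N IH] c k; first by split.
apply: (@ck_make _ _ _ (fun _ _ => 0)); first exact: H.
by move=> i; exact: (IH 0).
Qed.

Lemma ck_add N k f g : ck N k f -> ck N k g -> ck N k (fun z => f z + g z).
Proof.
elim: N k f g => [|N IH] k f g F G.
  by split => //; exact: lev_add (ck_lev F) (ck_lev G).
apply: (@ck_make _ _ _ (fun i z => 'D_(dir i) f z + 'D_(dir i) g z)).
- by exact: lev_add (ck_lev F) (ck_lev G).
- by move=> i; apply: IH; exact: ck_D.
- by move=> i z Oz; exact: is_derive_fadd (ck_derivable i F Oz) (ck_derivable i G Oz).
Qed.

Lemma ck_mul N k l f g : ck N k f -> ck N l g -> ck N (k + l) (fun z => f z * g z).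
Proof.
elim: N k l f g => [|N IH] k l f g F G.
  by split => //; exact: lev_mul (ck_lev F) (ck_lev G).
apply: (@ck_make _ _ _ (fun i z => 'D_(dir i) f z * g z + f z * 'D_(dir i) g z)).
- by exact: lev_mul (ck_lev F) (ck_lev G).
- move=> i; apply: ck_add.
    by rewrite addnAC; apply: IH; [exact: ck_D|exact: ckW].
  by rewrite -addnA; apply: IH; [exact: ckW|exact: ck_D].
- by move=> i z Oz; exact: is_derive_fmul (ck_derivable i F Oz) (ck_derivable i G Oz).
Qed.

Lemma ck_scale N k (c : R) f : ck N k f -> ck N k (fun z => c * f z).
Proof. by move=> F; exact: ck_mul (ck_cst N c) F. Qed.

Lemma ck_opp N k f : ck N k f -> ck N k (fun z => - f z).
Proof.
by move=> /(ck_scale (-1)); apply: ck_ext => z _; rewrite mulN1r.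
Qed.

Lemma ck_sub N k f g : ck N k f -> ck N k g -> ck N k (fun z => f z - g z).
Proof. by move=> F G; apply: ck_add => //; exact: ck_opp. Qed.

Lemma ck_sum N k (J : Type) (r : seq J) (F : J -> V -> R) :
  (forall j, ck N k (F j)) -> ck N k (fun z => \sum_(j <- r) F j z).
Proof.
move=> H; elim: r => [|j r IH].
  apply: (@ck_le _ 0%N) => //; apply: ck_ext (ck_cst N 0).
  by move=> z _; rewrite big_nil.
by apply: ck_ext (ck_add (H j) IH) => z _; rewrite big_cons.
Qed.

Lemma ck_exp N k m f : ck N k f -> ck N (m * k) (fun z => f z ^+ m).
Proof.
move=> F; elim: m => [|m IH]; first by rewrite mul0n; exact: ck_cst.
by rewrite mulSn; apply: ck_ext (ck_mul F IH) => z _; rewrite exprS.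
Qed.

Lemma ck_prod0 N (J : Type) (r : seq J) (F : J -> V -> R) :
  (forall j, ck N 0 (F j)) -> ck N 0 (fun z => \prod_(j <- r) F j z).
Proof.
move=> H; elim: r => [|j r IH].
  by apply: ck_ext (ck_cst N 1) => z _; rewrite big_nil.
by apply: ck_ext (ck_mul (H j) IH) => z _; rewrite big_cons.
Qed.

(** The derivative of 1/f is a polynomial in 1/f and the derivative of f, so the induction
    hypothesis for 1/f itself gives one more derivative; only the level of 1/f has to be supplied.
    [ck_rsqrt] works in the same way. *)
Lemma ck_inv N f : lev P 0 (fun z => (f z)^-1) -> (forall z, Om z -> f z != 0) ->
  ck N 0 f -> ck N 0 (fun z => (f z)^-1).
Proof.
move=> pf f0; elim: N => [|N IH] F; first by split.
have G := IH (ckW F).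
apply: (@ck_make _ _ _ (fun i z => (-1) * ((f z)^-1 * (f z)^-1 * 'D_(dir i) f z))).
- exact: pf.
- by move=> i; apply: ck_scale; exact: ck_mul (ck_mul G G) (ck_D i F).
- move=> i z Oz; have dz := ck_derivable i F Oz.
  have h := is_derive_fcomp (f := f) (is_deriveV (f0 _ Oz) (is_derive_id _ _)) dz.
  apply: (is_derive_eq h).
  by rewrite expr2 invfM mulN1r scaleNr [_ *: _]mulr1 mulNr.
Qed.

Lemma is_derive_rsqrt f z v d : 0 < f z -> is_derive z v f d ->
  is_derive z v (fun z => (Num.sqrt (f z))^-1)
    (- 2^-1 * ((Num.sqrt (f z))^-1) ^+ 3 * d).
Proof.
move=> f0 df; have s0 : Num.sqrt (f z) != 0 by rewrite gt_eqF// sqrtr_gt0.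
have h := is_derive_fcomp (h := fun y => (Num.sqrt y)^-1)
  (is_deriveV s0 (is_derive1_sqrt f0)) df.
apply: (is_derive_eq h); congr (_ * _).
by rewrite scaleNr [_ *: _]mulrC; field.
Qed.

Lemma ck_rsqrt N f : lev P 0 (fun z => (Num.sqrt (f z))^-1) ->
  (forall z, Om z -> 0 < f z) ->
  ck N 0 f -> ck N 0 (fun z => (Num.sqrt (f z))^-1).
Proof.
move=> pf f0; elim: N => [|N IH] F; first by split.
have G := IH (ckW F).
apply: (@ck_make _ _ _ (fun i z =>
  - 2^-1 * (((Num.sqrt (f z))^-1) ^+ 3 * 'D_(dir i) f z))).
- exact: pf.
- by move=> i; apply: ck_scale; exact: ck_mul (ck_exp 3 G) (ck_D i F).
- move=> i z Oz; have dz := ck_derivable i F Oz.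
  by rewrite mulrA; apply: is_derive_rsqrt => //; exact: f0.
Qed.

End ck.

Lemma continuous_at_rV {R : realType} {T : topologicalType} {n : nat}
  (f : T -> 'rV[R]_n) (x : T) :
  (forall j, {for x, continuous (fun y => f y ord0 j)}) -> {for x, continuous f}.
Proof.
move=> cf; apply/cvg_ballP => e e0.
have : \forall y \near x, forall j, ball (f x ord0 j) e (f y ord0 j).
  by apply: filter_forall => j; have /cvg_ballP/(_ _ e0) := cf j.
by apply: filterS => y fxy; split => // i j; rewrite (ord1 i); exact: fxy.
Qed.

(** * Lebesgue measure on row vectors *)

Section measurability_rV.
Context {R : realType} {n : nat}.
Local Notation rV := 'rV[R]_n.

Definition rect (A : 'I_n -> set R) : set rV := [set x | forall i, A i (x ord0 i)].

Lemma measurable_rect (A : 'I_n -> set R) :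
  (forall i, measurable (A i)) -> measurable (rect A).
Proof.
move=> mA; have -> : rect A = \bigcap_(i in [set: 'I_n])
    ((fun x : rV => x ord0 i) @^-1` A i).
  by apply/seteqP; split => x /= xA i => [_|]; exact: xA.
  apply: fin_bigcap_measurable => // i _.
by have := @measurable_rV_coord R n i measurableT (A i) (mA i); rewrite setTI.
Qed.

(** The sigma-algebra is generated by the coordinates; an open set is the union of the countably
    many boxes with rational endpoints that it contains. *)
Lemma open_measurable_rV (U : set rV) : open U -> measurable U.
Proof.
move=> oU.
pose box (c : {ffun 'I_n -> rat * rat}) : set rV :=
  rect (fun i => `](ratr (c i).1 : R), ratr (c i).2[%classic).
have -> : U = \bigcup_c (if `[< box c `<=` U >] then box c else set0).
  apply/seteqP; split => [x Ux|x [c _]]; last first.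
    by case: ifPn => // /asboolP; apply.
  have /nbhs_ballP[e /= e0 xeU] : nbhs x U by exact: open_nbhs_nbhs.
  have /choice[f fP] : forall i : 'I_n, exists q : rat * rat,
      [/\ x ord0 i - e < ratr q.1, (ratr q.1 : R) < x ord0 i,
          x ord0 i < ratr q.2 & (ratr q.2 : R) < x ord0 i + e].
    move=> i.
    have /rat_in_itvoo[p /[!in_itv]/= /andP[p1 p2]] : x ord0 i - e < x ord0 i.
      by rewrite ltrBlDr ltrDl.
    have /rat_in_itvoo[q /[!in_itv]/= /andP[q1 q2]] : x ord0 i < x ord0 i + e.
      by rewrite ltrDl.
    by exists (p, q).
  exists [ffun i => f i] => //.
  have bU : box [ffun i => f i] `<=` U.
    move=> y yb; apply: xeU; split => // i j; rewrite (ord1 i).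
    have := yb j; rewrite /= in_itv/= !ffunE => /andP[y1 y2].
    have [h1 h2 h3 h4] := fP j.
    by rewrite /ball/= ltr_distlC (lt_trans h1 y1) (lt_trans y2 h4).
  rewrite asboolT// => i /=; rewrite in_itv/= ffunE.
  by have [_ -> -> _] := fP i.
apply: countable_bigcupT_measurable => // c.
by case: ifPn => // _; apply: measurable_rect => i; exact: measurable_itv.
Qed.

Lemma continuous_measurable_rV (f : rV -> R) : continuous f -> measurable_fun setT f.
Proof.
move=> cf; apply: (measurability _ (RGenOpens.measurableE R)) => _ [_ [a [b ->] <-]].
rewrite setTI; apply: open_measurable_rV.
by move/continuousP : cf; apply; exact: interval_open.
Qed.

(** The preimage of an open interval is an open subset of the punctured space, together with the
    origin or not, whatever value is assigned there. *)
Lemma continuous_punctured_measurable (f : rV -> R) :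
  (forall x, x != 0 -> {for x, continuous f}) -> measurable_fun setT f.
Proof.
move=> cf; apply: (measurability _ (RGenOpens.measurableE R)) => _ [_ [a [b ->] <-]].
rewrite setTI; set S := (X in measurable X).
have m1 : measurable [set 0 : rV].
  rewrite (_ : [set 0] = rect (fun=> [set 0])); first exact: measurable_rect.
  apply/seteqP; split => [x -> i /=|x x0 /=]; first by rewrite mxE.
  by apply/rowP => i; rewrite mxE; exact: x0.
have oS : open (S `\ 0).
  rewrite openE => x [Sx /eqP x0].
  have nS : nbhs x S.
    by apply: cf => //; apply: open_nbhs_nbhs; split => //; exact: interval_open.
  have n0 : nbhs x (~` [set 0]).
    apply: open_nbhs_nbhs; split; last exact/eqP.
    by apply/closed_openC; exact: (accessible_closed_set1 (hausdorff_accessible (@norm_hausdorff _ _))).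
  by apply: filterS2 nS n0.
have -> : S = (S `\ 0) `|` (S `&` [set 0]) by rewrite setUC setUIDK.
apply: measurableU; first exact: open_measurable_rV.
have [S0|S0] := pselect (S 0).
  by rewrite (_ : S `&` _ = [set 0])// ; apply/seteqP; split => [x []|x ->].
by rewrite (_ : S `&` _ = set0)//; apply/seteqP; split => // x [/[swap] ->].
Qed.

End measurability_rV.

Section lebesgue_perm.
Context {R : realType}.

Lemma measurable_col_perm n (s : 'S_n) :
  measurable_fun [set: 'rV[R]_n] (col_perm s : 'rV[R]_n -> 'rV[R]_n).
Proof.
apply: measurable_fun_rVP => i.
rewrite (_ : (fun _ => _) = (fun x : 'rV[R]_n => x ord0 (s i))).
  exact: measurable_rV_coord.
by apply/funext => x; rewrite mxE.
Qed.

Let rects n : set (set 'rV[R]_n) :=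
  [set B | exists2 A : 'I_n -> set R, forall i, measurable (A i) & B = rect A].

(** The measure is built one coordinate at a time, so its symmetry is not visible. Both measures
    agree on boxes, which generate the sigma-algebra and are closed under intersection; the cubes
    [g k] of finite measure exhaust the space. *)
Lemma lebesgue_measure_rV_perm n (s : 'S_n) (A : set 'rV[R]_n) : measurable A ->
  lebesgue_measure_rV n (col_perm s @^-1` A) = lebesgue_measure_rV n A.
Proof.
pose m1 := @lebesgue_measure_rV R n.
pose m2 := measure_function_pushforward__canonical__measure_function_Measure
  m1 (measurable_col_perm s).
pose J k : set R := `]- k%:R, k%:R[%classic.
pose g k : set 'rV[R]_n := rect (fun=> J k).
move=> mA; apply/esym.
suff : m1 A = m2 A by [].
apply: (measure_unique (@rects n) g) => //.
- apply/seteqP; split => B; last first.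
    apply: smallest_sub; first exact: sigma_algebra_measurable.
    by move=> _ [C mC ->]; exact: measurable_rect.
  apply: smallest_sub; first exact: smallest_sigma_algebra.
  rewrite -bigcup_seq; apply: bigcup_sub => i _ C [D mD <-] /=.
  apply: sub_sigma_algebra; rewrite /rects/=; exists (fun j => if j == i then D else setT).
    by move=> j; case: ifP.
  rewrite setTI; apply/seteqP; split => x /=.
    by move=> Dx j; case: ifP => // /eqP ->.
  by move=> /(_ i); rewrite eqxx.
- move=> _ _ [C mC ->] [D mD ->]; rewrite /rects/=; exists (fun i => C i `&` D i).
    by move=> i; exact: measurableI.
  apply/seteqP; split => x /=; first by move=> [Cx Dx] i; split.
  by move=> CDx; split => i; have [] := CDx i.
- by move=> k; rewrite /rects/=; exists (fun=> J k) => // i; exact: measurable_itv.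
- apply/seteqP; split => // x _.
  pose M := \sum_i `|x ord0 i|.
  exists (Num.truncn M).+1 => // i /=; rewrite /J/= in_itv/= -ltr_norml.
  apply: le_lt_trans (truncnS_gt _).
  by rewrite /M (bigD1 i)//= lerDl sumr_ge0.
- move=> _ [C mC ->] /=; rewrite /m1 /pushforward.
  rewrite (_ : _ @^-1` _ = rect (fun i => C ((s^-1)%g i))); last first.
    apply/seteqP; split => x /= Cx i.
      by have := Cx ((s^-1)%g i); rewrite mxE permKV.
    by rewrite mxE; have := Cx (s i); rewrite permK.
  rewrite !lebesgue_measure_rV_box//; last by move=> i; exact: mC.
  by rewrite [RHS](reindex_inj (@perm_inj _ s))/=; apply: eq_bigr => i _; rewrite permK.
- move=> k; rewrite [X in (X < _)%E](_ : _ = m1 (rect (fun=> J k)))//.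
  rewrite /m1 (@lebesgue_measure_rV_box R n (fun=> J k)); last first.
    by move=> i; exact: measurable_itv.
  suff : (0 <= \prod_(i < n) @lebesgue_measure R (J k) < +oo)%E by case/andP.
  elim/big_ind : _ => [|x y /andP[x0 xoo] /andP[y0 yoo]|i _].
  + by rewrite lee01 ltry.
  + by rewrite mule_ge0// lte_mul_pinfty// ge0_fin_numE.
  + rewrite measure_ge0/= /J lebesgue_measure_itv/=; case: ifPn => _ //.
    by rewrite -EFinB ltry.
Qed.

End lebesgue_perm.

(** * Fubini's theorem and permutations of the coordinates *)

Section fubini_rV.
Context {R : realType}.
Local Open Scope ereal_scope.

Let perm_measure n (s : 'S_n) :=
  measure_function_pushforward__canonical__measure_function_Measure
    (@lebesgue_measure_rV R n) (measurable_col_perm s).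

Let integral_perm_measure n (s : 'S_n) (g : 'rV[R]_n -> \bar R) :
  \int[pushforward (lebesgue_measure_rV n) (col_perm s)]_x g x =
  \int[lebesgue_measure_rV n]_x g x.
Proof.
apply: (@eq_measure_integral _ _ _ _ (@lebesgue_measure_rV R n) (perm_measure s)).
by move=> A mA _; exact: lebesgue_measure_rV_perm.
Qed.

Lemma integrable_rV_perm n (s : 'S_n) (f : 'rV[R]_n -> \bar R) :
  (lebesgue_measure_rV n).-integrable setT f ->
  (lebesgue_measure_rV n).-integrable setT (f \o (col_perm s : 'rV[R]_n -> 'rV[R]_n)).
Proof.
move=> intf; have mf := measurable_int _ intf.
have mp := @measurable_col_perm R n s.
apply/integrableP; split; first exact: measurableT_comp.
move/integrableP : intf => [_].
rewrite -(integral_perm_measure s) ge0_integral_pushforward//.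
exact: measurableT_comp.
Qed.

Lemma integral_rV_perm n (s : 'S_n) (f : 'rV[R]_n -> \bar R) :
  (lebesgue_measure_rV n).-integrable setT f ->
  \int[lebesgue_measure_rV n]_x f (col_perm s x) = \int[lebesgue_measure_rV n]_x f x.
Proof.
move=> intf; have mf := measurable_int _ intf.
rewrite -[RHS](integral_perm_measure s) integral_pushforward//.
  exact: measurable_col_perm.
exact: integrable_rV_perm.
Qed.

Lemma integrable_rV_cons n (f : 'rV[R]_n.+1 -> \bar R) :
  (lebesgue_measure_rV n.+1).-integrable setT f ->
  (@lebesgue_measure R \x @lebesgue_measure_rV R n).-integrable setT (f \o @rV_cons R n).
Proof.
move=> intf; have mf := measurable_int _ intf.
have mc := @measurable_rV_cons R n.
apply/integrableP; split; first exact: measurableT_comp.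
move/integrableP : intf => [_].
rewrite /lebesgue_measure_rV -/lebesgue_measure_rV ge0_integral_pushforward//.
exact: measurableT_comp.
Qed.

Lemma integral_rV_cons n (f : 'rV[R]_n.+1 -> \bar R) :
  (lebesgue_measure_rV n.+1).-integrable setT f ->
  \int[lebesgue_measure_rV n.+1]_x f x =
  \int[lebesgue_measure_rV n]_y \int[lebesgue_measure]_t f (rV_cons (t, y)).
Proof.
move=> intf; have mf := measurable_int _ intf.
have intfc := integrable_rV_cons intf.
rewrite (integral21_prod_meas1 intfc).
rewrite /lebesgue_measure_rV -/lebesgue_measure_rV integral_pushforward//.
exact: measurable_rV_cons.
Qed.

End fubini_rV.

(** * Integrals of derivatives across a point singularity *)

Section integration_by_parts.
Context {R : realType}.
Local Notation e_ i := (delta_mx ord0 i).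

Lemma measure_rV_set1_0 n : (0 < n)%N -> @lebesgue_measure_rV R n [set 0] = 0%E.
Proof.
case: n => // n _; pose A := fun _ : 'I_n.+1 => [set 0 : R].
rewrite (_ : [set 0] = [set x : 'rV[R]_n.+1 | forall i, A i (x ord0 i)]).
  rewrite (@lebesgue_measure_rV_box R n.+1 A); last by move=> i; exact: measurable_set1.
  by rewrite big_ord_recl /A lebesgue_measure_set1 mul0e.
apply/seteqP; split => [x -> i /=|x x0 /=]; first by rewrite mxE.
by apply/rowP => i; rewrite mxE; exact: x0.
Qed.

Lemma measurable_rV_set1_0 n : measurable [set 0 : 'rV[R]_n].
Proof.
rewrite (_ : [set 0] = rect (fun=> [set 0])); first exact: measurable_rect.
apply/seteqP; split => [x -> i /=|x x0 /=]; first by rewrite mxE.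
by apply/rowP => i; rewrite mxE; exact: x0.
Qed.

Lemma rV_consE n t (y : 'rV[R]_n) : rV_cons (t, y) = t *: e_ ord0 + rV_cons (0, y).
Proof.
apply/rowP => j; rewrite !mxE/=; case: unliftP => [k ->|->] /=.
  by rewrite mulr0 add0r.
by rewrite mulr1 addr0.
Qed.

Lemma line_integral_derive (F f : R -> R) :
  (forall t : R, is_derive t (1 : R) F (f t)) -> continuous f ->
  (forall t, 1 <= `|t| -> F t = 0) ->
  (\int[lebesgue_measure]_t (f t)%:E = 0)%E.
Proof.
move=> dF cf F0.
have f0 t : 1 < `|t| -> f t = 0.
  move=> t1; have [_ <-] := dF t; rewrite (near_eq_derive (g := cst 0)).
    by rewrite derive_cst.
  near=> s; apply: F0; apply: ltW; near: s.
  exact: (cvgr_gt _ (@norm_continuous R R t)).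
rewrite (_ : (fun t => (f t)%:E) = (EFin \o f) \_ `[-2, 2]); last first.
  apply/funext => t; rewrite patchE; case: ifPn => //.
  rewrite notin_setE /= in_itv/= => /negP h.
  rewrite f0//; apply: contra_notT (negP h); rewrite -leNgt ler_norml => /andP[? ?].
  by apply/andP; split; lra.
rewrite -integral_mkcond (@continuous_FTC2 _ _ F)//.
- by rewrite !F0 ?subee// ?normrN ger0_norm// ler1n.
- by lra.
- exact: continuous_subspaceT.
- have cF : continuous F.
    by move=> t; apply/differentiable_continuous/derivable1_diffP; have [] := dF t.
  split => [t _||]; first by have [] := dF t.
  + exact: cvg_at_right_filter (cF _).
  + exact: cvg_at_left_filter (cF _).
- by move=> t _; rewrite derive1E; have [_ ->] := dF t.
Unshelve. all: by end_near. Qed.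

Lemma is_derive_shift_line (F : R -> R) (t a : R) :
  is_derive (0 : R) (1 : R) (fun h => F (h + t)) a -> is_derive t (1 : R) F a.
Proof.
move=> h; apply/is_derive_line; rewrite (_ : (fun _ => _) = fun h => F (h + t))//.
by apply/funext => s; rewrite [_ *: _]mulr1.
Qed.

(** A line parallel to the first axis misses the origin unless its other coordinates [y] all vanish,
    and [{0}] is null in the remaining [n > 0] dimensions. Hence the singularity leaves no boundary
    term as soon as [g] is integrable. *)
Let integral_derive0 n (G g : 'rV[R]_n.+1 -> R) : (0 < n)%N ->
  (forall (x : 'rV[R]_n.+1) j, 1 <= `|x ord0 j| -> G x = 0) ->
  (forall x, x != 0 -> is_derive x (e_ ord0) G (g x)) ->
  (forall x, x != 0 -> {for x, continuous g}) ->
  (lebesgue_measure_rV n.+1).-integrable setT (EFin \o g) ->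
  (\int[lebesgue_measure_rV n.+1]_x (g x)%:E = 0)%E.
Proof.
move=> n0 G0 dG cg intg; rewrite (integral_rV_cons intg)/=.
have E y : y != 0 -> (\int[lebesgue_measure]_t (g (rV_cons (t, y)))%:E = 0)%E.
  move=> y0.
  have ny t : rV_cons (t, y) != 0.
    apply: contraNneq y0 => ty; apply/eqP/rowP => j; rewrite mxE.
    by move/rowP/(_ (lift ord0 j)) : ty; rewrite !mxE liftK.
  apply: (line_integral_derive (F := fun t => G (rV_cons (t, y)))).
  - move=> t; apply: is_derive_shift_line.
    have := (is_derive_line _ _ _ _).1 (dG _ (ny t)).
    rewrite (_ : (fun h : R => G (h *: e_ ord0 + _)) = fun h => G (rV_cons (h + t, y)))//.
    by apply/funext => h; rewrite rV_consE [in RHS]rV_consE addrA scalerDl.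
  - move=> t; have := cg _ (ny t) => cgt.
    apply: (@continuous_comp _ _ _ (fun t => rV_cons (t, y)) g) => //.
    rewrite (_ : (fun t => rV_cons (t, y)) = fun t => t *: e_ ord0 + rV_cons (0, y)).
      by apply: cvgD; [apply: cvgZr_tmp; exact: cvg_id|exact: cvg_cst].
    by apply/funext => s; rewrite rV_consE.
  - by move=> t t1; apply: (G0 _ ord0); rewrite mxE unlift_none.
transitivity (\int[@lebesgue_measure_rV R n]_y (cst 0%E y))%E; last first.
  by rewrite integral_cst// mul0e.
have intfc : (@lebesgue_measure R \x @lebesgue_measure_rV R n)%E.-integrable setT
    ((EFin \o g) \o @rV_cons R n).
  exact: integrable_rV_cons.
apply: ae_eq_integral => //; first exact: (measurable_fubini_G intfc).
exists [set 0]; split; [exact: measurable_rV_set1_0|exact: measure_rV_set1_0|].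
move=> y /= /not_implyP[_ h]; apply: contrapT => /eqP y0; apply: h.
exact: E.
Qed.

(** A transposition of the coordinates, which preserves the measure, moves the direction [i] to the
    first place. *)
Lemma integral_derive n (i : 'I_n) (G g : 'rV[R]_n -> R) : (1 < n)%N ->
  (forall (x : 'rV[R]_n) j, 1 <= `|x ord0 j| -> G x = 0) ->
  (forall x, x != 0 -> is_derive x (e_ i) G (g x)) ->
  (forall x, x != 0 -> {for x, continuous g}) ->
  (lebesgue_measure_rV n).-integrable setT (EFin \o g) ->
  (\int[lebesgue_measure_rV n]_x (g x)%:E = 0)%E.
Proof.
case: n i G g => // n i G g n1 G0 dG cg intg.
pose s := tperm ord0 i; pose S := col_perm s : 'rV[R]_n.+1 -> 'rV[R]_n.+1.
have S0 x : x != 0 -> S x != 0.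
  apply: contraNneq => Sx0; apply/eqP/rowP => j.
  by move/rowP/(_ (s j)) : Sx0; rewrite !mxE tpermK.
rewrite -(integral_rV_perm s intg).
apply: (@integral_derive0 n (G \o S) (g \o S)) => //.
- by move=> x j x1; apply: (G0 _ (s j)); rewrite mxE tpermK.
- move=> x x0; apply/is_derive_line.
  have := (is_derive_line _ _ _ _).1 (dG _ (S0 _ x0)).
  rewrite (_ : (fun h : R => G (h *: e_ i + _)) = fun h => G (S (h *: e_ ord0 + x)))//.
  apply/funext => h; congr G; apply/rowP => j; rewrite !mxE/=.
  have -> : (j == i) = (s j == ord0); last by [].
  by rewrite -[LHS](inj_eq (@perm_inj _ s)) {2}/s tpermR.
- move=> x x0; apply: continuous_comp; last exact: cg (S0 _ x0).
  apply: continuous_at_rV => j.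
  rewrite (_ : (fun y => _) = fun y : 'rV[R]_n.+1 => y ord0 (s j)).
    exact: (@coord_continuous R 1 n.+1 ord0 (s j) x).
  by apply/funext => y; rewrite mxE.
- exact: (integrable_rV_perm s intg).
Qed.

End integration_by_parts.

Section euclidean_norm.
Context {R : realType} {n : nat}.
Implicit Types x y : 'rV[R]_n.

Lemma enorm_ge0 x : 0 <= enorm x.
Proof. exact: sqrtr_ge0. Qed.

Lemma enorm_sqr x : enorm x ^+ 2 = \sum_i x ord0 i ^+ 2.
Proof. by rewrite sqr_sqrtr// sumr_ge0// => i _; exact: sqr_ge0. Qed.

Lemma ler_coord_enorm x i : `|x ord0 i| <= enorm x.
Proof.
rewrite -ler_sqr ?nnegrE ?enorm_ge0// enorm_sqr real_normK ?num_real//.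
by rewrite (bigD1 i)//= lerDl sumr_ge0// => j _; exact: sqr_ge0.
Qed.

Lemma enorm_eq0 x : (enorm x == 0) = (x == 0).
Proof.
apply/eqP/eqP => [x0|->]; last first.
  by rewrite /enorm big1 ?sqrtr0// => i _; rewrite mxE expr0n.
apply/rowP => i; rewrite mxE; apply/eqP; rewrite -normr_le0 -x0.
exact: ler_coord_enorm.
Qed.

Lemma enorm_gt0 x : (0 < enorm x) = (x != 0).
Proof. by rewrite lt_def enorm_eq0 enorm_ge0 andbT. Qed.

Lemma coord_continuous_rV (i : 'I_n) : continuous (fun x : 'rV[R]_n => x ord0 i).
Proof. by move=> x; exact: (@coord_continuous R 1 n ord0 i x). Qed.

Lemma enorm_continuous : continuous (@enorm R n).
Proof.
move=> x; apply: continuous_comp; last exact: sqrt_continuous.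
apply: (@cvg_big _ _ _ _ _ _ _ (nbhs x)) => [z|i _]; first exact: add_continuous.
by rewrite expr2; apply: cvgM; exact: coord_continuous_rV.
Qed.

Lemma eball_measurable : measurable (@eball R n).
Proof.
apply: open_measurable_rV; rewrite (_ : @eball R n = @enorm R n @^-1` `]-oo, 1[%classic).
  by move: enorm_continuous => /continuousP; apply; exact: interval_open.
by apply/seteqP; split => x /=; rewrite /eball/= in_itv.
Qed.

Lemma lebesgue_measure_rV_cube (a b : R) : a <= b ->
  lebesgue_measure_rV n (rect (fun=> `]a, b[%classic)) = ((b - a) ^+ n)%:E.
Proof.
move=> ab; rewrite (@lebesgue_measure_rV_box R n (fun=> `]a, b[%classic)); last first.
  by move=> i; exact: measurable_itv.
have -> : @lebesgue_measure R `]a, b[ = (b - a)%:E.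
  rewrite lebesgue_measure_itv/= lte_fin; case: (ltP a b) => [_|ba].
    by rewrite -EFinB.
  have -> : b = a by apply/eqP; rewrite eq_le ba ab.
  by rewrite subrr.
elim: n => [|k IH]; first by rewrite big_ord0 expr0.
by rewrite big_ord_recl IH exprS EFinM.
Qed.

End euclidean_norm.

Definition rho {R : realType} {n : nat} (x : 'rV[R]_n) : R := (enorm x)^-1.

(** * Integrability of the critical weight *)

Section rho_integrable.
Context {R : realType} {n : nat}.
Local Notation mu := (@lebesgue_measure_rV R n).
Local Notation B := (@eball R n).

Lemma rho_ge0 (x : 'rV[R]_n) : 0 <= rho x.
Proof. by rewrite invr_ge0 enorm_ge0. Qed.

Lemma rho_gt0 (x : 'rV[R]_n) : x != 0 -> 0 < rho x.
Proof. by rewrite invr_gt0 enorm_gt0. Qed.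

Lemma rho_continuous (x : 'rV[R]_n) : x != 0 -> {for x, continuous (@rho R n)}.
Proof.
move=> x0; apply: continuousV; last exact: enorm_continuous.
by rewrite enorm_eq0.
Qed.

Lemma rho_measurable : measurable_fun setT (@rho R n).
Proof. by apply: continuous_punctured_measurable => x; exact: rho_continuous. Qed.

Lemma rho_ge1 (x : 'rV[R]_n) : B x -> x != 0 -> 1 <= rho x.
Proof. by move=> Bx x0; rewrite invf_ge1 ?enorm_gt0// ltW. Qed.

(** On the dyadic shell between the radii 2^-(k+1) and 2^-k the weight is at most 2^(8(k+1)), and
    the shell fits into a cube of volume 2^(n(1-k)); for [n >= 9] the products decay at least like
    2^-k. *)
Lemma rho_integrable : (9 <= n)%N ->
  mu.-integrable B (fun x => (rho x ^+ 8)%:E).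
Proof.
move=> n9; have mB := @eball_measurable R n.
have mr : measurable_fun B (fun x : 'rV[R]_n => (rho x ^+ 8)%:E).
  apply/measurable_EFinP; apply: measurable_funX.
  exact: measurable_funTS rho_measurable.
apply/integrableP; split => //.
under eq_integral do rewrite gee0_abs ?lee_fin ?exprn_ge0 ?rho_ge0//.
pose h k : R := (2 ^ k)%:R^-1.
have h0 k : 0 < h k by rewrite invr_gt0 ltr0n expn_gt0.
pose Q k : set 'rV[R]_n := rect (fun=> `]- h k, h k[%classic).
have mQ k : measurable (Q k) by apply: measurable_rect => i; exact: measurable_itv.
pose c k : R := (h k.+1)^-1 ^+ 8.
have c0 k : 0 <= c k by rewrite exprn_ge0// invr_ge0 ltW.
pose f k x : \bar R := ((c k)%:E * (\1_(Q k) x)%:E)%E.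
have f0 k x : (0 <= f k x)%E by rewrite mule_ge0// lee_fin// c0.
have mf k D : measurable_fun D (f k).
  by apply: measurable_funeM; apply/measurable_EFinP; exact: measurable_indic.
apply: (@le_lt_trans _ _ (\int[mu]_(x in B) \sum_(k <oo) f k x)%E).
  apply: ge0_le_integral => //.
  - by move=> x _; rewrite lee_fin exprn_ge0// rho_ge0.
  - by apply: ge0_emeasurable_sum => // k x _ _; exact: f0.
  - move=> x Bx; have [->|x0] := eqVneq x 0.
      have -> : @rho R n 0 = 0 by apply/eqP; rewrite /rho invr_eq0 enorm_eq0.
      by rewrite expr0n/=; apply: nneseries_ge0 => k _ _; exact: f0.
    (* The least such [k] is the index of the shell: its minimality gives the upper bound [h k] on
       the norm, the ball itself taking care of [k = 0]. *)
    have ex : exists k, h k.+1 <= enorm x.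
      exists (Num.truncn (rho x)).
      rewrite /h -[enorm x]invrK lef_pV2 ?posrE ?invr_gt0 ?enorm_gt0 ?ltr0n ?expn_gt0//.
      rewrite ltW//; apply: (lt_trans (truncnS_gt _)).
      by rewrite ltr_nat ltn_expl.
    have [k hk kmin] := ex_minnP ex.
    have xk : enorm x < h k.
      case: k hk kmin => [_ _|k _ kmin]; first by rewrite /h invr1; exact: Bx.
      by rewrite ltNge; apply/negP => /kmin; rewrite ltnn.
    have Qk : Q k x.
      move=> i /=; rewrite in_itv/= -ltr_norml.
      exact: le_lt_trans (ler_coord_enorm _ _) xk.
    apply: (@le_trans _ _ (f k x)).
      rewrite /f indicE mem_set// mule1 lee_fin.
      rewrite lerXn2r ?nnegrE ?rho_ge0 ?invr_ge0 ?(ltW (h0 _))//.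
      by rewrite lef_pV2 ?posrE ?enorm_gt0.
    have := @nneseries_lim_ge R (f ^~ x) xpredT 0%N k.+1 (fun i _ _ => f0 i x).
    by apply: le_trans; rewrite big_nat_recr//= leeDr// sume_ge0.
rewrite integral_nneseries; [|exact: mB|by move=> k; exact: mf|by move=> k x _; exact: f0].
(* The k-th term is at most 2^(8(k+1)) 2^n 2^(-9k) = 2^(n+9) / 2^(k+1), a geometric series with sum
   [C]. *)
pose C : R := 2 ^+ (n + 9).
apply: (@le_lt_trans _ _ C%:E); last exact: ltry.
apply: le_trans (epsilon_trick0 xpredT _); last exact: exprn_ge0.
apply: lee_nneseries => [k _ _|k _].
  by apply: integral_ge0 => x _; exact: f0.
rewrite ge0_integralZl_EFin; [|exact: mB|by move=> x _; rewrite lee_fin| |exact: c0];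
  last by apply/measurable_EFinP; exact: measurable_indic.
rewrite integral_indic//.
apply: (@le_trans _ _ ((c k)%:E * mu (Q k))%E).
  apply: lee_wpmul2l; first by rewrite lee_fin c0.
  by apply: le_measure; rewrite ?inE; [exact: measurableI|exact: mQ|exact: subIsetl].
rewrite lebesgue_measure_rV_cube; last by have := h0 k; lra.
rewrite opprK -EFinM lee_fin /c /C.
set T : R := 2 ^+ k.
have T1 : 1 <= T by rewrite exprn_ege1// ler1n.
have T0 : 0 < T := lt_le_trans ltr01 T1.
have -> : h k = T^-1 by rewrite /h natrX.
have -> : h k.+1 = (2 * T)^-1 by rewrite /h natrX exprS.
have -> : (2 ^ k.+1)%:R = 2 * T :> R by rewrite natrX exprS.
have -> : T^-1 + T^-1 = 2 / T by field; rewrite gt_eqF.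
have [m ->] : exists m, n = (9 + m)%N by exists (n - 9)%N; rewrite subnKC.
have Tm1 : (T^-1) ^+ m <= 1 by rewrite exprn_ile1// ?invr_ge0 ?(ltW T0)// invf_le1.
rewrite invrK (@exprMn R (9 + m)) (exprD T^-1) !exprD.
set M := (2 : R) ^+ m.
set S := T^-1 ^+ m in Tm1 *.
have -> : (2 * T) ^+ 8 * (2 ^+ 9 * M * (T^-1 ^+ 9 * S)) =
   2 ^+ 9 * M * 2 ^+ 8 * T^-1 * S by field; rewrite gt_eqF.
have -> : 2 ^+ 9 * M * 2 ^+ 9 / (2 * T) = 2 ^+ 9 * M * 2 ^+ 8 * T^-1.
  by field; rewrite gt_eqF.
by rewrite ger_pMr// !mulr_gt0// ?invr_gt0// exprn_gt0.
Qed.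

End rho_integrable.

(** * Functions singular at the origin *)

Section levels.
Context {R : realType}.

Definition smooth_level (V : normedModType R) : @level R V.
Proof.
refine (@Level R V setT (fun _ f => continuous f) openT _ _ _ _ _).
- by move=> _ f g fg; rewrite (_ : g = f)//; apply/funext => z; rewrite fg.
- by [].
- by move=> c z; exact: cvg_cst.
- by move=> _ f g cf cg z; apply: cvgD; [exact: cf|exact: cg].
- by move=> _ _ f g cf cg z; apply: cvgM; [exact: cf|exact: cg].
Defined.

Variables (n : nat) (V : normedModType R) (pr : V -> 'rV[R]_n) (T : set V).
Hypotheses (cpr : continuous pr) (oT : open T).

Definition sym_dom : set V := T `&` [set z | pr z != 0].

(* A singularity of order at most [k] at the origin; [pr] is the identity for
   functions of [x] and the second projection for functions of [(t, x)]. *)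
Definition sym_lev (k : nat) (f : V -> R) :=
  (forall z, sym_dom z -> {for z, continuous f}) /\
  exists C : R, forall z, sym_dom z -> eball (pr z) -> `|f z| <= C * rho (pr z) ^+ k.

Lemma sym_dom_open : open sym_dom.
Proof.
apply: openI => //.
have o0 : open [set x : 'rV[R]_n | x != 0].
  rewrite (_ : mkset _ = ~` [set 0]).
    apply/closed_openC.
    exact: (accessible_closed_set1 (hausdorff_accessible (@norm_hausdorff _ _))).
  by apply/seteqP; split => x /= /eqP.
by move: cpr => /continuousP/(_ _ o0).
Qed.

Lemma sym_lev_C k f : sym_lev k f -> exists2 C : R, 0 <= C &
  forall z, sym_dom z -> eball (pr z) -> `|f z| <= C * rho (pr z) ^+ k.
Proof.
move=> [_ [C HC]]; exists `|C| => // z Oz Bz; apply: le_trans (HC _ Oz Bz) _.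
by rewrite ler_wpM2r ?ler_norm// exprn_ge0// rho_ge0.
Qed.

Definition sym_level : @level R V.
Proof.
refine (@Level R V sym_dom sym_lev sym_dom_open _ _ _ _ _).
- move=> k f g fg [cf [C HC]]; split; last first.
  by exists C => z Oz Bz; rewrite -fg//; exact: HC.
move=> z Oz; have cfz : f @ z --> f z := cf _ Oz.
rewrite (fg _ Oz) in cfz; apply: cvg_trans cfz; apply: near_eq_cvg.
exact: near_open_eq sym_dom_open fg Oz.
(* Orders can be raised because [rho >= 1] on the punctured unit ball. *)
- move=> k l f kl /[dup] -[cf _] /sym_lev_C[C C0 HC]; split => //; exists C => z Oz Bz.
apply: le_trans (HC _ Oz Bz) _; apply: ler_wpM2l => //.
by apply: ler_weXn2l => //; apply: rho_ge1 => //; case: Oz.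
- move=> c; split => [z _|]; first exact: cvg_cst.
by exists `|c| => z _ _; rewrite expr0 mulr1.
- move=> k f g [cf [C HC]] [cg [D HD]]; split => [z Oz|].
  by apply: cvgD; [exact: cf|exact: cg].
exists (C + D) => z Oz Bz; rewrite mulrDl.
by apply: le_trans (ler_normD _ _) _; apply: lerD; [exact: HC|exact: HD].
- move=> k l f g [cf [C HC]] [cg [D HD]]; split => [z Oz|].
  by apply: cvgM; [exact: cf|exact: cg].
exists (C * D) => z Oz Bz; rewrite exprD mulrACA normrM.
by apply: ler_pM => //; [exact: HC|exact: HD].
Defined.

End levels.

Section instances.
Context {R : realType} {n : nat}.
Local Notation rV := 'rV[R]_n.
Local Notation e_ i := (delta_mx ord0 i : rV).
Local Notation B := (@eball R n).

Definition xdir (i : 'I_n) : rV := e_ i.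
Let id_continuous : continuous (id : rV -> rV). Proof. by move=> x; exact: cvg_id. Qed.
Let snd_continuous : continuous (snd : R * rV -> rV).
Proof. by move=> x; exact: cvg_snd. Qed.

Definition xlevel : level := @sym_level R n rV id setT id_continuous openT.
(* [Sx N k f]: off the origin [f] has [N] continuous derivatives, those of order
   [j] being O(rho^(k+j)) on the ball. *)
Definition Sx := @ck R rV 'I_n xdir (fun=> 1%N) xlevel.

Definition tslab (d : R) : set (R * rV)%type := [set z | `|z.1| < d].

Lemma tslab_open d : open (tslab d).
Proof.
have c : continuous (fun z : (R * rV)%type => `|z.1|).
  move=> z; have h : w.1 @[w --> z] --> z.1 by exact: cvg_fst.
  exact: cvg_norm h.
rewrite (_ : tslab d = (fun z : (R * rV)%type => `|z.1|) @^-1` `]-oo, d[%classic).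
  by move: c => /continuousP; apply; exact: interval_open.
by apply/seteqP; split => z /=; rewrite /tslab/= in_itv.
Qed.

(* [None] is the time direction; time derivatives do not worsen the singularity. *)
Definition tdir (i : option 'I_n) : (R * rV)%type :=
  if i is Some i then (0, e_ i) else (1, 0).
Definition tord (i : option 'I_n) : nat := if i is Some _ then 1 else 0.
Definition tlevel d : level :=
  @sym_level R n (R * rV)%type snd (tslab d) snd_continuous (@tslab_open d).
Definition St d := @ck R (R * rV)%type (option 'I_n) tdir tord (tlevel d).

Definition smooth_ck (N : nat) := @ck R rV 'I_n xdir (fun=> 0%N) (smooth_level rV) N 0.

Lemma xlevel_dom x : lev_dom xlevel x <-> x != 0.
Proof. by split => [[]|]. Qed.

Lemma Sx_derive N k f i x : Sx N.+1 k f -> x != 0 ->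
  is_derive x (e_ i) f ('D_(e_ i) f x).
Proof. by move=> F x0; apply: ck_derivable F _; apply/xlevel_dom. Qed.

Lemma Sx_D N k f i : Sx N.+1 k f -> Sx N k.+1 ('D_(e_ i) f).
Proof. by move=> /(ck_D i); rewrite addn1. Qed.

Lemma Sx_continuous N k f x : Sx N k f -> x != 0 -> {for x, continuous f}.
Proof. by move=> /ck_lev[c _] x0; apply: c; apply/xlevel_dom. Qed.

Lemma Sx_bound N k f : Sx N k f ->
  exists2 C : R, 0 <= C & forall x, x != 0 -> B x -> `|f x| <= C * rho x ^+ k.
Proof.
move=> /ck_lev/sym_lev_C[C C0 HC]; exists C => // x x0 Bx.
by apply: HC => //; apply/xlevel_dom.
Qed.

Lemma Sx_iter_partial s N k f : Sx (size s + N) k f ->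
  Sx N (k + size s) (iter_partial s f).
Proof.
elim: s N k f => [|i s IH] N k f; first by rewrite addn0.
rewrite addSnnS => /IH/(@Sx_D _ _ _ i).
by rewrite /= addnS.
Qed.

Lemma Sx_ext N k f g : (forall x, x != 0 -> f x = g x) -> Sx N k f -> Sx N k g.
Proof. by move=> fg; apply: ck_ext => x /xlevel_dom; exact: fg. Qed.

Lemma Sx_mul N k l f g : Sx N k f -> Sx N l g -> Sx N (k + l) (fun x => f x * g x).
Proof. exact: ck_mul. Qed.

Lemma Sx_add N k f g : Sx N k f -> Sx N k g -> Sx N k (fun x => f x + g x).
Proof. exact: ck_add. Qed.

Lemma Sx_sub N k f g : Sx N k f -> Sx N k g -> Sx N k (fun x => f x - g x).
Proof. exact: ck_sub. Qed.

Lemma Sx_scale N k (c : R) f : Sx N k f -> Sx N k (fun x => c * f x).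
Proof. exact: ck_scale. Qed.

Lemma Sx_exp N k m f : Sx N k f -> Sx N (m * k) (fun x => f x ^+ m).
Proof. exact: ck_exp. Qed.

Lemma Sx_sum N k (J : Type) (r : seq J) (F : J -> rV -> R) :
  (forall j, Sx N k (F j)) -> Sx N k (fun x => \sum_(j <- r) F j x).
Proof. exact: ck_sum. Qed.

Lemma SxW N k f : Sx N.+1 k f -> Sx N k f.
Proof. exact: ckW. Qed.

Lemma Sx_leN M N k f : (M <= N)%N -> Sx N k f -> Sx M k f.
Proof. exact: ck_leN. Qed.

Lemma Sx_make N k f (d : 'I_n -> rV -> R) :
  lev xlevel k f ->
  (forall i, Sx N k.+1 (d i)) ->
  (forall i x, x != 0 -> is_derive x (e_ i) f (d i x)) -> Sx N.+1 k f.
Proof.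
move=> fk dN df; apply: (@ck_make _ _ _ _ _ _ _ _ _ d) => //.
  by move=> i; rewrite addn1; exact: dN.
by move=> i x /xlevel_dom; exact: df.
Qed.

Lemma is_derive_coord (i j : 'I_n) x :
  is_derive x (e_ i) (fun y : rV => y ord0 j) (i == j)%:R.
Proof.
apply/is_derive_line.
rewrite (_ : (fun _ => _) = fun h : R => h * (i == j)%:R + x ord0 j); last first.
  by apply/funext => h; rewrite !mxE/= eq_sym.
have h1 : is_derive (0 : R) (1 : R) (fun h : R => h * (i == j)%:R) (1 * (i == j)%:R + 0 * 0).
  exact: is_derive_fmul (is_derive_id _ _) (is_derive_cst _ _ _).
have := is_derive_fadd h1 (is_derive_cst (x ord0 j) _ _).
by move/is_derive_eq; apply; rewrite mul1r mul0r !addr0.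
Qed.

Definition dirx (j : 'I_n) (x : rV) : R := x ord0 j / enorm x.

Lemma sum_dirx_sqr x : x != 0 -> \sum_i dirx i x ^+ 2 = 1.
Proof.
move=> x0; under eq_bigr do rewrite exprMn.
by rewrite -mulr_suml -enorm_sqr exprVn divff// expf_eq0/= enorm_eq0.
Qed.

Lemma is_derive_rho i x : x != 0 ->
  is_derive x (e_ i) (@rho R n) (- (dirx i x * rho x ^+ 2)).
Proof.
move=> x0.
have p : 0 < \sum_j x ord0 j ^+ 2 by rewrite -enorm_sqr exprn_gt0// enorm_gt0.
have d : is_derive x (e_ i) (fun y : rV => \sum_j y ord0 j ^+ 2) (x ord0 i *+ 2).
  have h j : is_derive x (e_ i) (fun y : rV => y ord0 j ^+ 2)
      ((i == j)%:R * x ord0 j + x ord0 j * (i == j)%:R).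
    rewrite (_ : (fun _ => _) = fun y : rV => y ord0 j * y ord0 j).
      exact: is_derive_fmul (is_derive_coord _ _ _) (is_derive_coord _ _ _).
    by apply/funext => y; rewrite expr2.
  have := is_derive_fsum (index_enum 'I_n) h; move/is_derive_eq; apply.
  rewrite (bigD1 i)//= eqxx mul1r mulr1 big1 ?addr0 -?mulr2n// => j ji.
  by rewrite eq_sym (negbTE ji) mul0r mulr0 addr0.
have := is_derive_rsqrt p d; move/is_derive_eq; apply.
rewrite -/(enorm x) /dirx /rho.
have e0 : enorm x != 0 by rewrite enorm_eq0.
by field.
Qed.

Lemma is_derive_dirx i j x : x != 0 ->
  is_derive x (e_ i) (dirx j) (((i == j)%:R - dirx i x * dirx j x) * rho x).
Proof.
move=> x0; have := is_derive_fmul (is_derive_coord i j x) (is_derive_rho i x0).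
move/is_derive_eq; apply; rewrite /dirx /rho.
have e0 : enorm x != 0 by rewrite enorm_eq0.
by field.
Qed.

Lemma dirx_le1 j x : `|dirx j x| <= 1.
Proof.
have [->|x0] := eqVneq x 0; first by rewrite /dirx mxE mul0r normr0.
rewrite normrM normfV (ger0_norm (enorm_ge0 _)) ler_pdivrMr ?enorm_gt0// mul1r.
exact: ler_coord_enorm.
Qed.

Lemma lev_rho : lev xlevel 1 (@rho R n).
Proof.
split => [x [_ x0]|]; first exact: rho_continuous.
by exists 1 => x _ _; rewrite mul1r expr1 ger0_norm// rho_ge0.
Qed.

Lemma lev_dirx j : lev xlevel 0 (dirx j).
Proof.
split => [x [_ x0]|]; last by exists 1 => x _ _; rewrite expr0 mulr1 dirx_le1.
have c1 : (fun y : rV => y ord0 j) @ x --> x ord0 j by exact: (@coord_continuous R 1 n ord0 j x).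
have c2 : rho y @[y --> x] --> rho x by exact: rho_continuous.
by have := cvgM c1 c2; apply.
Qed.

(** A joint induction, since the derivatives of [rho] and [dirx] are polynomials in both. *)
Lemma Sx_rho_dirx N : Sx N 1 (@rho R n) /\ forall j, Sx N 0 (dirx j).
Proof.
elim: N => [|N [Hr Hu]].
  by split => [|j]; split => //; [exact: lev_rho|exact: lev_dirx].
split => [|j].
  apply: (Sx_make (d := fun i x => - (dirx i x * rho x ^+ 2)) lev_rho).
    move=> i; apply: ck_opp; exact: (ck_mul (Hu i) (ck_exp 2 Hr)).
  by move=> i x; exact: is_derive_rho.
apply: (Sx_make (d := fun i x => ((i == j)%:R - dirx i x * dirx j x) * rho x) (lev_dirx j)).
  move=> i; apply: (@ck_mul _ _ _ _ _ _ N 0 1) => //.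
  apply: ck_sub; [exact: ck_cst|exact: (ck_mul (Hu i) (Hu j))].
by move=> i x; exact: is_derive_dirx.
Qed.

Lemma Sx_rho N : Sx N 1 (@rho R n). Proof. by have [] := Sx_rho_dirx N. Qed.
Lemma Sx_dirx N j : Sx N 0 (dirx j). Proof. by have [] := Sx_rho_dirx N. Qed.

End instances.

Section smooth_functions.
Context {R : realType} {n : nat}.
Local Notation rV := 'rV[R]_n.
Local Notation e_ i := (delta_mx ord0 i : rV).
Local Notation B := (@eball R n).
Implicit Types f g : rV -> R.

Lemma iter_partial_rcons s i f :
  iter_partial (rcons s i) f = iter_partial s ('D_(e_ i) f).
Proof. by rewrite /iter_partial foldr_rcons. Qed.

Lemma smooth_D f i : smooth f -> smooth ('D_(e_ i) f).
Proof. by move=> sf s; rewrite -iter_partial_rcons; exact: sf. Qed.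

Lemma smooth_iter_partial s f : smooth f -> smooth (iter_partial s f).
Proof.
by move=> sf r; have := sf (r ++ s); rewrite /iter_partial foldr_cat.
Qed.

Lemma smooth_continuous f : smooth f -> continuous f.
Proof. by move=> /(_ [::])[]. Qed.

Lemma smooth_derive f i x : smooth f -> is_derive x (e_ i) f ('D_(e_ i) f x).
Proof. by move=> /(_ [::])[_ /(_ i x)]; exact: derivableP. Qed.

Lemma smooth_smooth_ck f N : smooth f -> smooth_ck N f.
Proof.
elim: N f => [|N IH] f sf; first by split => //; exact: smooth_continuous.
apply: (@ck_make _ _ _ _ _ _ _ _ _ (fun i => 'D_(e_ i) f)).
- exact: smooth_continuous.
- by move=> i; apply: IH; exact: smooth_D.
- by move=> i x _; exact: smooth_derive.
Qed.

Lemma smooth_ck_smooth f : (forall N, smooth_ck N f) -> smooth f.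
Proof.
move=> sf s; have H : forall N, smooth_ck N (iter_partial s f).
  elim: s => [|i s IH] //= N.
  exact: (ck_D (f := iter_partial s f) i (IH N.+1)).
split; first by have /ck_lev := H 0%N.
move=> i x; have := @ck_derivable R rV _ xdir (fun=> 0%N) (smooth_level rV) 0 0 _ i x (H 1%N) I.
by case.
Qed.

Lemma continuous_ball_bounded f : continuous f ->
  exists2 C : R, 0 <= C & forall x, B x -> `|f x| <= C.
Proof.
move=> cf; pose K := [set x : rV | forall i, `[-1, 1]%classic (x ord0 i)].
have cK : compact K := rV_compact (fun i : 'I_n => @segment_compact R (-1) 1).
have cnf : continuous (fun x => `|f x|) by move=> x; exact: (cvg_norm (cf x)).
have K0 : K !=set0 by exists 0 => i /=; rewrite mxE in_itv/= lerN10 ler01.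
have [c _ Hc] := EVT_max_rV K0 cK (continuous_subspaceT cnf).
exists `|f c| => // x Bx; apply: Hc; rewrite inE => i /=.
rewrite in_itv/= -ler_norml; apply: le_trans (ler_coord_enorm _ _) _.
exact: ltW.
Qed.

Lemma smooth_Sx f N : smooth f -> Sx N 0 f.
Proof.
have H g : smooth g -> lev xlevel 0 g.
  move=> /smooth_continuous cg; split; first by move=> x _; exact: cg.
  have [C _ HC] := continuous_ball_bounded cg.
  by exists C => x _ Bx; rewrite expr0 mulr1; exact: HC.
elim: N f => [|N IH] f sf; first by split => //; exact: H.
apply: (Sx_make (d := fun i => 'D_(e_ i) f)) => [|i|i x _].
- exact: H.
- by apply: ck_le (IH _ (smooth_D i sf)).
- exact: smooth_derive.
Qed.

(** The support condition of a test function in a form that passes at once to products, sums and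
    derivatives, including those of functions singular at the origin; for smooth functions it is
    equivalent to [test_fun]. *)
Definition csupp f := exists2 c : R, c < 1 & forall x, c < enorm x -> f x = 0.

Lemma csuppW f x : csupp f -> 1 <= enorm x -> f x = 0.
Proof. by move=> [c c1 H] x1; apply: H; exact: lt_le_trans c1 x1. Qed.

Lemma csupp_mull f g : csupp f -> csupp (fun x => g x * f x).
Proof. by move=> [c c1 H]; exists c => // x /H ->; rewrite mulr0. Qed.

Lemma csupp_mulr f g : csupp f -> csupp (fun x => f x * g x).
Proof. by move=> [c c1 H]; exists c => // x /H ->; rewrite mul0r. Qed.

Lemma csupp0 : csupp (fun=> 0).
Proof. by exists 0. Qed.

Lemma csupp_sum (J : Type) (r : seq J) (F : J -> rV -> R) :
  (forall j, csupp (F j)) -> csupp (fun x => \sum_(j <- r) F j x).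
Proof.
move=> H; elim: r => [|j r [c c1 IH]].
  by exists 0 => // x _; rewrite big_nil.
have [d d1 K] := H j; exists (Num.max c d); first by rewrite gt_max c1.
by move=> x; rewrite gt_max big_cons => /andP[/IH -> /K ->]; rewrite addr0.
Qed.

Lemma csupp_D f i : csupp f -> csupp ('D_(e_ i) f).
Proof.
move=> [c c1 H]; exists c => // x cx.
rewrite (near_eq_derive (g := cst 0)) ?derive_cst//.
near=> y; apply: H; near: y.
exact: (cvgr_gt _ (enorm_continuous (x := x))).
Unshelve. all: by end_near. Qed.

Lemma csupp_iter_partial f s : csupp f -> csupp (iter_partial s f).
Proof. by move=> cf; elim: s => //= i s IH; exact: csupp_D. Qed.

Lemma test_fun_csupp f : test_fun f -> csupp f.
Proof.
move=> [_ cK KB]; set K := closure _ in cK KB.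
have subK x : f x != 0 -> K x by move=> fx; exact: subset_closure.
have [K0|K0] := pselect (K !=set0); last first.
  exists 0 => // x _; apply/eqP; apply: contrapT => /negP fx.
  by apply: K0; exists x; exact: subK.
have [c cKc Hc] := EVT_max_rV K0 cK (continuous_subspaceT (@enorm_continuous R n)).
exists (enorm c); first by apply: KB; rewrite inE in cKc.
move=> x cx; apply/eqP; apply: contraTT cx => fx; rewrite -leNgt.
by apply: Hc; rewrite inE; exact: subK.
Qed.

Lemma csupp_test_fun f : smooth f -> csupp f -> test_fun f.
Proof.
move=> sf [c c1 H]; set S := [set x | f x != 0].
have clE : closed [set x : rV | enorm x <= c].
  rewrite (_ : mkset _ = @enorm R n @^-1` `]-oo, c]%classic).
    by apply: preimage_closed => [x _|]; [exact: enorm_continuous|exact: interval_closed].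
  by apply/seteqP; split => x /=; rewrite in_itv.
have SE : closure S `<=` [set x | enorm x <= c].
  rewrite [X in _ `<=` X](closure_id _).1//; apply: closureS => x /=.
  by apply: contra_neqT; rewrite -ltNge => /H.
split => //; last by move=> x /SE /= xc; exact: le_lt_trans xc c1.
pose K := [set x : rV | forall i, `[-1, 1]%classic (x ord0 i)].
have cK : compact K := rV_compact (fun i : 'I_n => @segment_compact R (-1) 1).
apply: (subclosed_compact _ cK); first exact: closed_closure.
move=> x /SE /= xc i /=; rewrite in_itv/= -ler_norml.
apply: le_trans (ler_coord_enorm _ _) _; apply: le_trans xc _; exact: ltW.
Qed.

End smooth_functions.

(** * Integration by parts and weak derivatives on the ball *)

Section ball_integrals.
Context {R : realType} {n : nat}.
Local Notation rV := 'rV[R]_n.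
Local Notation e_ i := (delta_mx ord0 i : rV).
Local Notation mu := (@lebesgue_measure_rV R n).
Local Notation B := (@eball R n).
Local Notation intB f := (mu.-integrable B (fun x => (f x)%:E)).
Implicit Types f g : rV -> R.

Lemma mu_eball_lty : (mu B < +oo)%E.
Proof.
apply: (@le_lt_trans _ _ (mu (rect (fun=> `](-1), 1[%classic)))).
  apply: le_measure; rewrite ?inE; [exact: eball_measurable| |].
    by apply: measurable_rect => i; exact: measurable_itv.
  move=> x Bx i /=; rewrite in_itv/= -ltr_norml.
  exact: le_lt_trans (ler_coord_enorm x i) Bx.
by rewrite lebesgue_measure_rV_cube ?ltry//; lra.
Qed.

Lemma intB_cst (c : R) : intB (fun=> c).
Proof.
apply/integrableP; split; first exact: measurable_cst.
rewrite integral_cst//; last exact: eball_measurable.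
by rewrite lte_mul_pinfty// mu_eball_lty.
Qed.

Lemma intB_le f g : measurable_fun B f -> intB g ->
  (forall x, B x -> `|f x| <= g x) -> intB f.
Proof.
move=> mf ig fg; apply: le_integrable ig; first exact: eball_measurable.
  exact/measurable_EFinP.
by move=> x Bx /=; rewrite lee_fin; apply: le_trans (fg x Bx) _; exact: ler_norm.
Qed.

Lemma intB_add f g : intB f -> intB g ->
  intB (fun x => f x + g x).
Proof. by move=> fi gi; have := integrableD eball_measurable fi gi. Qed.

Lemma intB_sub f g : intB f -> intB g ->
  intB (fun x => f x - g x).
Proof. by move=> fi gi; have := integrableB eball_measurable fi gi. Qed.

Lemma intB_scale (c : R) f : intB f -> intB (fun x => c * f x).
Proof. by move=> fi; have := integrableZl eball_measurable c fi. Qed.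

Lemma intB_sum (J : Type) (r : seq J) (F : J -> rV -> R) :
  (forall j, intB (F j)) -> intB (fun x => \sum_(j <- r) F j x).
Proof.
move=> H; elim: r => [|j r IH].
  rewrite (_ : (fun _ => _) = (fun=> 0%:E)); first exact: intB_cst.
  by apply/funext => x; rewrite big_nil.
rewrite (_ : (fun _ => _) = (fun x => (F j x + \sum_(j <- r) F j x)%:E)).
  exact: intB_add.
by apply/funext => x; rewrite big_cons.
Qed.

Definition IB f : R := \int[mu]_(x in B) f x.

Lemma IB_add f g : intB f -> intB g ->
  IB (fun x => f x + g x) = IB f + IB g.
Proof. by move=> fi gi; rewrite /IB RintegralD//; exact: eball_measurable. Qed.

Lemma IB_sub f g : intB f -> intB g ->
  IB (fun x => f x - g x) = IB f - IB g.
Proof. by move=> fi gi; rewrite /IB RintegralB//; exact: eball_measurable. Qed.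

Lemma IB_scale (c : R) f : intB f -> IB (fun x => c * f x) = c * IB f.
Proof. by move=> fi; rewrite /IB RintegralZl//; exact: eball_measurable. Qed.

Lemma IB_0 : IB (fun=> 0) = 0.
Proof. by rewrite /IB /Rintegral integral0. Qed.

Lemma IB_sum (J : Type) (r : seq J) (F : J -> rV -> R) :
  (forall j, intB (F j)) ->
  IB (fun x => \sum_(j <- r) F j x) = \sum_(j <- r) IB (F j).
Proof.
move=> H; elim: r => [|j r IH].
  rewrite big_nil -[RHS]IB_0; congr IB; apply/funext => x; exact: big_nil.
rewrite big_cons -IH -IB_add//; last exact: intB_sum.
by congr IB; apply/funext => x; exact: big_cons.
Qed.

Lemma IB_ge0 f : (forall x, B x -> 0 <= f x) -> 0 <= IB f.
Proof. exact: Rintegral_ge0. Qed.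

Lemma IB_le f g : intB f -> intB g ->
  (forall x, B x -> f x <= g x) -> IB f <= IB g.
Proof. by move=> fi gi; apply: le_Rintegral => //; exact: eball_measurable. Qed.

Definition aeB (P : rV -> Prop) := {ae mu, forall x, B x -> P x}.

Lemma aeB_imp (P Q : rV -> Prop) : (forall x, B x -> P x -> Q x) -> aeB P -> aeB Q.
Proof. by move=> PQ; rewrite /aeB; apply: filterS => x Px Bx; exact/PQ/Px. Qed.

Lemma aeB_and (P Q : rV -> Prop) : aeB P -> aeB Q -> aeB (fun x => P x /\ Q x).
Proof.
by rewrite /aeB => p q; apply: filterS2 p q => x Px Qx Bx; split; [exact: Px|exact: Qx].
Qed.

Lemma aeB_forall m (P : 'I_m -> rV -> Prop) : (forall i, aeB (P i)) ->
  aeB (fun x => forall i, P i x).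
Proof.
rewrite /aeB => H; have : {ae mu, forall x, forall i, B x -> P i x}.
  by apply: filter_forall => i; exact: H.
by apply: filterS => x Px Bx i; exact: Px.
Qed.

Lemma aeB_nonzero : (0 < n)%N -> aeB (fun x => x != 0).
Proof.
move=> n0; exists [set 0]; split; [exact: measurable_rV_set1_0|exact: measure_rV_set1_0|].
by move=> x /= /not_implyP[_ /negP/negPn/eqP].
Qed.

Lemma IB_ae f g : measurable_fun B f -> measurable_fun B g ->
  aeB (fun x => f x = g x) -> IB f = IB g.
Proof.
move=> mf mg fg; rewrite /IB /Rintegral; congr fine; apply: ae_eq_integral.
- exact: eball_measurable.
- exact/measurable_EFinP.
- exact/measurable_EFinP.
- by move: fg; rewrite /aeB; apply: filterS => x h Bx; rewrite /= h.
Qed.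

Lemma IB_ge0_ae f : measurable_fun B f -> aeB (fun x => 0 <= f x) -> 0 <= IB f.
Proof.
move=> mf f0; rewrite (_ : IB f = IB (fun x => `|f x|)); first exact: IB_ge0.
apply: IB_ae => //; first exact: measurableT_comp.
by apply: aeB_imp f0 => x _ fx; rewrite ger0_norm.
Qed.

Lemma measurableB_rho : measurable_fun B (@rho R n).
Proof. exact: measurable_funTS rho_measurable. Qed.

Lemma Sx_measurable N k f : Sx N k f -> measurable_fun B f.
Proof.
move=> F; apply: measurable_funTS; apply: continuous_punctured_measurable => x.
exact: Sx_continuous F.
Qed.

Hypothesis n9 : (9 <= n)%N.
Let n0 : (0 < n)%N. Proof. exact: leq_trans n9. Qed.

Lemma Sx_integrable N k f : (k <= 8)%N -> Sx N k f -> intB f.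
Proof.
move=> k8 F; have mf := Sx_measurable F.
have [C C0 HC] := Sx_bound (ck_le k8 F).
(* The symbol bound says nothing at the origin; the constant covers that point. *)
apply: (@intB_le _ (fun x => C * rho x ^+ 8 + `|f 0|)) => //.
  apply: intB_add; last exact: intB_cst.
  by apply: intB_scale; exact: rho_integrable.
move=> x Bx; have [->|x0] := eqVneq x 0.
  by rewrite lerDr mulr_ge0// exprn_ge0// rho_ge0.
by apply: le_trans (HC _ x0 Bx) _; rewrite lerDl.
Qed.

Lemma Sx_L2 N k f : (k <= 4)%N -> Sx N k f -> L2 f.
Proof.
move=> k4 F; split; first exact: Sx_measurable F.
by apply: (@Sx_integrable N (2 * k)); [rewrite (leq_mul2l 2 k 4)|exact: ck_exp].
Qed.

(** Order 7 is the limit: the derivative then has order 8 and is integrable. The compact support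
    allows the integral to be taken over the whole space. *)
Lemma IB_derive0 N k i f : (k <= 7)%N -> Sx N.+1 k f -> csupp f ->
  IB ('D_(e_ i) f) = 0.
Proof.
move=> k7 F cf; have DF := Sx_D i F; have cDf := csupp_D i cf.
have E' : (fun x => ('D_(e_ i) f x)%:E) \_ B = (fun x => ('D_(e_ i) f x)%:E).
  apply/funext => x; rewrite patchE; case: ifPn => //; rewrite notin_setE.
  by rewrite /eball/= => /negP; rewrite -leNgt => /(csuppW cDf) ->.
have iD : intB ('D_(e_ i) f) by exact: Sx_integrable DF.
have mB := @eball_measurable R n.
rewrite /IB /Rintegral integral_mkcond.
rewrite E' (_ : (\int[mu]_x ('D_(e_ i) f x)%:E = 0)%E)//.
have n1 : (1 < n)%N by exact: leq_trans n9.
apply: (integral_derive (i := i) (G := f) n1).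
- by move=> x j xj; apply: csuppW => //; apply: le_trans xj _; exact: ler_coord_enorm.
- by move=> x x0; exact: Sx_derive F x0.
- by move=> x x0; exact: Sx_continuous DF x0.
- by rewrite -[X in _.-integrable _ X]E' -integrable_mkcond.
Qed.

Lemma IB_parts N i k l f g : (k + l <= 7)%N -> Sx N.+1 k f -> Sx N.+1 l g ->
  csupp f \/ csupp g ->
  IB (fun x => 'D_(e_ i) f x * g x) = - IB (fun x => f x * 'D_(e_ i) g x).
Proof.
move=> kl F G cfg.
have FG := ck_mul F G.
have cFG : csupp (fun x => f x * g x).
  by case: cfg => ?; [exact: csupp_mulr|exact: csupp_mull].
have i1 : intB (fun x => 'D_(e_ i) f x * g x).
  apply: (@Sx_integrable N (k.+1 + l)); first by rewrite addSn.
  exact: ck_mul (Sx_D i F) (ckW G).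
have i2 : intB (fun x => f x * 'D_(e_ i) g x).
  apply: (@Sx_integrable N (k + l.+1)); first by rewrite addnS.
  exact: ck_mul (ckW F) (Sx_D i G).
apply/eqP; rewrite -addr_eq0 -IB_add//; apply/eqP.
rewrite -[RHS](IB_derive0 i kl FG cFG).
have H x : x != 0 -> 'D_(e_ i) (fun x => f x * g x) x =
    'D_(e_ i) f x * g x + f x * 'D_(e_ i) g x.
  move=> x0.
  by have [] := is_derive_fmul (Sx_derive i F x0) (Sx_derive i G x0).
apply: IB_ae.
- apply: measurable_funD; apply: measurable_funM.
  + exact: Sx_measurable (Sx_D i F).
  + exact: Sx_measurable G.
  + exact: Sx_measurable F.
  + exact: Sx_measurable (Sx_D i G).
- exact: Sx_measurable (Sx_D i FG).
- by apply: aeB_imp (aeB_nonzero n0) => x _ /H ->.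
Qed.

(** Each integration by parts takes the outermost derivative off the test function and makes it the
    innermost one on [f], hence the reversal; partial derivatives of [f] are not commuted. *)
Lemma Sx_is_weak_partial s k f : (k + size s <= 8)%N -> Sx (size s) k f ->
  is_weak_partial s f (iter_partial (rev s) f).
Proof.
move=> ks F phi tphi; have cp := test_fun_csupp tphi; have [sp _ _] := tphi.
have sps r : smooth (iter_partial r phi) := smooth_iter_partial r sp.
elim: s k f ks F => [|i s IH] k f ks F.
  by rewrite expr0 mul1r.
have k7 : (k + 0 <= 7)%N.
  by rewrite addn0 -ltnS; apply: leq_trans ks; rewrite /= addnS ltnS leq_addr.
have E : IB (fun x => f x * 'D_(e_ i) (iter_partial s phi) x) =
    - IB (fun x => 'D_(e_ i) f x * iter_partial s phi x).
  have F' : Sx (size s).+1 k f by exact: F.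
  rewrite (IB_parts i k7 F' (smooth_Sx (size s).+1 (sps s))) ?opprK//.
  by right; exact: csupp_iter_partial.
rewrite -[LHS]/(IB (fun x => f x * 'D_(e_ i) (iter_partial s phi) x)) E.
have ks' : (k.+1 + size s <= 8)%N by rewrite addSnnS.
rewrite [IB _](IH k.+1 _ ks' (Sx_D i F)) /= exprS mulN1r mulNr.
by rewrite rev_cons iter_partial_rcons.
Qed.

(** Four derivatives cost rho^4, and rho^8 is integrable. *)
Lemma Sx_sobolev N f : (4 <= N)%N -> Sx N 0 f -> sobolev 4 f.
Proof.
move=> N4 F; split; first exact: Sx_L2 F.
move=> s s4; exists (iter_partial (rev s) f).
  apply: (@Sx_L2 0 (0 + size (rev s))); first by rewrite size_rev.
  apply: Sx_iter_partial; rewrite addn0 size_rev.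
  by apply: ck_leN F; exact: leq_trans N4.
apply: (@Sx_is_weak_partial s 0); first by rewrite (leq_trans s4).
by apply: ck_leN F; exact: leq_trans N4.
Qed.

End ball_integrals.

(** * Flat functions, the building blocks of cutoffs *)

Section flat_functions.
Context {R : realType}.

(* The family is indexed by [k] because its span, unlike that of [flat 0] alone,
   is stable under differentiation. *)
Definition flat (k : nat) (y : R) : R := if 0 < y then y ^- k * expR (- y^-1) else 0.

Lemma flat_le0 k y : y <= 0 -> flat k y = 0.
Proof. by rewrite /flat ltNge => ->. Qed.

Lemma flat_ge0 k y : 0 <= flat k y.
Proof.
rewrite /flat; case: ltP => // y0.
by rewrite mulr_ge0 ?expR_ge0// invr_ge0 exprn_ge0// ltW.
Qed.

(** From exp(z) >= z^(k+2) / (k+2)! at z = 1/y. A quadratic bound is enough to make the derivative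
    at 0 vanish. *)
Lemma flat_le_sqr k y : flat k y <= (k.+2)`!%:R * y ^+ 2.
Proof.
rewrite /flat; case: ltP => y0; last by rewrite mulr_ge0// sqr_ge0.
have z0 : 0 <= y^-1 by rewrite invr_ge0 ltW.
have := expR_ge1Dxn k.+1 z0; rewrite expRN.
set f : R := (k.+2)`!%:R; have f0 : 0 < f by rewrite ltr0n fact_gt0.
have y20 : 0 < y^-1 ^+ k.+2 by rewrite exprn_gt0// invr_gt0.
move=> h; have {}h : y^-1 ^+ k.+2 / f <= expR y^-1 by apply: le_trans h; rewrite lerDr.
apply: (@le_trans _ _ (y ^- k * (y^-1 ^+ k.+2 / f)^-1)).
  rewrite ler_wpM2l ?invr_ge0 ?exprn_ge0 ?(ltW y0)//.
  by rewrite lef_pV2// posrE ?expR_gt0// divr_gt0.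
rewrite invf_div !exprVn invrK !exprS.
have yn0 : y != 0 by rewrite gt_eqF.
have yk : y ^+ k != 0 by rewrite expf_neq0.
have fn0 : f != 0 by rewrite gt_eqF.
rewrite le_eqVlt; apply/orP; left; apply/eqP.
by field; rewrite ?yn0 ?yk ?fn0.
Qed.

Lemma is_derive_flat k (y : R) :
  is_derive y (1 : R) (flat k) (- k%:R * flat k.+1 y + flat k.+2 y).
Proof.
have [y0|y0|->] := ltgtP y 0.
- rewrite !flat_le0 ?(ltW y0)// mulr0 addr0.
  have h := is_derive_cst (0 : R) y (1 : R); apply: (near_eq_is_derive _ h).
  near=> z; rewrite flat_le0//; apply: ltW; near: z; exact: lt_nbhsl.
- have yn0 : y != 0 by rewrite gt_eqF.
  have yk : y ^+ k != 0 by rewrite expf_neq0.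
  have dv : is_derive y (1 : R) (fun z : R => z^-1) (- y ^- 2).
    have := is_deriveV (lt0r_neq0 y0) (is_derive_id y (1 : R)).
    by move/is_derive_eq; apply; rewrite [_ *: _]mulr1.
  have de : is_derive y (1 : R) (fun z : R => expR (- z^-1)) (expR (- y^-1) * y ^- 2).
    have := is_derive_fcomp (f := fun z : R => - z^-1) (is_derive_expR (- y^-1)) (is_derive_fopp dv).
    by rewrite opprK.
  have dk : is_derive y (1 : R) (fun z : R => z ^- k) (- k%:R * y ^- k.+1).
    have hX : is_derive y (1 : R) (fun z : R => z ^+ k) (k%:R * y ^+ k.-1).
      have := is_deriveX k (is_derive_id y (1 : R)).
      by rewrite exprfctE => h; apply: (is_derive_eq h); rewrite [_ *: _]mulr1.
    have := is_deriveV (f := fun z : R => z ^+ k) _ hX.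
    move=> /(_ _)/is_derive_eq; apply; first by rewrite expf_neq0// gt_eqF.
    rewrite /= scaleNr [_ *: _]mulrA.
    case: k {hX} yk => [|k] yk; first by rewrite mulr0 !mul0r oppr0 mul0r.
    have yk' : y ^+ k != 0 by rewrite expf_neq0.
    by rewrite /= !exprS; field; rewrite ?yn0 ?yk'.
  have h : is_derive y (1 : R) (fun z : R => z ^- k * expR (- z^-1))
      (- k%:R * flat k.+1 y + flat k.+2 y).
    have h := is_derive_fmul dk de; apply: (is_derive_eq h).
    by rewrite /flat y0 !exprS; field; rewrite ?yn0 ?yk.
  apply: (near_eq_is_derive _ h).
  near=> z; have z0 : 0 < z by near: z; exact: lt_nbhsr.
  by rewrite /flat z0.
- rewrite !flat_le0// mulr0 addr0.
  set C : R := (k.+2)`!%:R.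
  have C0 : 0 < C by rewrite ltr0n fact_gt0.
  have H : (fun h : R => h^-1 *: (flat k (h *: 1 + 0) - flat k 0)) @ 0^' --> (0 : R).
    apply/cvgr0Pnorm_lt => e e0; near=> h.
    have hn0 : h != 0 by near: h; exact: nbhs_dnbhs_neq.
    rewrite [flat k 0]flat_le0// subr0 addr0 [h *: 1]mulr1 normrM normfV.
    rewrite ltr_pdivrMl ?normr_gt0// (ger0_norm (flat_ge0 _ _)).
    apply: le_lt_trans (flat_le_sqr _ _) _.
    rewrite -/C -real_normK ?num_real// expr2 mulrCA ltr_pM2l ?normr_gt0//.
    rewrite -ltr_pdivlMl// mulrC.
    near: h; apply: dnbhs0_lt; exact: divr_gt0.
  split; first by apply/cvg_ex; exists 0.
  by apply: cvg_lim H.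
Unshelve. all: by end_near. Qed.

Definition smooth1 (f : R -> R) :=
  forall N, @ck R R unit (fun=> 1) (fun=> 0%N) (smooth_level R) N 0 f.

Lemma flat_smooth1 k : smooth1 (flat k).
Proof.
have cF j : continuous (flat j).
  by move=> y; apply/differentiable_continuous/derivable1_diffP; have [] := is_derive_flat j y.
move=> N; elim: N k => [|N IH] k; first by split => //; exact: cF.
apply: (@ck_make _ _ _ _ _ _ _ _ _ (fun _ y => - k%:R * flat k.+1 y + flat k.+2 y)).
- exact: cF.
- by move=> _; apply: ck_add; [apply: ck_scale|]; exact: IH.
- by move=> _ y _; exact: is_derive_flat.
Qed.

Lemma flat0_le1 y : flat 0 y <= 1.
Proof.
rewrite /flat; case: ifPn => // y0; rewrite expr0 invr1 mul1r -[leRHS]expR0 ler_expR.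
by rewrite oppr_le0 invr_ge0 ltW.
Qed.

Lemma flat0_gt0 y : 0 < y -> 0 < flat 0 y.
Proof. by rewrite /flat => ->; rewrite expr0 invr1 mul1r expR_gt0. Qed.

Lemma flat0_cvg (s c : R) : 0 < s -> flat 0 (k.+1%:R * s - c) @[k --> \oo] --> (1 : R).
Proof.
move=> s0; apply/cvgrPdist_lt => e e0; near=> k.
have kb : e^-1 + c < k.+1%:R * s.
  rewrite -ltr_pdivrMr//; near: k.
  exists (Num.truncn ((e^-1 + c) / s)) => // k /= hk.
  by apply: lt_le_trans (truncnS_gt _) _; rewrite ler_nat ltnS.
set z := _ - c; have ze : e^-1 < z by rewrite /z ltrBrDr.
have z0 : 0 < z by apply: lt_trans ze; rewrite invr_gt0.
rewrite ger0_norm ?subr_ge0 ?flat0_le1//.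
rewrite /flat z0 expr0 invr1 mul1r.
apply: (@le_lt_trans _ _ z^-1).
  by rewrite lerBlDr -lerBlDl; have := expR_ge1Dx (- z^-1); lra.
by rewrite -[e]invrK ltf_pV2 ?posrE ?invr_gt0.
Unshelve. all: by end_near. Qed.

Lemma smooth1_comp (V : normedModType R) (I : Type) (dir : I -> V) (h : R -> R) (f : V -> R) :
  smooth1 h -> (forall N, ck dir (fun=> 0%N) (smooth_level V) N 0 f) ->
  forall N, ck dir (fun=> 0%N) (smooth_level V) N 0 (fun x => h (f x)).
Proof.
move=> sh sf N.
have C g : smooth1 g -> continuous (fun x => g (f x)).
  move=> sg x; apply: continuous_comp; first by have /ck_lev := sf 0%N; apply.
  by have /ck_lev := sg 0%N; apply.
elim: N h sh => [|N IH] h sh; first by split => //; exact: C.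
have sh' : smooth1 ('D_1 h) by move=> M; exact: (ck_D tt (sh M.+1)).
apply: (@ck_make _ _ _ _ _ _ _ _ _ (fun i x => 'D_1 h (f x) * 'D_(dir i) f x)).
- exact: C.
- by move=> i; apply: (ck_mul (IH _ sh')); exact: (ck_D i (sf N.+1)).
- move=> i x _; apply: is_derive_fcomp.
    exact: (@ck_derivable R R unit (fun=> 1) (fun=> 0%N) (smooth_level R) 0 0 h tt (f x) (sh 1%N)).
  exact: (@ck_derivable R V I dir (fun=> 0%N) (smooth_level V) 0 0 f i x (sf 1%N)).
Qed.

End flat_functions.

(** * The fundamental lemma and uniqueness of weak derivatives *)

Section fundamental_lemma.
Context {R : realType} {n : nat}.
Local Notation rV := 'rV[R]_n.
Local Notation mu := (@lebesgue_measure_rV R n).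
Local Notation B := (@eball R n).
Implicit Types f g : rV -> R.

Lemma smooth_ck_coord N (i : 'I_n) : smooth_ck N (fun x : rV => x ord0 i).
Proof.
have c : continuous (fun x : rV => x ord0 i) := @coord_continuous_rV R n i.
case: N => [|N]; first by split.
apply: (@ck_make _ _ _ _ _ _ _ _ _ (fun j => cst (j == i)%:R)) => //.
  by move=> j; exact: ck_cst.
by move=> j x _; exact: is_derive_coord.
Qed.

Lemma smooth_ck_sqnorm N : smooth_ck N (fun x : rV => enorm x ^+ 2).
Proof.
apply: (@ck_ext _ _ _ _ _ _ _ _ (fun x : rV => \sum_i x ord0 i ^+ 2)).
  by move=> x _; rewrite enorm_sqr.
by apply: ck_sum => i; have := ck_exp 2 (smooth_ck_coord N i); rewrite muln0.
Qed.

Definition half_space_factor (o : option R) (k : nat) (y : R) : R :=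
  if o is Some a then flat 0 (k.+1%:R * (y - a)) else 1.

(** As [k] grows these tend on the ball to the indicator of [corner c], while staying below 1. The
    shift by 1 makes the first factor vanish for |x|^2 >= 1 - 1/(k+1), so that the support is
    compact in the open ball. *)
Definition bump (k : nat) (c : 'I_n -> option R) (x : rV) : R :=
  flat 0 (k.+1%:R * (1 - enorm x ^+ 2) - 1) *
  \prod_i half_space_factor (c i) k (x ord0 i).

(** Free coordinates ([None]) are allowed so that these sets are closed under intersection, include
    the whole space and include the preimages of half-lines under single coordinates, which generate
    the sigma-algebra. *)
Definition corner (c : 'I_n -> option R) : set rV :=
  rect (fun i => if c i is Some a then `]a, +oo[%classic else setT).

Lemma bump_test_fun k c : test_fun (bump k c).
Proof.
apply: csupp_test_fun.
  apply: smooth_ck_smooth => N; apply: (@ck_mul _ _ _ _ _ _ N 0 0).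
    apply: smooth1_comp; first exact: flat_smooth1.
    move=> M; apply: ck_sub; last exact: ck_cst.
    apply: ck_scale; apply: ck_sub; [exact: ck_cst|exact: smooth_ck_sqnorm].
  apply: ck_prod0 => i; rewrite /half_space_factor.
  case: (c i) => [a|]; last exact: ck_cst.
  apply: (smooth1_comp (h := flat 0)); first exact: flat_smooth1.
  move=> M; apply: ck_scale; apply: ck_sub; [exact: smooth_ck_coord|exact: ck_cst].
have k1 : (k.+1%:R : R)^-1 <= 1 by rewrite invf_le1// ler1n.
exists (Num.sqrt (1 - k.+1%:R^-1)).
  rewrite -[ltRHS]sqrtr1 ltr_sqrt// ltrBlDr ltrDl invr_gt0//.
move=> x xs; rewrite /bump flat_le0 ?mul0r// subr_le0 -ler_pdivlMl// mulr1.
rewrite lerBlDr -lerBlDl.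
have : Num.sqrt (1 - k.+1%:R^-1) ^+ 2 <= enorm x ^+ 2.
  by rewrite ler_sqr ?nnegrE ?sqrtr_ge0 ?enorm_ge0// ltW.
by rewrite sqr_sqrtr// subr_ge0.
Qed.

Lemma bump_norm_le1 k c x : `|bump k c x| <= 1.
Proof.
have P : 0 <= \prod_i half_space_factor (c i) k (x ord0 i) <= 1.
  apply/andP; split.
    by apply: prodr_ge0 => i _; rewrite /half_space_factor; case: (c i) => // a; exact: flat_ge0.
  apply: prodr_ile1 => i _; rewrite /half_space_factor.
  by case: (c i) => [a|]; rewrite ?flat_ge0 ?flat0_le1 ?ler01 ?lexx.
case/andP: P => P0 P1.
rewrite ger0_norm; last by rewrite mulr_ge0// flat_ge0.
by rewrite mulr_ile1// ?flat_ge0// flat0_le1.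
Qed.

Lemma bump_cvg c x : B x -> bump k c x @[k --> \oo] --> (\1_(corner c) x : R).
Proof.
move=> Bx; rewrite indicE.
have s0 : 0 < 1 - enorm x ^+ 2.
  by rewrite subr_gt0 expr_lt1// enorm_ge0.
have h1 : flat 0 (k.+1%:R * (1 - enorm x ^+ 2) - 1) @[k --> \oo] --> (1 : R).
  exact: flat0_cvg.
have h2 i : half_space_factor (c i) k (x ord0 i) @[k --> \oo] -->
    ((x ord0 i \in (if c i is Some a then `]a, +oo[%classic else setT : set R))%:R : R).
  rewrite /half_space_factor; case: (c i) => [a|]; last first.
    by rewrite in_setT; exact: cvg_cst.
  have [ax|xa] := ltP a (x ord0 i).
    rewrite mem_set/=; last by rewrite in_itv/= ax.
    have := @flat0_cvg R (x ord0 i - a) 0; rewrite subr_gt0 => /(_ ax).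
    by under eq_fun do rewrite subr0.
  rewrite memNset/=; last by rewrite in_itv/= andbT => /(le_lt_trans xa); rewrite ltxx.
  under eq_fun do rewrite flat_le0 ?pmulr_rle0 ?ltr0n// ?subr_le0//.
  exact: cvg_cst.
have h3 : \prod_i half_space_factor (c i) k (x ord0 i) @[k --> \oo] -->
    (\prod_i (x ord0 i \in (if c i is Some a then `]a, +oo[%classic else setT : set R))%:R : R).
  apply: (@cvg_big _ _ _ _ _ _ _ \oo) => [z|i _]; last exact: h2.
  exact: mul_continuous.
have -> : ((x \in corner c)%:R : R) = 1 * \prod_i
    (x ord0 i \in (if c i is Some a then `]a, +oo[%classic else setT : set R))%:R.
  rewrite mul1r; have [xc|xc] := boolP (x \in corner c).
    rewrite big1// => i _; rewrite mem_set//; move: xc; rewrite inE => /(_ i).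
    by [].
  rewrite (_ : \prod_i _ = 0)//; apply/eqP/prodf_eq0.
  move: xc; rewrite notin_setE => /existsNP[i Hi]; exists i => //.
  by rewrite memNset.
exact: cvgM h1 h3.
Qed.

Let corners : set (set rV) := [set A | exists c, A = corner c].

Lemma measurable_corners : @measurable _ rV = <<s corners >>.
Proof.
have mcorner c : measurable (corner c).
  apply: measurable_rect => i; case: (c i) => [a|]; last exact: measurableT.
  exact: measurable_itv.
apply/seteqP; split => S; last first.
  apply: smallest_sub; first exact: sigma_algebra_measurable.
  by move=> _ [c ->].
apply: smallest_sub; first exact: smallest_sigma_algebra.
rewrite -bigcup_seq; apply: bigcup_sub => i _ _ [D mD <-] /=.
rewrite setTI.
have : (@RGenOInfty.G R).-sigma.-measurable D by rewrite -RGenOInfty.measurableE.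
move: D {mD}.
suff : <<s @RGenOInfty.G R >> `<=` [set D | <<s corners >> ((fun x : rV => x ord0 i) @^-1` D)].
  by [].
apply: smallest_sub.
  split.
  - by rewrite /= preimage_set0; exact: sigma_algebra0.
  - by move=> A /= sA; rewrite setTD preimage_setC -setTD; exact: sigma_algebraCD.
  - by move=> F /= sF; rewrite preimage_bigcup; exact: sigma_algebra_bigcup.
move=> _ [a ->] /=; apply: sub_sigma_algebra.
exists (fun j => if j == i then Some a else None).
apply/seteqP; split => x /=.
  by move=> xa j; case: eqP => [->|].
by move=> /(_ i); rewrite eqxx.
Qed.

Lemma cornersI : setI_closed corners.
Proof.
move=> _ _ [c ->] [d ->].
exists (fun i => match c i, d i with
  | Some a, Some b => Some (Num.max a b) | Some a, None => Some a | None, o => o end).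
apply/seteqP; split => x.
  move=> [cx dx] i; have := cx i; have := dx i.
  case: (c i) (d i) => [a|] [b|] //=.
  by rewrite !in_itv/= !andbT gt_max => -> ->.
move=> cd; split => i; have := cd i.
all: case: (c i) (d i) => [a|] [b|] //=.
all: by rewrite !in_itv/= !andbT gt_max => /andP[].
Qed.

Lemma L2_integrable f : L2 f -> mu.-integrable B (fun x => (f x)%:E).
Proof.
move=> [mf if2]; apply: (@intB_le _ _ _ (fun x => 1 + f x ^+ 2)) => //.
  by apply: intB_add => //; exact: intB_cst.
move=> x _; have := sqr_ge0 (`|f x| - 1); rewrite sqrrB real_normK ?num_real//.
by have := normr_ge0 (f x); nra.
Qed.

(** Dominated convergence along [bump] shows that the integral of [g] over every corner vanishes.
    Dynkin's theorem extends this to all measurable sets, and a function whose integrals all vanish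
    is zero almost everywhere. *)
Lemma fundamental_lemma g : mu.-integrable B (fun x => (g x)%:E) ->
  (forall phi, test_fun phi -> IB (fun x => g x * phi x) = 0) ->
  aeB (fun x => g x = 0).
Proof.
move=> ig H; have mB := @eball_measurable R n.
have mg : measurable_fun B g by apply/measurable_EFinP; exact: measurable_int ig.
pose f := (fun x => (g x)%:E) \_ B.
have intf : mu.-integrable setT f by apply/(integrable_mkcond _ mB); exact: ig.
have If A : measurable A -> (\int[mu]_(x in A) f x = \int[mu]_(x in B) ((g x * \1_A x)%:E))%E.
  move=> mA; rewrite integral_mkcond [RHS]integral_mkcond; apply: eq_integral => x _.
  rewrite /f !patchE indicE; case: (x \in A); case: (x \in B) => //.
    by rewrite mulr1.
  by rewrite mulr0.
have fc c : (\int[mu]_(x in corner c) f x = 0)%E.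
  have mc : measurable (corner c).
    apply: measurable_rect => i; case: (c i) => [a|]; last exact: measurableT.
    exact: measurable_itv.
  rewrite If//.
  have [] := @dominated_convergence _ _ _ mu B mB
    (fun k x => (g x * bump k c x)%:E) (fun x => (g x * \1_(corner c) x)%:E)
    (fun x => `|(g x)%:E|%E).
  - move=> k; apply/measurable_EFinP; apply: measurable_funM => //.
    apply: measurable_funTS; apply: continuous_measurable_rV.
    by have [/smooth_continuous] := bump_test_fun k c.
  - by apply/measurable_EFinP; apply: measurable_funM => //; exact: measurable_indic.
  - apply: aeW => x Bx; apply: cvg_EFin; first exact: nearW.
    by apply: cvgM; [exact: cvg_cst|exact: bump_cvg].
  - exact: integrable_abse.
  - apply: aeW => x k Bx; rewrite lee_fin normrM ler_piMr//; exact: bump_norm_le1.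
  move=> ic _ cv.
  have E k : (\int[mu]_(x in B) (g x * bump k c x)%:E = 0)%E.
    have ib : mu.-integrable B (fun x => (g x * bump k c x)%:E).
      apply: (@intB_le _ _ _ (fun x => `|g x|)).
      + apply: measurable_funM => //.
        apply: measurable_funTS; apply: continuous_measurable_rV.
        by have [/smooth_continuous] := bump_test_fun k c.
      + by have := integrable_abse ig.
      + by move=> x Bx; rewrite normrM ler_piMr//; exact: bump_norm_le1.
    have := H _ (bump_test_fun k c); rewrite /IB /Rintegral => h.
    by rewrite -[LHS]fineK ?h//; exact: integrable_fin_num.
  apply/esym; apply: cvg_unique cv; first exact: ereal_hausdorff.
  rewrite (_ : (fun _ => _) = cst 0%E); first exact: cvg_cst.
  by apply/funext => k; exact: E.
have fA A : measurable A -> (\int[mu]_(x in A) f x = 0)%E.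
  rewrite measurable_corners.
  apply: (@dynkin_induction _ rV corners (fun A => \int[mu]_(x in A) f x = 0)%E).
  - exact: measurable_corners.
  - exact: cornersI.
  - have <- : corner (fun=> None) = setT by apply/seteqP; split.
    exact: fc.
  - by move=> _ [c ->]; exact: fc.
  - move=> S mS S0.
    have := @integral_setU _ _ _ mu S (~` S) f mS (measurableC mS).
    rewrite setUv => /(_ (measurable_int _ intf)).
    rewrite S0 add0e => <-.
      have <- : corner (fun=> None) = setT by apply/seteqP; split.
      exact: fc.
    by apply/disj_set2P; rewrite setICr.
  - move=> F mF tF F0; rewrite integral_bigcup//.
      by apply: eseries0 => k _ _.
    by apply: integrableS intf => //; exact: bigcup_measurable.
have := @integral_ae_eq _ _ _ mu setT measurableT (cst 0%E) f intf (measurable_cst _).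
have h0 (E : set rV) : E `<=` setT -> measurable E ->
    (\int[mu]_(x in E) f x = \int[mu]_(x in E) cst 0 x)%E.
  by move=> _ mE; rewrite fA// integral_cst// mul0e.
move=> /(_ h0); rewrite /aeB; apply: filterS => x /(_ I) fx Bx.
by move: fx; rewrite /f patchE mem_set// => -[].
Qed.

Lemma weak_partial_unique s f g1 g2 : L2 g1 -> L2 g2 ->
  is_weak_partial s f g1 -> is_weak_partial s f g2 -> aeB (fun x => g1 x = g2 x).
Proof.
move=> L1 L2' w1 w2.
have i1 := L2_integrable L1; have i2 := L2_integrable L2'.
have ib g phi : mu.-integrable B (fun x => (g x)%:E) -> test_fun phi ->
    mu.-integrable B (fun x => (g x * phi x)%:E).
  move=> ig [/smooth_continuous cphi _ _].
  have mphi : measurable_fun B phi.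
    by apply: measurable_funTS; exact: continuous_measurable_rV.
  have mg : measurable_fun B g by apply/measurable_EFinP; exact: measurable_int ig.
  have [C C0 HC] := continuous_ball_bounded cphi.
  apply: (@intB_le _ _ _ (fun x => C * `|g x|)).
  - exact: measurable_funM.
  - by apply: intB_scale; have := integrable_abse ig.
  - by move=> x Bx; rewrite normrM mulrC ler_wpM2r// HC.
have h : aeB (fun x => g1 x - g2 x = 0).
  apply: fundamental_lemma; first exact: intB_sub.
  move=> phi tphi; have := w1 _ tphi; rewrite w2// => E.
  have sE (a : R) : (-1) ^+ size s * ((-1) ^+ size s * a) = a.
    by rewrite mulrA -exprMn mulrNN mulr1 expr1n mul1r.
  have {}E : IB (fun x => g1 x * phi x) = IB (fun x => g2 x * phi x).
    by rewrite -[LHS]sE -[RHS]sE /IB E.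
  rewrite (_ : (fun x => _) = fun x => g1 x * phi x - g2 x * phi x).
    by rewrite IB_sub ?E ?subrr//; exact: ib.
  by apply/funext => x; rewrite mulrBl.
by apply: aeB_imp h => x _ /eqP; rewrite subr_eq0 => /eqP.
Qed.

End fundamental_lemma.

(* Locked: comparing two unfolded Laplacians is very expensive for the unifier. *)
HB.lock Definition lap (R : realType) (n : nat) (f : 'rV[R]_n -> R) : 'rV[R]_n -> R :=
  fun x => \sum_i 'D_(delta_mx ord0 i) ('D_(delta_mx ord0 i) f) x.
Arguments lap {R n} f _.

(** * The Laplacian off the origin *)

Section laplacian.
Context {R : realType} {n : nat}.
Local Notation rV := 'rV[R]_n.
Local Notation e_ i := (delta_mx ord0 i : rV).
Implicit Types f g : rV -> R.

Lemma lapE f : lap f = fun x => \sum_i 'D_(e_ i) ('D_(e_ i) f) x.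
Proof. by rewrite lap.unlock. Qed.

Lemma open_punctured : open [set x : rV | x != 0].
Proof.
have := lev_open (@xlevel R n).
by rewrite (_ : lev_dom _ = [set x | x != 0])//; apply/seteqP; split => x /xlevel_dom.
Qed.

Lemma D_ext f g i x : (forall z, z != 0 -> f z = g z) -> x != 0 ->
  'D_(e_ i) f x = 'D_(e_ i) g x.
Proof. by move=> fg x0; apply: near_eq_derive; exact: near_open_eq open_punctured fg x0. Qed.

Lemma lap_ext f g x : (forall z, z != 0 -> f z = g z) -> x != 0 -> lap f x = lap g x.
Proof.
move=> fg x0; rewrite !lapE; apply: eq_bigr => i _; apply: D_ext x0 => z z0; exact: D_ext.
Qed.

Lemma D_val f i x a : is_derive x (e_ i) f a -> 'D_(e_ i) f x = a.
Proof. by case. Qed.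

Lemma Sx_D_add N k l f g i x : Sx N.+1 k f -> Sx N.+1 l g -> x != 0 ->
  'D_(e_ i) (fun z => f z + g z) x = 'D_(e_ i) f x + 'D_(e_ i) g x.
Proof.
by move=> F G x0; apply: D_val; exact: is_derive_fadd (Sx_derive i F x0) (Sx_derive i G x0).
Qed.

Lemma Sx_D_scale N k c f i x : Sx N.+1 k f -> x != 0 ->
  'D_(e_ i) (fun z => c * f z) x = c * 'D_(e_ i) f x.
Proof.
move=> F x0; apply: D_val.
have := is_derive_fmul (is_derive_cst c x (e_ i)) (Sx_derive i F x0).
by move/is_derive_eq; apply; rewrite mul0r add0r.
Qed.

Lemma Sx_D_sum N k (J : Type) (r : seq J) (F : J -> rV -> R) i x :
  (forall j, Sx N.+1 k (F j)) -> x != 0 ->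
  'D_(e_ i) (fun z => \sum_(j <- r) F j z) x = \sum_(j <- r) 'D_(e_ i) (F j) x.
Proof.
by move=> HF x0; apply: D_val; apply: is_derive_fsum => j; exact: Sx_derive (HF j) x0.
Qed.

Lemma Sx_lap N k f : Sx N.+2 k f -> Sx N k.+2 (lap f).
Proof. by move=> F; rewrite lapE; apply: ck_sum => i; exact: Sx_D i (Sx_D i F). Qed.

Lemma lap_add N k l f g x : Sx N.+2 k f -> Sx N.+2 l g -> x != 0 ->
  lap (fun z => f z + g z) x = lap f x + lap g x.
Proof.
move=> F G x0; rewrite !lapE -big_split/=; apply: eq_bigr => i _.
rewrite -(Sx_D_add i (Sx_D i F) (Sx_D i G) x0).
by apply: D_ext x0 => z z0; exact: Sx_D_add F G z0.
Qed.

Lemma lap_scale N k c f x : Sx N.+2 k f -> x != 0 ->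
  lap (fun z => c * f z) x = c * lap f x.
Proof.
move=> F x0; rewrite !lapE mulr_sumr; apply: eq_bigr => i _.
rewrite -(Sx_D_scale c i (Sx_D i F) x0).
by apply: D_ext x0 => z z0; exact: Sx_D_scale F z0.
Qed.

Lemma lap0 x : lap (fun _ : rV => 0) x = 0.
Proof.
rewrite lapE big1// => k _; rewrite (_ : 'D_(e_ k) (fun=> 0) = cst 0) ?derive_cst//.
by apply/funext => z; rewrite derive_cst.
Qed.

Lemma csupp_lap f : csupp f -> csupp (lap f).
Proof. by move=> cf; rewrite lapE; apply: csupp_sum => i; apply: csupp_D; exact: csupp_D. Qed.

Lemma smooth_add f g : smooth f -> smooth g -> smooth (fun x => f x + g x).
Proof.
move=> sf sg; apply: smooth_ck_smooth => N.
by apply: ck_add; exact: smooth_smooth_ck.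
Qed.

Lemma smooth_sum (J : Type) (r : seq J) (F : J -> rV -> R) :
  (forall j, smooth (F j)) -> smooth (fun x => \sum_(j <- r) F j x).
Proof.
move=> sF; apply: smooth_ck_smooth => N.
by apply: ck_sum => j; exact: smooth_smooth_ck.
Qed.

Lemma smooth_mul f g : smooth f -> smooth g -> smooth (fun x => f x * g x).
Proof.
move=> sf sg; apply: smooth_ck_smooth => N; apply: (@ck_mul _ _ _ _ _ _ N 0 0);
exact: smooth_smooth_ck.
Qed.

Lemma smooth_lap f : smooth f -> smooth (lap f).
Proof. by move=> sf; rewrite lapE; apply: smooth_sum => i; apply: smooth_D; exact: smooth_D. Qed.

(** Exchanging the two sums accounts for the reversal, so this needs no commutation of partial
    derivatives. *)
Lemma lap_lapE N k f x : Sx N.+4 k f -> x != 0 ->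
  lap (lap f) x = \sum_(i < n) \sum_(j < n) iter_partial (rev [:: i; i; j; j]) f x.
Proof.
move=> F x0; have F2 j := Sx_D j (Sx_D j F); have F3 i j := Sx_D i (F2 j).
rewrite !lapE exchange_big/=; apply: eq_bigr => i _.
transitivity ('D_(e_ i) (fun z => \sum_j 'D_(e_ i) ('D_(e_ j) ('D_(e_ j) f)) z) x).
  by apply: D_ext x0 => z z0; exact: Sx_D_sum F2 z0.
exact: (Sx_D_sum (index_enum 'I_n) i (F3 i) x0).
Qed.

Lemma is_derive_rhoX i (x : rV) a : x != 0 ->
  is_derive x (e_ i) (fun z : rV => rho z ^+ a) (- (a%:R * (dirx i x * rho x ^+ a.+1))).
Proof.
move=> x0; elim: a => [|a IH].
  rewrite mul0r oppr0 (_ : (fun _ => _) = cst 1); first exact: is_derive_cst.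
  by apply/funext => z; rewrite expr0.
rewrite (_ : (fun _ => _) = fun z => rho z * rho z ^+ a); last first.
  by apply/funext => z; rewrite exprS.
have h := is_derive_fmul (is_derive_rho i x0) IH; apply: (is_derive_eq h).
by rewrite !exprS -addn1 natrD; ring.
Qed.

Lemma Sx_rhoX N a : Sx N a (fun x : rV => rho x ^+ a).
Proof. by have := ck_exp a (Sx_rho (R := R) (n := n) N); rewrite muln1. Qed.

Lemma sum_dirx_mix j (x : rV) (al be ga : R) : x != 0 ->
  \sum_i (al * ((i == j)%:R * dirx i x) + be * dirx i x ^+ 2 + ga) =
  al * dirx j x + be + n%:R * ga.
Proof.
move=> x0; rewrite !big_split/= -!mulr_sumr sum_dirx_sqr// mulr1.
rewrite (bigD1 j)//= eqxx mul1r big1 ?addr0 => [|i /negbTE ->]; last by rewrite mul0r.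
by rewrite sumr_const card_ord mulr_natl.
Qed.

(** [dirx j] is a spherical harmonic of degree 1: the radial factor gives a(a+2-n), the sphere gives
    -(n-1), and the sum is -(a+1)(n-1-a). The exponents 0, 2, 4, 6 yield the factors of
    [lap4_const]. *)
Lemma lap_rhoX_dirx a j (x : rV) : x != 0 ->
  lap (fun z : rV => rho z ^+ a * dirx j z) x =
  - (a.+1%:R * (n%:R - 1 - a%:R)) * (rho x ^+ a.+2 * dirx j x).
Proof.
move=> x0; have hA : a.+1%:R = a%:R + 1 :> R by rewrite -addn1 natrD.
have D1 i z : z != 0 -> is_derive z (e_ i) (fun z : rV => rho z ^+ a * dirx j z)
    (rho z ^+ a.+1 * ((i == j)%:R - a.+1%:R * (dirx i z * dirx j z))).
  move=> z0; have h := is_derive_fmul (is_derive_rhoX i a z0) (is_derive_dirx i j z0).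
  by apply: (is_derive_eq h); rewrite !exprS hA; ring.
have D2 i : 'D_(e_ i) ('D_(e_ i) (fun z : rV => rho z ^+ a * dirx j z)) x =
    (- 2 * a.+1%:R * rho x ^+ a.+2) * ((i == j)%:R * dirx i x) +
    (a.+1%:R * (a%:R + 3) * rho x ^+ a.+2 * dirx j x) * dirx i x ^+ 2 +
    (- a.+1%:R * rho x ^+ a.+2 * dirx j x).
  rewrite (@D_ext _ (fun z : rV => rho z ^+ a.+1 *
    ((i == j)%:R - a.+1%:R * (dirx i z * dirx j z))))//; last first.
    by move=> z z0; exact: D_val (D1 i z z0).
  apply: D_val.
  have h1 := is_derive_fmul (is_derive_cst (a.+1%:R : R) x (e_ i))
    (is_derive_fmul (is_derive_dirx i i x0) (is_derive_dirx i j x0)).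
  have h2 := is_derive_fadd (is_derive_cst ((i == j)%:R : R) x (e_ i)) (is_derive_fopp h1).
  have h := is_derive_fmul (is_derive_rhoX i a.+1 x0) h2.
  apply: (is_derive_eq h); rewrite /= eqxx [true%:R]mulr1n !exprS hA; ring.
rewrite lapE (eq_bigr _ (fun i _ => D2 i)) sum_dirx_mix// hA; ring.
Qed.

End laplacian.

(** * The Rellich inequality *)

Section rellich.
Context {R : realType} {n : nat}.
Hypothesis n9 : (9 <= n)%N.
Local Notation rV := 'rV[R]_n.
Local Notation e_ i := (delta_mx ord0 i : rV).
Local Notation mu := (@lebesgue_measure_rV R n).
Local Notation B := (@eball R n).
Local Notation intB f := (mu.-integrable B (fun x => (f x)%:E)).
Implicit Types f g : rV -> R.

Let n0 : (0 < n)%N. Proof. exact: leq_trans n9. Qed.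

Lemma IB_Sx_ext N M k l f g : Sx N k f -> Sx M l g ->
  (forall x, x != 0 -> B x -> f x = g x) -> IB f = IB g.
Proof.
move=> F G fg; apply: IB_ae; [exact: Sx_measurable F|exact: Sx_measurable G|].
by apply: aeB_imp (aeB_nonzero n0) => x Bx x0; exact: fg.
Qed.

(** Each of the two integrations by parts involves one derivative already taken, so total order 6
    becomes the admissible 7. *)
Lemma green k l f g : (k + l <= 6)%N -> Sx 2 k f -> Sx 2 l g ->
  csupp f \/ csupp g -> IB (fun x => lap f x * g x) = IB (fun x => f x * lap g x).
Proof.
move=> kl F G cfg.
have DF i := Sx_D i F; have DG i := Sx_D i G.
have E1 : IB (fun x => lap f x * g x) =
    \sum_i IB (fun x => 'D_(e_ i) ('D_(e_ i) f) x * g x).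
  rewrite -IB_sum; last first.
    move=> i; apply: (@Sx_integrable R n n9 0 (k.+2 + l)); first by rewrite !addSn !ltnS.
    exact: Sx_mul (Sx_D i (DF i)) (SxW (SxW G)).
  by congr IB; apply/funext => x; rewrite lapE mulr_suml.
have E2 : IB (fun x => f x * lap g x) =
    \sum_i IB (fun x => f x * 'D_(e_ i) ('D_(e_ i) g) x).
  rewrite -IB_sum; last first.
    move=> i; apply: (@Sx_integrable R n n9 0 (k + l.+2)); first by rewrite !addnS !ltnS.
    exact: Sx_mul (SxW (SxW F)) (Sx_D i (DG i)).
  by congr IB; apply/funext => x; rewrite lapE mulr_sumr.
rewrite E1 E2; apply: eq_bigr => i _.
rewrite (IB_parts n9 i (k := k.+1) (l := l) _ (DF i) (SxW G)); last 2 first.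
- by rewrite addSn ltnS.
- by case: cfg => c; [left; exact: csupp_D|right].
have := IB_parts n9 i (k := k) (l := l.+1) _ (SxW F) (DG i).
rewrite addnS ltnS kl => /(_ isT) ->; first by rewrite opprK.
by case: cfg => c; [left|right; exact: csupp_D].
Qed.

(** The factor, up to sign, of the Laplacian on rho^a with a = (n-4-m)/2, the borderline power for
    which rho^(m+4) g^2 is rho^n. It is the constant of the Rellich inequality with weight rho^m. *)
Definition rellich_const (m : nat) : R := (n%:R - 4 - m%:R) * (n%:R + m%:R) / 4.

(* Completing squares: with [kappa = (n-4-m)/2], the difference of the integrands
   is [rho^m (lap g + K rho^2 g)^2 + 2 K rho^(m+2) sum_i (D_i g + kappa u_i rho g)^2]
   minus the divergence of a combination of the fields [V] and [W]. *)
Lemma rellich_weight (m : nat) g : (m <= 4)%N -> Sx 2 0 g -> csupp g ->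
  rellich_const m ^+ 2 * IB (fun x => rho x ^+ (m + 4) * g x ^+ 2) <=
  IB (fun x => rho x ^+ m * lap g x ^+ 2).
Proof.
move=> m4 G cg; set K := rellich_const m.
have n9R : (9 : R) <= n%:R by rewrite ler_nat.
have m4R : (m%:R : R) <= 4 by rewrite ler_nat.
have nm0 : 0 <= n%:R - 4 - m%:R :> R by lra.
have K0 : 0 <= K by rewrite /K /rellich_const divr_ge0// mulr_ge0// addr_ge0.
have DG i := Sx_D i G; have rX N a := @Sx_rhoX R n N a.
pose V i x := rho x ^+ m.+2 * (g x * 'D_(e_ i) g x).
pose W i x := rho x ^+ m.+3 * (dirx i x * (g x * g x)).
have SV i : Sx 1 m.+3 (V i).
  by have := Sx_mul (rX 1%N m.+2) (Sx_mul (SxW G) (DG i)); rewrite add0n addn1.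
have SW i : Sx 1 m.+3 (W i).
  by have := Sx_mul (rX 1%N m.+3) (Sx_mul (Sx_dirx 1 i) (Sx_mul (SxW G) (SxW G))); rewrite !addn0.
have m7 : (m.+3 <= 7)%N by rewrite (@leq_ltn_trans 6)// !ltnS.
have IV i : IB ('D_(e_ i) (V i)) = 0.
  by apply: (IB_derive0 n9 i m7 (SV i)); apply: csupp_mull; exact: csupp_mulr.
have IW i : IB ('D_(e_ i) (W i)) = 0.
  apply: (IB_derive0 n9 i m7 (SW i)); apply: csupp_mull; apply: csupp_mull; exact: csupp_mulr.
pose a x := \sum_i dirx i x * 'D_(e_ i) g x.
pose b x := \sum_i 'D_(e_ i) g x ^+ 2.
have dV x : x != 0 -> \sum_i 'D_(e_ i) (V i) x =
    rho x ^+ m.+2 * b x + rho x ^+ m.+2 * (g x * lap g x) -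
    m.+2%:R * rho x ^+ m.+3 * (g x * a x).
  move=> x0; rewrite /b /a lapE !mulr_sumr -!big_split/= -sumrB; apply: eq_bigr => i _.
  apply: D_val.
  have h := is_derive_fmul (is_derive_rhoX i m.+2 x0)
    (is_derive_fmul (Sx_derive i G x0) (Sx_derive i (DG i) x0)).
  by apply: (is_derive_eq h); rewrite /=; ring.
have dW x : x != 0 -> \sum_i 'D_(e_ i) (W i) x =
    (n%:R - 4 - m%:R) * rho x ^+ (m + 4) * g x ^+ 2 + 2 * rho x ^+ m.+3 * (g x * a x).
  move=> x0.
  have h i : 'D_(e_ i) (W i) x = - (m.+4%:R * rho x ^+ m.+4 * g x ^+ 2) * dirx i x ^+ 2 +
      rho x ^+ m.+4 * g x ^+ 2 + 2 * rho x ^+ m.+3 * (g x * (dirx i x * 'D_(e_ i) g x)).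
    apply: D_val.
    have h := is_derive_fmul (is_derive_rhoX i m.+3 x0)
      (is_derive_fmul (is_derive_dirx i i x0)
        (is_derive_fmul (Sx_derive i G x0) (Sx_derive i G x0))).
    apply: (is_derive_eq h).
    have hA : m.+4%:R = m.+3%:R + 1 :> R by rewrite -[in LHS]addn1 natrD.
    by rewrite /= eqxx [true%:R]mulr1n hA (exprS _ m.+3); ring.
  rewrite (eq_bigr _ (fun i _ => h i)) !big_split/= -!mulr_sumr sum_dirx_sqr//.
  rewrite sumr_const card_ord -mulr_natl /a addn4.
  have -> : m.+4%:R = m%:R + 4 :> R by rewrite -addn4 natrD.
  by ring.
have il : intB (fun x => rho x ^+ m * lap g x ^+ 2).
  have := Sx_mul (rX 0%N m) (Sx_exp 2 (Sx_lap G)).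
  by apply: Sx_integrable => //; rewrite (leq_add2r (2 * 2) m 4).
have ig : intB (fun x => rho x ^+ (m + 4) * g x ^+ 2).
  have := Sx_mul (rX 0%N (m + 4)%N) (Sx_exp 2 (SxW (SxW G))).
  by apply: Sx_integrable => //; rewrite muln0 addn0 (leq_add2r 4 m 4).
have iV i : intB ('D_(e_ i) (V i)).
  by apply: (@Sx_integrable R n n9 0 m.+4) => //; exact: Sx_D (SV i).
have iW i : intB ('D_(e_ i) (W i)).
  by apply: (@Sx_integrable R n n9 0 m.+4) => //; exact: Sx_D (SW i).
have IV0 : IB (fun x => \sum_i 'D_(e_ i) (V i) x) = 0.
  by rewrite (IB_sum _ iV) big1// => i _; exact: IV.
have IW0 : IB (fun x => \sum_i 'D_(e_ i) (W i) x) = 0.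
  by rewrite (IB_sum _ iW) big1// => i _; exact: IW.
pose Q x := rho x ^+ m * lap g x ^+ 2 - K ^+ 2 * (rho x ^+ (m + 4) * g x ^+ 2) +
  (2 * K * \sum_i 'D_(e_ i) (V i) x + K * (n%:R - 2) * \sum_i 'D_(e_ i) (W i) x).
have iS (F : 'I_n -> rV -> R) : (forall i, intB (F i)) -> intB (fun x => \sum_i F i x).
  exact: intB_sum.
have IQ : IB Q = IB (fun x => rho x ^+ m * lap g x ^+ 2) -
    K ^+ 2 * IB (fun x => rho x ^+ (m + 4) * g x ^+ 2).
  rewrite /Q IB_add; last 2 first.
  - by apply: intB_sub => //; exact: intB_scale.
  - by apply: intB_add; apply: intB_scale; exact: iS.
  rewrite IB_sub//; last exact: intB_scale.
  rewrite IB_add; [|apply: intB_scale; exact: iS..].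
  rewrite !IB_scale//; do 2? exact: iS.
  by rewrite IV0 IW0 !mulr0 !addr0.
rewrite -subr_ge0 -IQ.
pose Q0 x := rho x ^+ m * (lap g x + K * (rho x ^+ 2 * g x)) ^+ 2 +
  2 * K * (rho x ^+ m.+2 * \sum_i ('D_(e_ i) g x +
     (n%:R - 4 - m%:R) / 2 * (dirx i x * (rho x * g x))) ^+ 2).
have Q0E x : x != 0 -> Q x = Q0 x.
  move=> x0; rewrite /Q /Q0 dV// dW//.
  rewrite [\sum_i (_ + _) ^+ 2](_ : _ = b x + (n%:R - 4 - m%:R) * (rho x * g x) * a x +
    ((n%:R - 4 - m%:R) / 2 * (rho x * g x)) ^+ 2); last first.
    rewrite (eq_bigr (fun i => 'D_(e_ i) g x ^+ 2 +
        (n%:R - 4 - m%:R) * (rho x * g x) * (dirx i x * 'D_(e_ i) g x) +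
        ((n%:R - 4 - m%:R) / 2 * (rho x * g x)) ^+ 2 * dirx i x ^+ 2)); last first.
      by move=> i _; field.
    by rewrite !big_split/= -!mulr_sumr sum_dirx_sqr// mulr1.
  have -> : m.+2%:R = m%:R + 2 :> R by rewrite -addn2 natrD.
  by rewrite addn4 !exprS /K /rellich_const; field.
have mQ : measurable_fun B Q.
  apply/measurable_EFinP; apply: (@measurable_int _ _ _ mu).
  apply: intB_add; first by apply: intB_sub => //; exact: intB_scale.
  by apply: intB_add; apply: intB_scale; exact: iS.
apply: IB_ge0_ae => //; apply: aeB_imp (aeB_nonzero n0) => x _ x0; rewrite Q0E// /Q0.
have rm k : 0 <= rho x ^+ k by rewrite exprn_ge0// rho_ge0.
apply: addr_ge0; first by rewrite mulr_ge0// sqr_ge0.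
apply: mulr_ge0; first by rewrite mulr_ge0.
by apply: mulr_ge0 => //; apply: sumr_ge0 => i _; exact: sqr_ge0.
Qed.

(** The inequality with weight 0 for [lap phi] is chained to the one with weight 4 for [phi] through
    the integral of rho^4 ([lap phi])^2. *)
Lemma rellich_test (phi : rV -> R) : smooth phi -> csupp phi ->
  (rellich_const 0 * rellich_const 4) ^+ 2 * IB (fun x => rho x ^+ 8 * phi x ^+ 2) <=
  IB (fun x => lap (lap phi) x ^+ 2).
Proof.
move=> sphi cphi.
have h4 := @rellich_weight 4 phi isT (smooth_Sx 2 sphi) cphi.
have h0 := @rellich_weight 0 (lap phi) isT (smooth_Sx 2 (smooth_lap sphi)) (csupp_lap cphi).
have -> : (fun x => lap (lap phi) x ^+ 2) = (fun x : rV => rho x ^+ 0 * lap (lap phi) x ^+ 2).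
  by apply/funext => x; rewrite expr0 mul1r.
apply: le_trans h0; rewrite exprMn -mulrA; apply: ler_wpM2l => //; exact: sqr_ge0.
Qed.

End rellich.

(** * Square integrable functions and their norm *)

Section square_integrable.
Context {R : realType} {n : nat}.
Local Notation rV := 'rV[R]_n.
Local Notation mu := (@lebesgue_measure_rV R n).
Local Notation B := (@eball R n).
Local Notation intB f := (mu.-integrable B (fun x => (f x)%:E)).
Implicit Types f g : rV -> R.

Lemma L2_mul_integrable f g : L2 f -> L2 g -> intB (fun x => f x * g x).
Proof.
move=> [mf if2] [mg ig2]; apply: (@intB_le _ _ _ (fun x => f x ^+ 2 + g x ^+ 2)).
- exact: measurable_funM.
- exact: intB_add.
move=> x _; rewrite -[f x ^+ 2]real_normK ?num_real// -[g x ^+ 2]real_normK ?num_real//.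
rewrite normrM; have := sqr_ge0 (`|f x| - `|g x|).
have := mulr_ge0 (normr_ge0 (f x)) (normr_ge0 (g x)); nra.
Qed.

Lemma L2_sqr_integrable f : L2 f -> intB (fun x => f x ^+ 2).
Proof. by case. Qed.

Lemma L2_add f g : L2 f -> L2 g -> L2 (fun x => f x + g x).
Proof.
move=> Lf Lg; have [mf if2] := Lf; have [mg ig2] := Lg.
split; first exact: measurable_funD.
rewrite (_ : (fun x => _) = fun x => (f x ^+ 2 + 2 * (f x * g x) + g x ^+ 2)%:E).
  by apply: intB_add => //; apply: intB_add => //; apply: intB_scale; exact: L2_mul_integrable.
by apply/funext => x; congr (_%:E); ring.
Qed.

Lemma L2_scale (c : R) f : L2 f -> L2 (fun x => c * f x).
Proof.
move=> [mf if2]; split; first by apply: measurable_funM => //; exact: measurable_cst.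
rewrite (_ : (fun x => _) = fun x => (c ^+ 2 * f x ^+ 2)%:E); first exact: intB_scale.
by apply/funext => x; rewrite exprMn.
Qed.

Lemma L2_sub f g : L2 f -> L2 g -> L2 (fun x => f x - g x).
Proof.
move=> Lf /(L2_scale (-1)) Lg; have := L2_add Lf Lg.
by under eq_fun do rewrite mulN1r.
Qed.

Lemma L2_0 : L2 (fun _ : rV => 0).
Proof.
split; first exact: measurable_cst.
by under eq_fun do rewrite expr0n; exact: intB_cst.
Qed.

Lemma L2_sum (J : Type) (r : seq J) (F : J -> rV -> R) :
  (forall j, L2 (F j)) -> L2 (fun x => \sum_(j <- r) F j x).
Proof.
move=> H; elim: r => [|j r IH].
  by under eq_fun do rewrite big_nil; exact: L2_0.
by under eq_fun do rewrite big_cons; exact: L2_add.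
Qed.

Lemma L2_mul_bounded (C : R) f g : measurable_fun B f ->
  (forall x, B x -> `|f x| <= C) -> L2 g -> L2 (fun x => f x * g x).
Proof.
move=> mf fC [mg ig2]; split; first exact: measurable_funM.
apply: (@intB_le _ _ _ (fun x => C ^+ 2 * g x ^+ 2)).
- by apply: measurable_funX; exact: measurable_funM.
- exact: intB_scale.
move=> x Bx; rewrite ger0_norm ?sqr_ge0// exprMn ler_wpM2r ?sqr_ge0//.
by rewrite -real_normK ?num_real// lerXn2r ?nnegrE//; [exact: le_trans (fC _ Bx)|exact: fC].
Qed.

Lemma smooth_L2 f : smooth f -> L2 f.
Proof.
move=> sf; have cf := smooth_continuous sf.
have mf : measurable_fun B f by apply: measurable_funTS; exact: continuous_measurable_rV.
have [C C0 fC] := continuous_ball_bounded cf.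
have L1 : L2 (fun _ : rV => 1) by split; [exact: measurable_cst|exact: intB_cst].
have -> : f = fun x => f x * 1 by apply/funext => x; rewrite mulr1.
exact: (L2_mul_bounded (g := fun _ => 1) mf fC L1).
Qed.

Definition nrm f : R := Num.sqrt (IB (fun x => f x ^+ 2)).

Lemma nrm_ge0 f : 0 <= nrm f. Proof. exact: sqrtr_ge0. Qed.

Lemma nrm_sqr f : nrm f ^+ 2 = IB (fun x => f x ^+ 2).
Proof. by rewrite sqr_sqrtr// IB_ge0// => x _; exact: sqr_ge0. Qed.

Lemma IB_cauchy_schwarz f g : L2 f -> L2 g -> `|IB (fun x => f x * g x)| <= nrm f * nrm g.
Proof.
move=> Lf Lg; set b := IB _.
have H t : 0 <= t ^+ 2 * nrm f ^+ 2 + 2 * t * b + nrm g ^+ 2.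
  have if2 := L2_sqr_integrable Lf; have ig2 := L2_sqr_integrable Lg.
  have ifg := L2_mul_integrable Lf Lg.
  rewrite !nrm_sqr /b -!IB_scale//.
  rewrite -IB_add//; [|exact: intB_scale..].
  rewrite -IB_add//; last by apply: intB_add; exact: intB_scale.
  apply: IB_ge0 => x _; have := sqr_ge0 (t * f x + g x).
  by rewrite sqrrD exprMn -mulr_natl; congr (_ <= _); ring.
have a0 := nrm_ge0 f; have d0 := nrm_ge0 g.
move: a0 d0 H; set a := nrm f; set d := nrm g => a0 d0 H.
rewrite -ler_sqr ?nnegrE ?mulr_ge0// real_normK ?num_real//.
have [a1|a1] := eqVneq a 0; last first.
  have := H (- b / a ^+ 2).
  have -> : (- b / a ^+ 2) ^+ 2 * a ^+ 2 + 2 * (- b / a ^+ 2) * b + d ^+ 2 =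
    ((a * d) ^+ 2 - b ^+ 2) / a ^+ 2 by field.
  by rewrite pmulr_lge0 ?subr_ge0// invr_gt0 exprn_gt0// lt_def a1.
rewrite a1 mul0r expr0n/=.
have [->|b0] := eqVneq b 0; first by rewrite expr0n.
(* With [a = 0] the quadratic polynomial of [H] is affine in t; this t gives it the value -1. *)
have := H (- (d ^+ 2 + 1) / (2 * b)).
have -> : (- (d ^+ 2 + 1) / (2 * b)) ^+ 2 * a ^+ 2 + 2 * (- (d ^+ 2 + 1) / (2 * b)) * b + d ^+ 2 = -1.
  by rewrite a1; field.
by rewrite oppr_ge0 ler10.
Qed.

Lemma nrm_triangle f g : L2 f -> L2 g -> nrm (fun x => f x + g x) <= nrm f + nrm g.
Proof.
move=> Lf Lg; rewrite -ler_sqr ?nnegrE ?addr_ge0 ?nrm_ge0// nrm_sqr.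
have if2 := L2_sqr_integrable Lf; have ig2 := L2_sqr_integrable Lg.
have ifg := L2_mul_integrable Lf Lg.
rewrite (_ : (fun x => _) = fun x => f x ^+ 2 + 2 * (f x * g x) + g x ^+ 2); last first.
  by apply/funext => x; ring.
rewrite IB_add//; last by apply: intB_add => //; exact: intB_scale.
rewrite IB_add//; last exact: intB_scale.
rewrite IB_scale// -!nrm_sqr.
have := ler_norm (IB (fun x => f x * g x)).
have := IB_cauchy_schwarz Lf Lg; nra.
Qed.

Lemma nrm_le f g : L2 f -> L2 g -> (forall x, B x -> `|f x| <= `|g x|) -> nrm f <= nrm g.
Proof.
move=> [_ if2] [_ ig2] fg; rewrite ler_sqrt; last by apply: IB_ge0 => x _; exact: sqr_ge0.
apply: IB_le => // x Bx.
by rewrite -[leLHS]real_normK ?num_real// -[leRHS]real_normK ?num_real// lerXn2r ?nnegrE// fg.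
Qed.

Lemma nrm_scale c f : L2 f -> nrm (fun x => c * f x) = `|c| * nrm f.
Proof.
move=> [_ if2]; rewrite /nrm; under eq_fun do rewrite exprMn.
by rewrite IB_scale// sqrtrM ?sqr_ge0// sqrtr_sqr.
Qed.

Lemma nrm_ae f g : measurable_fun B f -> measurable_fun B g ->
  aeB (fun x => f x = g x) -> nrm f = nrm g.
Proof.
move=> mf mg fg; congr Num.sqrt; apply: IB_ae; [exact: measurable_funX..|].
by apply: aeB_imp fg => x _ ->.
Qed.

End square_integrable.

(** * The weak bilaplacian and the Rellich inequality in the closure of test functions *)

Section bilaplacian.
Context {R : realType} {n : nat}.
Hypothesis n9 : (9 <= n)%N.
Local Notation rV := 'rV[R]_n.
Local Notation mu := (@lebesgue_measure_rV R n).
Local Notation B := (@eball R n).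
Implicit Types f g w W phi : rV -> R.

Let n0 : (0 < n)%N. Proof. exact: leq_trans n9. Qed.

Definition weak_bilap f : rV -> R := fun x =>
  \sum_(i < n) \sum_(k < n) weak_partial [:: i; i; k; k] f x.

Lemma weak_partialP s g f : L2 g -> is_weak_partial s f g ->
  L2 (weak_partial s f) /\ is_weak_partial s f (weak_partial s f).
Proof.
move=> Lg wg; have : [set h | L2 h /\ is_weak_partial s f h] g by split.
by move=> /getI.
Qed.

Lemma weak_partial_ae s g f : L2 g -> is_weak_partial s f g ->
  aeB (fun x => weak_partial s f x = g x).
Proof.
move=> Lg wg; have [Lp wp] := weak_partialP Lg wg.
exact: weak_partial_unique Lp Lg wp wg.
Qed.

Lemma sobolev_weak_partial k s f : sobolev k f -> (size s <= k)%N ->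
  L2 (weak_partial s f) /\ is_weak_partial s f (weak_partial s f).
Proof. by move=> [_ H] /H[g Lg wg]; exact: weak_partialP Lg wg. Qed.

Lemma weak_bilap_L2 f : sobolev 4 f -> L2 (weak_bilap f).
Proof.
move=> sf; apply: L2_sum => i; apply: L2_sum => k.
by have [] := sobolev_weak_partial (s := [:: i; i; k; k]) sf isT.
Qed.

Lemma is_weak_partial_sub s f1 f2 g1 g2 : L2 f1 -> L2 f2 -> L2 g1 -> L2 g2 ->
  is_weak_partial s f1 g1 -> is_weak_partial s f2 g2 ->
  is_weak_partial s (fun x => f1 x - f2 x) (fun x => g1 x - g2 x).
Proof.
move=> F1 F2 G1 G2 w1 w2 phi tphi; have [sphi _ _] := tphi.
have L0 := smooth_L2 sphi; have Ls := smooth_L2 (smooth_iter_partial s sphi).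
rewrite -![Rintegral _ _ _]/(IB _).
rewrite (_ : (fun x => (f1 x - f2 x) * _) = fun x => f1 x * iter_partial s phi x - f2 x * iter_partial s phi x); last first.
  by apply/funext => x; rewrite mulrBl.
rewrite (_ : (fun x => (g1 x - g2 x) * _) = fun x => g1 x * phi x - g2 x * phi x); last first.
  by apply/funext => x; rewrite mulrBl.
rewrite !IB_sub; try exact: L2_mul_integrable.
by rewrite mulrBr; congr (_ - _); [exact: w1|exact: w2].
Qed.

Lemma weak_bilap_sub f g : sobolev 4 f -> sobolev 4 g ->
  aeB (fun x => weak_bilap (fun y => f y - g y) x = weak_bilap f x - weak_bilap g x).
Proof.
move=> sf sg.
have H i k : aeB (fun x => weak_partial [:: i; i; k; k] (fun y => f y - g y) x =
    weak_partial [:: i; i; k; k] f x - weak_partial [:: i; i; k; k] g x).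
  have [Lf wf] := sobolev_weak_partial (s := [:: i; i; k; k]) sf isT.
  have [Lg wg] := sobolev_weak_partial (s := [:: i; i; k; k]) sg isT.
  apply: weak_partial_ae; first exact: L2_sub.
  by apply: is_weak_partial_sub => //; [case: sf|case: sg].
have {}H : aeB (fun x => forall i k, weak_partial [:: i; i; k; k] (fun y => f y - g y) x =
    weak_partial [:: i; i; k; k] f x - weak_partial [:: i; i; k; k] g x).
  by apply: aeB_forall => i; exact: aeB_forall (H i).
apply: aeB_imp H => x _ H; rewrite /weak_bilap -sumrB; apply: eq_bigr => i _.
by rewrite -sumrB; apply: eq_bigr => k _; exact: H.
Qed.

Lemma weak_bilap_Sx f : Sx 4 0 f -> aeB (fun x => weak_bilap f x = lap (lap f) x).
Proof.
move=> F.
have H i k : aeB (fun x => weak_partial [:: i; i; k; k] f x =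
    iter_partial (rev [:: i; i; k; k]) f x).
  apply: weak_partial_ae.
    by apply: (@Sx_L2 R n n9 0 4) => //; exact: (@Sx_iter_partial _ _ (rev [:: i; i; k; k]) 0 0).
  exact: (@Sx_is_weak_partial R n n9 [:: i; i; k; k] 0).
have {}H : aeB (fun x => forall i k, weak_partial [:: i; i; k; k] f x =
    iter_partial (rev [:: i; i; k; k]) f x).
  by apply: aeB_forall => i; exact: aeB_forall (H i).
apply: aeB_imp (aeB_and H (aeB_nonzero n0)) => x _ [{}H x0].
rewrite (lap_lapE (N := 0) F x0); apply: eq_bigr => i _; apply: eq_bigr => k _; exact: H.
Qed.

Lemma nrm_sum (J : Type) (r : seq J) (F : J -> rV -> R) : (forall j, L2 (F j)) ->
  nrm (fun x => \sum_(j <- r) F j x) <= \sum_(j <- r) nrm (F j).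
Proof.
move=> LF; elim: r => [|j r IH].
  rewrite big_nil (_ : (fun _ => _) = fun=> 0); last by apply/funext => x; rewrite big_nil.
  by rewrite /nrm; under eq_fun do rewrite expr0n; rewrite IB_0 sqrtr0.
rewrite big_cons (_ : (fun _ => _) = fun x => F j x + \sum_(j <- r) F j x); last first.
  by apply/funext => x; rewrite big_cons.
by apply: le_trans (nrm_triangle (LF j) (L2_sum _ LF)) _; rewrite lerD2l.
Qed.

(* [W] is the bilaplacian of [w] in the closure of the test functions. *)
Definition W0pair w W := [/\ L2 w, L2 W & forall e : R, 0 < e ->
  exists phi, [/\ test_fun phi, nrm (fun x => W x - lap (lap phi) x) <= e &
    nrm (fun x => w x - phi x) <= e]].

Lemma sobolev0_W0pair w : sobolev0 4 w -> W0pair w (weak_bilap w).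
Proof.
move=> [sw aw]; split; [by case: sw|exact: weak_bilap_L2|].
(* The bilaplacian has n^2 terms, each approximated within [d]; the extra 1 also gives [d <= e], for
   [w] itself. *)
move=> e e0; pose d := e / (n%:R * n%:R + 1).
have d0 : 0 < d by rewrite divr_gt0// ltr_wpDl.
have [phi tphi Hphi] := aw (d ^+ 2) (exprn_gt0 2 d0).
have [sphi _ _] := tphi.
have Hn s : (size s <= 4)%N -> nrm (fun x => weak_partial s w x - iter_partial s phi x) <= d.
  move=> s4; have [Lw _] := sobolev_weak_partial sw s4.
  have [_ ii] := L2_sub Lw (smooth_L2 (smooth_iter_partial s sphi)).
  rewrite -ler_sqr ?nnegrE ?nrm_ge0 ?(ltW d0)// nrm_sqr -lee_fin.
  rewrite /IB /Rintegral fineK; first exact: ltW (Hphi _ s4).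
  by apply: integrable_fin_num; first exact: eball_measurable.
have dsum : n%:R * n%:R * d <= e.
  rewrite /d mulrCA ger_pMr// ler_pdivrMr ?mul1r ?lerDl//; lra.
have de : d <= e by rewrite /d ler_pdivrMr ?ler_peMr ?lerDr ?(ltW e0)//; lra.
exists phi; split => //.
  have LD i k : L2 (fun x => weak_partial [:: i; i; k; k] w x - iter_partial [:: i; i; k; k] phi x).
    apply: L2_sub; last exact: smooth_L2 (smooth_iter_partial _ sphi).
    by have [] := sobolev_weak_partial (s := [:: i; i; k; k]) sw isT.
  rewrite (@nrm_ae _ _ _ (fun x => \sum_i \sum_k
    (weak_partial [:: i; i; k; k] w x - iter_partial [:: i; i; k; k] phi x))).
  - apply: le_trans dsum; apply: le_trans (nrm_sum _ _) _.
      by move=> i; apply: L2_sum => k; exact: LD.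
    have -> : n%:R * n%:R * d = \sum_(i < n) \sum_(k < n) d.
      by rewrite !sumr_const !card_ord -mulrnA -[RHS]mulr_natl natrM.
    apply: ler_sum => i _; apply: le_trans (nrm_sum _ (LD i)) _.
    by apply: ler_sum => k _; exact: Hn.
  - apply: measurable_funB; first by have [] := weak_bilap_L2 sw.
    by have [] := smooth_L2 (smooth_lap (smooth_lap sphi)).
  - have [//] : L2 (fun x => \sum_i \sum_k
      (weak_partial [:: i; i; k; k] w x - iter_partial [:: i; i; k; k] phi x)).
    by apply: L2_sum => i; apply: L2_sum => k; exact: LD.
  - apply: aeB_imp (aeB_nonzero n0) => x _ x0.
    rewrite (lap_lapE (N := 0) (smooth_Sx 4 sphi) x0) [X in _ - X]exchange_big/= /weak_bilap -sumrB.
    by apply: eq_bigr => i _; rewrite -sumrB.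
have w0 : is_weak_partial [::] w w by move=> psi _; rewrite expr0 mul1r.
have Lw : L2 w by case: sw.
have [mw _] := Lw.
have mp : measurable_fun B phi by have [] := smooth_L2 sphi.
have [mwp _] : L2 (weak_partial [::] w) by have [] := weak_partialP Lw w0.
rewrite (@nrm_ae _ _ _ (fun x => weak_partial [::] w x - phi x)).
- by apply: le_trans de; exact: (Hn [::]).
- exact: measurable_funB.
- exact: measurable_funB.
- by apply: aeB_imp (weak_partial_ae Lw w0) => x _ ->.
Qed.

Local Notation C := (rellich_const (R := R) (n := n) 0 * rellich_const (R := R) (n := n) 4).

Lemma rellich_const_gt0 : 0 < C.
Proof.
have n9R : (9 : R) <= n%:R by rewrite ler_nat.
by rewrite /rellich_const mulr_gt0// divr_gt0// mulr_gt0//; lra.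
Qed.

Lemma nrm_rellich_test phi : test_fun phi ->
  C * nrm (fun x => rho x ^+ 4 * phi x) <= nrm (lap (lap phi)).
Proof.
move=> tphi; have [sphi _ _] := tphi; have C0 := rellich_const_gt0.
rewrite -ler_sqr ?nnegrE ?(mulr_ge0 (ltW C0) (nrm_ge0 _)) ?nrm_ge0// exprMn !nrm_sqr.
have := rellich_test n9 sphi (test_fun_csupp tphi).
rewrite (_ : (fun x : rV => rho x ^+ 8 * phi x ^+ 2) = fun x => (rho x ^+ 4 * phi x) ^+ 2)//.
by apply/funext => x; rewrite exprMn -exprM.
Qed.

(** L2 convergence of test functions to [w] does not survive multiplication by the unbounded rho^4.
    With the truncated weight [h k] it does, and the resulting bound is independent of [k]; monotone
    convergence removes the truncation and yields integrability at the same time. *)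
Lemma rellich_W0pair w W : W0pair w W ->
  L2 (fun x => rho x ^+ 4 * w x) /\ C * nrm (fun x => rho x ^+ 4 * w x) <= nrm W.
Proof.
move=> [Lw LW H]; have C0 := rellich_const_gt0.
have [mw _] := Lw.
pose h (k : nat) (x : rV) : R := Num.min (rho x ^+ 4) k%:R.
have r4 x : 0 <= @rho R n x ^+ 4 by rewrite exprn_ge0// rho_ge0.
have h0 k x : 0 <= h k x by rewrite /h le_min r4 ler0n.
have hk k x : h k x <= k%:R by rewrite /h ge_min lexx orbT.
have hr k x : h k x <= rho x ^+ 4 by rewrite /h ge_min lexx.
have mr4 : measurable_fun B (fun x => @rho R n x ^+ 4).
  by apply: measurable_funX; exact: measurableB_rho.
have mh k : measurable_fun B (h k) by apply: measurable_minr.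
have Lh k f : L2 f -> L2 (fun x => h k x * f x).
  by apply: L2_mul_bounded (mh k) _ => x _; rewrite ger0_norm; [exact: hk|exact: h0].
have nhk k f : L2 f -> nrm (fun x => h k x * f x) <= k%:R * nrm f.
  move=> Lf; rewrite -[k%:R]ger0_norm// -nrm_scale//.
  apply: nrm_le => [||x _]; [exact: Lh|exact: L2_scale|].
  by rewrite !normrM ler_wpM2r// !ger0_norm.
have step k : C * nrm (fun x => h k x * w x) <= nrm W.
  apply/ler_addgt0Pr => e e0.
  (* The error is [d] from the bilaplacian and [C * k%:R * d] from the truncated weight, in total
     [e]. *)
  pose d := e / (1 + C * k%:R).
  have D0 : 0 < 1 + C * k%:R by rewrite ltr_pwDl// mulr_ge0// ltW.
  have [phi [tphi nW nw]] := H d (divr_gt0 e0 D0); have [sphi _ _] := tphi.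
  have Lphi := smooth_L2 sphi; have Lwp := L2_sub Lw Lphi.
  have Ll := smooth_L2 (smooth_lap (smooth_lap sphi)).
  have Lr : L2 (fun x => rho x ^+ 4 * phi x).
    apply: (@Sx_L2 R n n9 0 (4 + 0)) => //.
    by apply: Sx_mul; [exact: Sx_rhoX|exact: smooth_Sx].
  have e1 : nrm (fun x => h k x * w x) <=
      nrm (fun x => h k x * phi x) + nrm (fun x => h k x * (w x - phi x)).
    have -> : (fun x => h k x * w x) = fun x => h k x * phi x + h k x * (w x - phi x).
      by apply/funext => x; ring.
    exact: nrm_triangle (Lh k _ Lphi) (Lh k _ Lwp).
  have e2 : nrm (fun x => h k x * phi x) <= nrm (fun x => rho x ^+ 4 * phi x).
    apply: nrm_le => [||x _]; [exact: Lh|exact: Lr|].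
    rewrite (normrM (h k x)) (normrM (rho x ^+ 4)); apply: ler_wpM2r => //.
    by rewrite !ger0_norm.
  have e3 := nrm_rellich_test tphi.
  have e4 : nrm (lap (lap phi)) <= nrm W + d.
    have e4 := nrm_triangle LW (L2_scale (-1) (L2_sub LW Ll)).
    rewrite nrm_scale ?normrN1 ?mul1r in e4; last exact: L2_sub.
    have -> : lap (lap phi) = fun x => W x + -1 * (W x - lap (lap phi) x).
      by apply/funext => x; ring.
    by apply: le_trans e4 _; rewrite lerD2l.
  have e5 := nhk k _ Lwp.
  have ed : d + C * k%:R * d = e by rewrite /d -[X in X + _]mul1r -mulrDl mulrCA divff ?mulr1// gt_eqF.
  apply: (@le_trans _ _ (C * (nrm (fun x => rho x ^+ 4 * phi x) + k%:R * d))).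
    rewrite ler_pM2l//; apply: le_trans e1 _; apply: lerD => //.
    by apply: le_trans e5 _; rewrite ler_wpM2l.
  have -> : C * (nrm (fun x => rho x ^+ 4 * phi x) + k%:R * d) =
    C * nrm (fun x => rho x ^+ 4 * phi x) + C * k%:R * d by ring.
  rewrite -ed addrA; apply: lerD => //; exact: le_trans e3 e4.
have mrw : measurable_fun B (fun x => rho x ^+ 4 * w x) by exact: measurable_funM.
pose M := (nrm W / C) ^+ 2.
have Hle : (\int[mu]_(x in B) ((rho x ^+ 4 * w x) ^+ 2)%:E <= M%:E)%E.
  pose g k (x : rV) := ((h k x * w x) ^+ 2)%:E.
  have := @cvg_monotone_convergence _ _ _ mu B (@eball_measurable R n) g.
  have -> : (\int[mu]_(x in B) limn (g ^~ x) = \int[mu]_(x in B) ((rho x ^+ 4 * w x) ^+ 2)%:E)%E.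
    apply: eq_integral => x _; apply: lim_near_cst => //.
    near=> k; rewrite /g /h min_l//.
    near: k; exists (Num.truncn (rho x ^+ 4)).+1 => // k /= hk'.
    by apply: ltW; apply: lt_le_trans (truncnS_gt _) _; rewrite ler_nat.
  move=> cv; apply: (cvge_to_le (cv _ _ _)).
  - by move=> k; apply/measurable_EFinP; apply: measurable_funX; exact: measurable_funM.
  - by move=> k x _; rewrite lee_fin sqr_ge0.
  - move=> x _ k l kl; rewrite lee_fin !exprMn ler_wpM2r ?sqr_ge0//.
    by rewrite lerXn2r ?nnegrE// /h le_min2// ler_nat.
  apply: nearW => k.
  have [_ ig] := Lh k _ Lw.
  rewrite -[leLHS]fineK; last by apply: integrable_fin_num; first exact: eball_measurable.
  rewrite lee_fin -/(Rintegral mu B _) -/(IB _) -nrm_sqr.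
  by rewrite lerXn2r ?nnegrE ?nrm_ge0 ?divr_ge0 ?nrm_ge0 ?(ltW C0)// ler_pdivlMr// mulrC.
have L : L2 (fun x => rho x ^+ 4 * w x).
  split => //; apply/integrableP; split.
    by apply/measurable_EFinP; exact: measurable_funX.
  under eq_integral do rewrite gee0_abs ?lee_fin ?sqr_ge0//.
  by apply: le_lt_trans Hle _; exact: ltry.
split => //; have [_ ig] := L.
rewrite mulrC -ler_pdivlMr// -ler_sqr ?nnegrE ?nrm_ge0 ?divr_ge0 ?nrm_ge0 ?(ltW C0)//.
rewrite nrm_sqr -lee_fin /IB /Rintegral fineK//.
by apply: integrable_fin_num; first exact: eball_measurable.
Unshelve. all: by end_near. Qed.

End bilaplacian.

(** * The equator map and its minimality *)

Section equator.
Context {R : realType} {n : nat}.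
Local Notation rV := 'rV[R]_n.
Local Notation mu := (@lebesgue_measure_rV R n).
Local Notation B := (@eball R n).
Local Notation intB f := (mu.-integrable B (fun x => (f x)%:E)).
Implicit Types f g w W phi : rV -> R.

Definition eqc (j : 'I_(n + 1)) : rV -> R := coordf (@equator_map R n) j.

Lemma eqc_lshift i : eqc (lshift 1 i) = dirx i.
Proof.
by apply/funext => x; rewrite /eqc /coordf /equator_map row_mxEl mxE mulrC.
Qed.

Lemma eqc_rshift i : eqc (rshift n i) = fun=> 0.
Proof. by apply/funext => x; rewrite /eqc /coordf /equator_map row_mxEr mxE. Qed.

Lemma Sx_eqc N j : Sx N 0 (eqc j).
Proof.
case: (split_ordP j) => i ->; first by rewrite eqc_lshift; exact: Sx_dirx.
by rewrite eqc_rshift; exact: ck_cst.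
Qed.

Lemma sum_eqc_sqr x : x != 0 -> \sum_j eqc j x ^+ 2 = 1.
Proof.
move=> x0; rewrite big_split_ord/= -[RHS](sum_dirx_sqr x0) [X in _ + X]big1 ?addr0.
  by apply: eq_bigr => i _; rewrite eqc_lshift.
by move=> i _; rewrite eqc_rshift expr0n.
Qed.

Lemma lap_rhoX_eqc a j x : x != 0 ->
  lap (fun z => rho z ^+ a * eqc j z) x =
  - (a.+1%:R * (n%:R - 1 - a%:R)) * (rho x ^+ a.+2 * eqc j x).
Proof.
move=> x0; case: (split_ordP j) => i ->; first by rewrite eqc_lshift lap_rhoX_dirx.
rewrite eqc_rshift (_ : (fun z => _) = fun=> 0); first by rewrite lap0 !mulr0.
by apply/funext => z; rewrite mulr0.
Qed.

Lemma lap_scale_rhoX_eqc c a j f x : x != 0 ->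
  (forall z, z != 0 -> f z = c * (rho z ^+ a * eqc j z)) ->
  lap f x = - (c * a.+1%:R * (n%:R - 1 - a%:R)) * (rho x ^+ a.+2 * eqc j x).
Proof.
move=> x0 /lap_ext -> //.
have S : Sx 2 (a + 0) (fun z => rho z ^+ a * eqc j z).
  by apply: Sx_mul; [exact: Sx_rhoX|exact: Sx_eqc].
by rewrite (lap_scale (N := 0) c S x0) lap_rhoX_eqc//; ring.
Qed.

Definition lap2_const : R := 3 * (n%:R - 1) * (n%:R - 3).
Definition lap4_const : R := 105 * (n%:R - 1) * (n%:R - 3) * (n%:R - 5) * (n%:R - 7).

Lemma lap2_eqc j x : x != 0 ->
  lap (lap (eqc j)) x = lap2_const * (rho x ^+ 4 * eqc j x).
Proof.
move=> x0; rewrite (@lap_scale_rhoX_eqc (- (n%:R - 1)) 2 j)//.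
  by rewrite /lap2_const; congr (_ * _); ring.
move=> z z0; rewrite (@lap_scale_rhoX_eqc 1 0 j)//; first by congr (_ * _); ring.
by move=> y _; rewrite expr0 !mul1r.
Qed.

Lemma lap4_eqc j x : x != 0 ->
  lap (lap (lap (lap (eqc j)))) x = lap4_const * (rho x ^+ 8 * eqc j x).
Proof.
move=> x0; rewrite (@lap_scale_rhoX_eqc (- (lap2_const * 5 * (n%:R - 5))) 6 j)//.
  by rewrite /lap2_const /lap4_const; congr (_ * _); ring.
move=> z z0; rewrite (@lap_scale_rhoX_eqc lap2_const 4 j)//; first by congr (_ * _); ring.
by move=> y; exact: lap2_eqc.
Qed.

Hypothesis n9 : (9 <= n)%N.
Let n0 : (0 < n)%N. Proof. exact: leq_trans n9. Qed.

Lemma green2 f g : Sx 8 0 f -> Sx 4 0 g -> csupp g ->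
  IB (fun x => lap (lap f) x * lap (lap g) x) = IB (fun x => lap (lap (lap (lap f))) x * g x).
Proof.
move=> F G cg.
have F4 : Sx 4 4 (lap (lap f)) := Sx_lap (Sx_lap F).
have F6 : Sx 2 6 (lap (lap (lap f))) := Sx_lap F4.
have G2 : Sx 2 2 (lap g) := Sx_lap G.
have cg2 := csupp_lap cg.
rewrite -(@green _ _ n9 4 2 _ _ isT (SxW (SxW F4)) G2); last by right.
by rewrite -(@green _ _ n9 6 0 _ _ isT F6 (SxW (SxW G)))//; right.
Qed.

Lemma rho4_eqc_L2 j : L2 (fun x => rho x ^+ 4 * eqc j x).
Proof.
apply: (@Sx_L2 R n n9 0 (4 + 0)) => //.
by apply: Sx_mul; [exact: Sx_rhoX|exact: Sx_eqc].
Qed.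

Lemma rho8_eqc_integrable j w W : W0pair w W -> intB (fun x => rho x ^+ 8 * (eqc j x * w x)).
Proof.
move=> /(rellich_W0pair n9)[Lw _]; have := L2_mul_integrable (rho4_eqc_L2 j) Lw.
rewrite (_ : (fun x => _) = fun x => (rho x ^+ 8 * (eqc j x * w x))%:E)//.
by apply/funext => x; congr (_%:E); ring.
Qed.

(** Allows the Rellich inequality to be applied to the approximation error [w - phi], and not just
    to [w]. *)
Lemma W0pair_sub w W phi : W0pair w W -> test_fun phi ->
  W0pair (fun x => w x - phi x) (fun x => W x - lap (lap phi) x).
Proof.
move=> [Lw LW H] tphi; have [sphi _ _] := tphi; split.
- exact: L2_sub (smooth_L2 sphi).
- exact: L2_sub (smooth_L2 (smooth_lap (smooth_lap sphi))).
move=> e e0; have [psi [tpsi h1 h2]] := H e e0; have [spsi _ _] := tpsi.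
have mphi := @smooth_Sx _ _ _ 4 sphi; have mpsi := @smooth_Sx _ _ _ 4 spsi.
have sd : smooth (fun x => psi x - phi x).
  by apply: smooth_ck_smooth => N; apply: ck_sub; exact: smooth_smooth_ck.
exists (fun x => psi x - phi x); split.
- apply: csupp_test_fun => //.
  have [c c1 Hc] := test_fun_csupp tphi; have [d d1 Hd] := test_fun_csupp tpsi.
  exists (Num.max c d); first by rewrite gt_max c1.
  by move=> x; rewrite gt_max => /andP[/Hc -> /Hd ->]; rewrite subr0.
- apply: le_trans h1; rewrite le_eqVlt; apply/orP; left; apply/eqP.
  apply: nrm_ae.
  + have [m1 _] := LW; have [m2 _] := smooth_L2 (smooth_lap (smooth_lap sphi)).
    have [m3 _] := smooth_L2 (smooth_lap (smooth_lap sd)).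
    exact: measurable_funB (measurable_funB m1 m2) m3.
  + have [m1 _] := LW; have [m2 _] := smooth_L2 (smooth_lap (smooth_lap spsi)).
    exact: measurable_funB m1 m2.
  + apply: aeB_imp (aeB_nonzero n0) => x _ x0.
    have E y : y != 0 -> lap (fun x => psi x - phi x) y = lap psi y + -1 * lap phi y.
      have -> : (fun x => psi x - phi x) = (fun x => psi x + -1 * phi x).
        by apply/funext => z; rewrite mulN1r.
      move=> y0; rewrite -(lap_scale (N := 2) (-1) mphi y0).
      exact: (lap_add (N := 2) mpsi (Sx_scale (-1) mphi) y0).
    have -> : lap (lap (fun x => psi x - phi x)) x = lap (lap psi) x - lap (lap phi) x.
      rewrite (lap_ext E x0) (lap_add (N := 0) (Sx_lap mpsi) (Sx_scale (-1) (Sx_lap mphi)) x0).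
      by rewrite (lap_scale (N := 0) (-1) (Sx_lap mphi) x0) mulN1r.
    by ring.
- by under eq_fun do rewrite opprB addrA subrK.
Qed.

(** By density. The defect [D] is unchanged when a test function is subtracted from [w]. The
    bilaplacian term is then small by Cauchy-Schwarz, and so is the weighted term, because the
    Rellich inequality bounds rho^4 (w - phi) by the bilaplacian of the error divided by [K]. *)
Lemma green_W0pair j w W : W0pair w W ->
  IB (fun x => lap (lap (eqc j)) x * W x) =
  lap4_const * IB (fun x => rho x ^+ 8 * (eqc j x * w x)).
Proof.
move=> P; have [Lw LW H] := P; apply/eqP; rewrite -subr_eq0 -normr_le0.
set U := lap (lap (eqc j)); set D := _ - _.
have LU : L2 U by apply: (@Sx_L2 R n n9 0 4) => //; exact: Sx_lap (Sx_lap (Sx_eqc 4 j)).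
pose K : R := rellich_const (R := R) (n := n) 0 * rellich_const (R := R) (n := n) 4.
have K0 : 0 < K := rellich_const_gt0 n9.
pose M := nrm U + `|lap4_const| * (nrm (fun x => rho x ^+ 4 * eqc j x) / K).
have M0 : 0 <= M.
  by rewrite addr_ge0 ?nrm_ge0// mulr_ge0// divr_ge0 ?nrm_ge0// ltW.
have HD e : 0 < e -> `|D| <= M * e.
  move=> e0; have [phi [tphi h1 h2]] := H e e0; have [sphi _ _] := tphi.
  have Pd := W0pair_sub P tphi; have [Lr Hr] := rellich_W0pair n9 Pd.
  have Ld := L2_sub LW (smooth_L2 (smooth_lap (smooth_lap sphi))).
  have Lll := smooth_L2 (smooth_lap (smooth_lap sphi)).
  have E1 : IB (fun x => U x * lap (lap phi) x) =
      lap4_const * IB (fun x => rho x ^+ 8 * (eqc j x * phi x)).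
    rewrite (green2 (Sx_eqc 8 j) (smooth_Sx 4 sphi) (test_fun_csupp tphi)).
    have S : Sx 0 (8 + (0 + 0)) (fun x => rho x ^+ 8 * (eqc j x * phi x)).
      apply: Sx_mul; first exact: Sx_rhoX.
      by apply: Sx_mul; [exact: Sx_eqc|exact: smooth_Sx].
    rewrite -IB_scale; last exact: Sx_integrable n9 _ _ _ _ S.
    apply: (IB_Sx_ext n9 (N := 0) (M := 0) (k := 8 + 0) (l := 8)).
    - apply: Sx_mul; last exact: smooth_Sx.
      exact: Sx_lap (Sx_lap (Sx_lap (Sx_lap (Sx_eqc 8 j)))).
    - exact: Sx_scale.
    - by move=> x x0 _; rewrite lap4_eqc//; ring.
  have iphi : intB (fun x => rho x ^+ 8 * (eqc j x * phi x)).
    apply: (@Sx_integrable R n n9 0 (8 + (0 + 0))) => //.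
    apply: Sx_mul; first exact: Sx_rhoX.
    by apply: Sx_mul; [exact: Sx_eqc|exact: smooth_Sx].
  have -> : D = IB (fun x => U x * (W x - lap (lap phi) x)) -
      lap4_const * IB (fun x => (rho x ^+ 4 * eqc j x) * (rho x ^+ 4 * (w x - phi x))).
    rewrite (_ : (fun x => U x * (W x - _)) = fun x => U x * W x - U x * lap (lap phi) x); last first.
      by apply/funext => x; rewrite mulrBr.
    rewrite (_ : (fun x => (_ * eqc j x) * _) = fun x => rho x ^+ 8 * (eqc j x * w x) - rho x ^+ 8 * (eqc j x * phi x)); last first.
      by apply/funext => x; ring.
    rewrite IB_sub; [|exact: L2_mul_integrable..].
    rewrite IB_sub//; last exact: rho8_eqc_integrable P.
    by rewrite E1 /D; ring.
  apply: le_trans (ler_normB _ _) _; rewrite /M mulrDl; apply: lerD.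
    by apply: le_trans (IB_cauchy_schwarz LU Ld) _; rewrite ler_wpM2l ?nrm_ge0.
  rewrite normrM -mulrA ler_wpM2l//.
  apply: le_trans (IB_cauchy_schwarz (rho4_eqc_L2 j) Lr) _.
  rewrite -mulrA ler_wpM2l ?nrm_ge0// mulrC ler_pdivlMr// mulrC.
  exact: le_trans Hr h1.
apply/ler_addgt0Pr => e e0; rewrite add0r.
have M1 : 0 < M + 1 by rewrite ltr_wpDl.
apply: le_trans (HD _ (divr_gt0 e0 M1)) _.
by rewrite mulrCA ger_pMr// ler_pdivrMr// mul1r lerDl.
Qed.

End equator.

(** * Comparison with sphere-valued competitors *)

Section minimality.
Context {R : realType} {n : nat}.
Hypothesis n9 : (9 <= n)%N.
Local Notation rV := 'rV[R]_n.
Local Notation mu := (@lebesgue_measure_rV R n).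
Local Notation B := (@eball R n).
Local Notation intB f := (mu.-integrable B (fun x => (f x)%:E)).
Let n0 : (0 < n)%N. Proof. exact: leq_trans n9. Qed.

Lemma esphereP m (y : 'rV[R]_m) : esphere y <-> \sum_j y ord0 j ^+ 2 = 1.
Proof.
rewrite /esphere /=; split => [y1|]; first by rewrite -enorm_sqr y1 expr1n.
by rewrite /enorm => ->; rewrite sqrtr1.
Qed.

Lemma equator_sobolev_sphere : sobolev_sphere 4 (@equator_map R n).
Proof.
split; first by move=> j; apply: (@Sx_sobolev R n n9 4) => //; exact: Sx_eqc.
have := aeB_nonzero (R := R) n0; rewrite /aeB; apply: filterS => x x0 Bx.
by apply/esphereP; exact: sum_eqc_sqr (x0 Bx).
Qed.

Lemma E4ext_weak_bilap m (v : rV -> 'rV[R]_m) :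
  E4ext v = IB (fun x => \sum_j weak_bilap (coordf v j) x ^+ 2).
Proof.
rewrite /E4ext /IB; congr (Rintegral _ _ _); apply/funext => x.
by rewrite enorm_sqr; apply: eq_bigr => j _; rewrite mxE.
Qed.

Lemma E4ext_equator : E4ext (@equator_map R n) = \sum_j nrm (lap (lap (@eqc R n j))) ^+ 2.
Proof.
rewrite E4ext_weak_bilap IB_sum; last first.
  move=> j; apply: L2_sqr_integrable; apply: weak_bilap_L2.
  by have [/(_ j)] := equator_sobolev_sphere.
apply: eq_bigr => j _; rewrite -nrm_sqr; congr (_ ^+ 2).
apply: nrm_ae.
- by have [] := weak_bilap_L2 (equator_sobolev_sphere.1 j).
- exact: Sx_measurable (Sx_lap (Sx_lap (Sx_eqc 4 j))).
- exact: weak_bilap_Sx n9 _ (Sx_eqc 4 j).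
Qed.

Lemma lap4_constE : lap4_const (R := R) (n := n) =
  105 * (n%:R * (n%:R - 8) + 7) * (n%:R * (n%:R - 8) + 15).
Proof. by rewrite /lap4_const; ring. Qed.

Lemma rellich_constE :
  rellich_const (R := R) (n := n) 0 * rellich_const (R := R) (n := n) 4 =
  n%:R * (n%:R - 8) * ((n%:R ^+ 2 - 16) / 16).
Proof. by rewrite /rellich_const; field. Qed.

(** With X = n(n-8) and Z = (n^2-16)/16 the claim is 105(X+7)(X+15) <= X^2 Z^2. For [n >= 15], X >=
    105 and Z >= 12, and 144 X^2 already dominates the left-hand side. *)
Lemma lap4_const_le_rellich : (15 <= n)%N ->
  lap4_const (R := R) (n := n) <= (rellich_const (n := n) 0 * rellich_const (n := n) 4) ^+ 2.
Proof.
move=> n15; have n15R : (15 : R) <= n%:R by rewrite ler_nat.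
rewrite lap4_constE rellich_constE exprMn.
set X := _ * (n%:R - 8); set Z := (_ / 16).
have X1 : 105 <= X by rewrite /X; nra.
have Z1 : 12 <= Z by rewrite /Z ler_pdivlMr//; nra.
have : 12 ^+ 2 * X ^+ 2 <= X ^+ 2 * Z ^+ 2.
  by rewrite mulrC ler_wpM2l ?sqr_ge0// lerXn2r ?nnegrE//; lra.
by nra.
Qed.

Lemma lap4_const_ge0 : 0 <= lap4_const (R := R) (n := n).
Proof.
have n9R : (9 : R) <= n%:R by rewrite ler_nat.
by rewrite /lap4_const !mulr_ge0//; lra.
Qed.

Theorem equator_minimizing : (15 <= n)%N -> minimizing (@equator_map R n).
Proof.
move=> n15; split; first exact: equator_sobolev_sphere.
move=> v [sv av] H0.
pose u j := @eqc R n j; pose U j := lap (lap (u j)).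
pose w j := coordf (@equator_map R n \- v) j; pose W j := weak_bilap (w j).
have P j : W0pair (w j) (W j) by apply: sobolev0_W0pair => //; exact: H0.
have su j : sobolev 4 (u j) by have [/(_ j)] := equator_sobolev_sphere.
have wE j : w j = fun x => u j x - coordf v j x.
  by apply/funext => x; rewrite /w /u /eqc /coordf /= mxE [X in _ + X]mxE.
have LU j : L2 (U j).
  by apply: (@Sx_L2 R n n9 0 4) => //; exact: Sx_lap (Sx_lap (Sx_eqc 4 j)).
have LW j : L2 (W j) by have [] := P j.
have Lv j : L2 (weak_bilap (coordf v j)) by exact: weak_bilap_L2.
have ae1 j : aeB (fun x => weak_bilap (coordf v j) x = U j x - W j x).
  have h1 := weak_bilap_sub (su j) (sv j).
  have h2 := weak_bilap_Sx n9 (Sx_eqc (R := R) 4 j).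
  apply: aeB_imp (aeB_and h1 h2) => x _ [e1 e2].
  by rewrite /U -e2 /W wE e1 opprB addrC subrK.
pose l : R := lap4_const (R := R) (n := n).
have l0 : 0 <= l := lap4_const_ge0.
have Lr j := (rellich_W0pair n9 (P j)).1.
have Hr j := (rellich_W0pair n9 (P j)).2.
have i1 j := rho8_eqc_integrable n9 j (P j).
have i2 j : intB (fun x => rho x ^+ 8 * w j x ^+ 2).
  have := L2_sqr_integrable (Lr j).
  rewrite (_ : (fun x => _) = fun x => (rho x ^+ 8 * w j x ^+ 2)%:E)//.
  by apply/funext => x; congr (_%:E); ring.
rewrite E4ext_equator E4ext_weak_bilap IB_sum; last by move=> j; exact: L2_sqr_integrable.
(* The Rellich inequality acts on each component separately. The remaining integral has no sign for
   a single [j]; the constraint on the values of [v] enters only after summation. *)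
have E j : IB (fun x => weak_bilap (coordf v j) x ^+ 2) >=
    nrm (U j) ^+ 2 + l * IB (fun x => rho x ^+ 8 * (w j x ^+ 2 - 2 * (u j x * w j x))).
  rewrite -nrm_sqr (nrm_ae _ _ (ae1 j)); last 2 first.
  - by have [] := Lv j.
  - by have [] := L2_sub (LU j) (LW j).
  have e1 : nrm (fun x => U j x - W j x) ^+ 2 =
      nrm (U j) ^+ 2 - 2 * IB (fun x => U j x * W j x) + nrm (W j) ^+ 2.
    have iU := L2_sqr_integrable (LU j); have iW := L2_sqr_integrable (LW j).
    have iUW := L2_mul_integrable (LU j) (LW j).
    rewrite !nrm_sqr -IB_scale// -IB_sub//; last exact: intB_scale.
    rewrite -IB_add//; last by apply: intB_sub => //; exact: intB_scale.
    by congr IB; apply/funext => x; ring.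
  have e2 : IB (fun x => rho x ^+ 8 * (w j x ^+ 2 - 2 * (u j x * w j x))) =
      nrm (fun x => rho x ^+ 4 * w j x) ^+ 2 - 2 * IB (fun x => rho x ^+ 8 * (u j x * w j x)).
    rewrite nrm_sqr -IB_scale//.
    rewrite (_ : (fun x => (rho x ^+ 4 * w j x) ^+ 2) = fun x => rho x ^+ 8 * w j x ^+ 2); last first.
      by apply/funext => x; ring.
    rewrite -IB_sub//; last exact: intB_scale.
    by congr IB; apply/funext => x; ring.
  rewrite e1 e2 (green_W0pair n9 j (P j)) -/l.
  have Hrj := Hr j; have a0 := nrm_ge0 (fun x => rho x ^+ 4 * w j x).
  have b0 := nrm_ge0 (W j).
  move: Hrj a0 b0; set a := nrm (fun x => rho x ^+ 4 * w j x); set b := nrm (W j).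
  move=> Hrj a0 b0; have K0 := rellich_const_gt0 (R := R) n9.
  have lK := lap4_const_le_rellich n15.
  move: Hrj K0 lK; set K := (_ * rellich_const 4) => Hrj K0 lK.
  have h1 : l * a ^+ 2 <= b ^+ 2.
    apply: (@le_trans _ _ (K ^+ 2 * a ^+ 2)); first by rewrite ler_wpM2r ?sqr_ge0.
    by rewrite -exprMn lerXn2r ?nnegrE// mulr_ge0// ltW.
  rewrite mulrBr mulrCA; lra.
apply: (@le_trans _ _ (\sum_j (nrm (U j) ^+ 2 +
    l * IB (fun x => rho x ^+ 8 * (w j x ^+ 2 - 2 * (u j x * w j x)))))); last first.
  by apply: ler_sum => j _; exact: E.
rewrite big_split/= -mulr_sumr -IB_sum; last first.
  move=> j; rewrite (_ : (fun x => _) = fun x => (rho x ^+ 8 * w j x ^+ 2 - 2 * (rho x ^+ 8 * (u j x * w j x)))%:E).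
    by apply: intB_sub => //; exact: intB_scale.
  by apply/funext => x; congr (_%:E); ring.
rewrite lerDl mulr_ge0//.
apply: IB_ge0_ae.
  apply: measurable_sum => j.
  apply: measurable_funM; first by apply: measurable_funX; exact: measurableB_rho.
  have [mw _ _] := P j; have [{}mw _] := mw.
  have mu' : measurable_fun B (u j) := Sx_measurable (Sx_eqc 0 j).
  apply: measurable_funB; first exact: measurable_funX.
  by apply: measurable_funM; [exact: measurable_cst|exact: measurable_funM].
apply: aeB_imp (aeB_and (aeB_nonzero n0) av) => x _ [x0 /esphereP vx].
rewrite -mulr_sumr mulr_ge0 ?exprn_ge0 ?rho_ge0//.
(* Since w = u - v, w^2 - 2uw is v^2 - u^2, and both maps have norm 1. *)
rewrite (_ : \sum_j _ = \sum_j v x ord0 j ^+ 2 - \sum_j u j x ^+ 2); last first.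
  by rewrite -sumrB; apply: eq_bigr => j _; rewrite wE /coordf; ring.
by rewrite vx sum_eqc_sqr// subrr.
Qed.

End minimality.

(** * First and second variation *)

Section schwarz.
Context {R : realType} {V : normedModType R}.
Variables (Om : set V) (v w : V) (f : V -> R).
Hypothesis oO : open Om.

Lemma is_derive_shift (a x y : V) (g : V -> R) (s l : R) : x = s *: a + y ->
  is_derive x a g l -> is_derive s (1 : R) (fun h : R => g (h *: a + y)) l.
Proof.
move=> ->; rewrite is_derive_line => H.
have h1 : is_derive (s - s) (1 : R) (fun h : R => g (h *: a + (s *: a + y))) l by rewrite subrr.
have h2 : is_derive s (1 : R) (fun z : R => z - s) (1 : R).
  have := is_derive_fadd (is_derive_id s (1 : R)) (is_derive_cst (- s) s (1 : R)).
  by rewrite addr0.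
have := is_derive_fcomp (f := fun z : R => z - s) h1 h2; rewrite mulr1.
by congr (is_derive _ _ _ _); apply/funext => z; rewrite addrA -scalerDl subrK.
Qed.

Lemma mvt0 (F dF : R -> R) (h : R) : 0 < h ->
  (forall s : R, 0 <= s <= h -> is_derive s (1 : R) F (dF s)) ->
  exists2 s : R, 0 <= s <= h & F h - F 0 = dF s * h.
Proof.
move=> h0 H; have [||s] := @MVT_segment R F dF 0 h (ltW h0).
- by move=> x; rewrite in_itv/= => /andP[x0 xh]; apply: H; rewrite !ltW.
- by apply: derivable_within_continuous => x; rewrite in_itv/= => /H[].
by rewrite in_itv/= subr0 => sh E; exists s.
Qed.

(** The mean value theorem along [a] for the difference of two translates, then along [b] for the
    derivative so obtained. *)
Lemma second_difference_MVT (g : V -> R) (a b z : V) (h : R) : 0 < h ->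
  (forall s t : R, 0 <= s <= h -> 0 <= t <= h -> Om (s *: a + (t *: b + z))) ->
  (forall y, Om y -> is_derive y a g ('D_a g y)) ->
  (forall y, Om y -> is_derive y b ('D_a g) ('D_b ('D_a g) y)) ->
  exists s t : R, [/\ 0 <= s <= h, 0 <= t <= h &
    g (h *: a + (h *: b + z)) - g (h *: a + z) - (g (h *: b + z) - g z) =
    'D_b ('D_a g) (s *: a + (t *: b + z)) * h * h].
Proof.
move=> h0 HO Ha Hb; have h0' := ltW h0.
have O0 s : 0 <= s <= h -> Om (s *: a + z).
  by move=> sh; have := HO s 0 sh; rewrite scale0r add0r; apply; rewrite lexx.
pose F (s : R) := g (s *: a + (h *: b + z)) - g (s *: a + z).
have dF s : 0 <= s <= h -> is_derive s (1 : R) F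
    ('D_a g (s *: a + (h *: b + z)) - 'D_a g (s *: a + z)).
  move=> sh; apply: is_derive_fadd; last apply: is_derive_fopp.
    by apply: is_derive_shift erefl _; apply/Ha/HO => //; rewrite h0' lexx.
  by apply: is_derive_shift erefl _; apply/Ha/O0.
have [s sh Es] := mvt0 h0 dF.
have dG t : 0 <= t <= h -> is_derive t (1 : R) (fun t : R => 'D_a g (t *: b + (s *: a + z)))
    ('D_b ('D_a g) (s *: a + (t *: b + z))).
  move=> th; have E : s *: a + (t *: b + z) = t *: b + (s *: a + z) by rewrite addrCA.
  exact: (is_derive_shift E (Hb _ (HO _ _ sh th))).
have [t th Et] := mvt0 h0 dG.
exists s, t; split => //; rewrite -Et scale0r add0r (addrCA (h *: b)) -Es /F.
by rewrite scale0r !add0r.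
Qed.

(** The second difference over a small parallelogram is symmetric in [v] and [w]. It is h^2 times
    either mixed derivative, each at some nearby point, so continuity forces the two to agree at
    [z]. *)
Lemma derive_comm z : Om z ->
  (forall y, Om y -> is_derive y v f ('D_v f y)) ->
  (forall y, Om y -> is_derive y w f ('D_w f y)) ->
  (forall y, Om y -> is_derive y w ('D_v f) ('D_w ('D_v f) y)) ->
  (forall y, Om y -> is_derive y v ('D_w f) ('D_v ('D_w f) y)) ->
  {for z, continuous ('D_w ('D_v f))} -> {for z, continuous ('D_v ('D_w f))} ->
  'D_w ('D_v f) z = 'D_v ('D_w f) z.
Proof.
move=> Oz fv fw fvw fwv c1 c2; apply/eqP; rewrite -subr_eq0 -normr_le0.
apply/ler_addgt0Pr => e e0; rewrite add0r.
have e2 : 0 < e / 2 by rewrite divr_gt0.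
have H : \forall y \near z, [/\ Om y, `|'D_w ('D_v f) z - 'D_w ('D_v f) y| < e / 2 &
    `|'D_v ('D_w f) z - 'D_v ('D_w f) y| < e / 2].
  have c1' : 'D_w ('D_v f) y @[y --> z] --> 'D_w ('D_v f) z by exact: c1.
  have c2' : 'D_v ('D_w f) y @[y --> z] --> 'D_v ('D_w f) z by exact: c2.
  have /cvgrPdist_lt/(_ _ e2) H1 := c1'; have /cvgrPdist_lt/(_ _ e2) H2 := c2'.
  have H0 : \forall y \near z, Om y by exact: open_nbhs_nbhs.
  by apply: filterS3 H0 H1 H2 => y a b c; exact: And3 a b c.
have [r /= r0 Hr] := (nbhs_ballP _ _).1 H.
(* Small enough to keep the whole parallelogram in the ball of radius [r]; the 1 covers the case
   [v = w = 0]. *)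
pose h := r / (2 * (`|v| + `|w| + 1)).
have h0 : 0 < h by rewrite divr_gt0// mulr_gt0.
have hr : h * (`|v| + `|w| + 1) < r.
  rewrite /h invfM mulrA mulfVK ?gt_eqF//; by rewrite ltr_pdivrMr// ltr_pMr// ltr1n.
have N (s t : R) : 0 <= s <= h -> 0 <= t <= h -> ball z r (s *: v + (t *: w + z)).
  move=> /andP[s0 sh] /andP[t0 th]; rewrite -ball_normE /ball_/=.
  rewrite addrA opprD addrCA subrr addr0 normrN; apply: le_lt_trans (ler_normD _ _) _.
  rewrite !normrZ !ger0_norm//; apply: le_lt_trans hr.
  rewrite !mulrDr mulr1 -[leLHS]addr0; apply: lerD; last exact: ltW.
  by apply: lerD; rewrite ler_wpM2r.
have N' (s t : R) : 0 <= s <= h -> 0 <= t <= h -> ball z r (s *: w + (t *: v + z)).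
  by move=> sh th; rewrite addrCA; exact: N.
have O1 (s t : R) : 0 <= s <= h -> 0 <= t <= h -> Om (s *: v + (t *: w + z)).
  by move=> sh th; have [] := Hr _ (N s t sh th).
have O2 (s t : R) : 0 <= s <= h -> 0 <= t <= h -> Om (s *: w + (t *: v + z)).
  by move=> sh th; have [] := Hr _ (N' s t sh th).
have [s [t [sh th E1]]] := second_difference_MVT h0 O1 fv fvw.
have [s' [t' [sh' th' E2]]] := second_difference_MVT h0 O2 fw fwv.
have [_ A1 _] := Hr _ (N s t sh th); have [_ _ A2] := Hr _ (N' s' t' sh' th').
move: A1 A2 E1 E2; rewrite [h *: w + (h *: v + z)]addrCA.
set p := 'D_w ('D_v f) (_ + _); set q := 'D_v ('D_w f) (_ + _) => A1 A2 E1 E2.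
have pq : p = q.
  have h1 : h != 0 by rewrite gt_eqF.
  have sub4 (A B C D : R) : A - B - (C - D) = A - C - (B - D) by ring.
  have : p * h * h = q * h * h by exact: etrans (esym E1) (etrans (sub4 _ _ _ _) E2).
  by move=> /(mulIf h1)/(mulIf h1).
have H3 (a b c d : R) : `|a - c| < d / 2 -> `|b - c| < d / 2 -> `|a - b| <= d.
  move=> /ltW h1 /ltW h2; rewrite [leRHS]splitr; apply: le_trans (ler_distD c _ _) _.
  by rewrite [X in _ + X]distrC lerD.
by apply: H3 A1 _; rewrite pq.
Qed.

End schwarz.

Section commuting_partials.
Context {R : realType} {n : nat}.
Local Notation rV := 'rV[R]_n.
Local Notation e_ i := (delta_mx ord0 i : rV).
Implicit Types f : rV -> R.

Lemma smooth_D_comm f i j : smooth f -> 'D_(e_ i) ('D_(e_ j) f) = 'D_(e_ j) ('D_(e_ i) f).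
Proof.
move=> sf; apply/funext => x.
have cD k l : {for x, continuous ('D_(e_ k) ('D_(e_ l) f))}.
  exact: (smooth_continuous (smooth_D k (smooth_D l sf))).
have si := smooth_D i sf; have sj := smooth_D j sf.
exact: (@derive_comm R rV setT (e_ j) (e_ i) f openT x I
  (fun y _ => smooth_derive j y sf) (fun y _ => smooth_derive i y sf)
  (fun y _ => smooth_derive i y sj) (fun y _ => smooth_derive j y si)
  (cD _ _) (cD _ _)).
Qed.

(** Needed for [sobolev0], which compares the weak derivative along [s], known to be the classical
    one along [rev s], with the classical one along [s]. *)
Lemma smooth_iter_partial_rev f s : smooth f -> iter_partial (rev s) f = iter_partial s f.
Proof.
elim: s f => //= i s IH f sf; rewrite rev_cons iter_partial_rcons IH; last exact: smooth_D.
elim: s {IH} => //= j s ->.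
exact: smooth_D_comm _ _ (smooth_iter_partial s sf).
Qed.

End commuting_partials.

(** * Families of singular functions depending on time *)

Section slab.
Context {R : realType} {n : nat}.
Local Notation rV := 'rV[R]_n.
Local Notation e_ i := (delta_mx ord0 i : rV).
Local Notation B := (@eball R n).
Local Notation V := (R * rV)%type.
Variable d : R.
Implicit Types (f g : V -> R) (h : rV -> R) (t : R) (x : rV).

Definition Dt f : V -> R := 'D_((1, 0) : V) f.
Definition Dx (i : 'I_n) f : V -> R := 'D_((0, e_ i) : V) f.

Lemma slab_dom (z : V) : lev_dom (tlevel (n := n) d) z <-> `|z.1| < d /\ z.2 != 0.
Proof. by split => [[]|[]]. Qed.

Lemma DxE i f t x : Dx i f (t, x) = 'D_(e_ i) (fun y => f (t, y)) x.
Proof.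
rewrite /Dx /derive; set g1 := fun s : R => s^-1 *: _; set g2 := fun s : R => s^-1 *: _.
suff -> : g1 = g2 by [].
rewrite funeqE /g1 /g2 => s /=; congr (_ *: (f _ - _)).
by congr pair; rewrite /= scaler0 add0r.
Qed.

Lemma DtE f t x : Dt f (t, x) = 'D_1 (fun s : R => f (s, x)) t.
Proof.
rewrite /Dt /derive; set g1 := fun s : R => s^-1 *: _; set g2 := fun s : R => s^-1 *: _.
suff -> : g1 = g2 by [].
rewrite funeqE /g1 /g2 => s /=; congr (_ *: (f _ - _)).
by congr pair; rewrite /= scaler0 add0r.
Qed.

Lemma is_derive_Dx i f t x l :
  is_derive ((t, x) : V) ((0, e_ i) : V) f l <-> is_derive x (e_ i) (fun y => f (t, y)) l.
Proof.
rewrite [X in X <-> _]is_derive_line [X in _ <-> X]is_derive_line.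
rewrite (_ : (fun _ => _) = fun h : R => f (t, h *: e_ i + x))//.
by apply/funext => s; congr f; congr pair; rewrite /= scaler0 add0r.
Qed.

Lemma is_derive_Dt f t x l :
  is_derive ((t, x) : V) ((1, 0) : V) f l <-> is_derive t (1 : R) (fun s => f (s, x)) l.
Proof.
rewrite [X in X <-> _]is_derive_line [X in _ <-> X]is_derive_line.
rewrite (_ : (fun _ => _) = fun h : R => f (h *: 1 + t, x))//.
by apply/funext => s; congr f; congr pair; rewrite /= scaler0 add0r.
Qed.

Lemma St_Dx N k f i : St d N.+1 k f -> St d N k.+1 (Dx i f).
Proof. by move=> /(ck_D (Some i)); rewrite addn1. Qed.

Lemma St_Dt N k f : St d N.+1 k f -> St d N k (Dt f).
Proof. by move=> /(ck_D None); rewrite addn0. Qed.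

Lemma St_is_derive_x N k f i z : St d N.+1 k f -> `|z.1| < d -> z.2 != 0 ->
  is_derive z ((0, e_ i) : V) f (Dx i f z).
Proof. by move=> F z1 z2; apply: (ck_derivable (Some i) F); apply/slab_dom. Qed.

Lemma St_is_derive_t N k f z : St d N.+1 k f -> `|z.1| < d -> z.2 != 0 ->
  is_derive z ((1, 0) : V) f (Dt f z).
Proof. by move=> F z1 z2; apply: (ck_derivable None F); apply/slab_dom. Qed.

Lemma St_continuous N k f z : St d N k f -> `|z.1| < d -> z.2 != 0 -> {for z, continuous f}.
Proof. by move=> /ck_lev[c _] z1 z2; apply: c; apply/slab_dom. Qed.

Lemma St_bound N k f : St d N k f -> exists2 C : R, 0 <= C &
  forall t x, `|t| < d -> x != 0 -> B x -> `|f (t, x)| <= C * rho x ^+ k.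
Proof.
move=> /ck_lev/sym_lev_C[C C0 HC]; exists C => // t x td x0 Bx.
by apply: (HC (t, x)) => //; apply/slab_dom.
Qed.

Lemma St_make N k f (ft : V -> R) (fx : 'I_n -> V -> R) : lev (tlevel d) k f ->
  St d N k ft -> (forall i, St d N k.+1 (fx i)) ->
  (forall t x, `|t| < d -> x != 0 -> is_derive t (1 : R) (fun s => f (s, x)) (ft (t, x))) ->
  (forall i t x, `|t| < d -> x != 0 ->
    is_derive x (e_ i) (fun y => f (t, y)) (fx i (t, x))) -> St d N.+1 k f.
Proof.
move=> lf Ft Fx Ht Hx; apply: (@ck_make _ _ _ _ _ _ _ _ _ (fun o => if o is Some i then fx i else ft)) => //.
  case=> [i|]; first by have := Fx i; rewrite -addn1.
  by have := Ft; rewrite -[X in St _ _ X]addn0.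
case=> [i|] [t x] /slab_dom[/= td x0]; first exact/is_derive_Dx/Hx.
exact/is_derive_Dt/Ht.
Qed.

Lemma St_slice N k f t : `|t| < d -> St d N k f -> Sx N k (fun x => f (t, x)).
Proof.
move=> td; have L k' g : lev (tlevel d) k' g -> lev xlevel k' (fun x => g (t, x)).
  move=> [c [C HC]]; split => [x /xlevel_dom x0|].
    have : g @ (t, x) --> g (t, x) by apply: (c (t, x)); apply/slab_dom.
    move=> ctx; have h1 : {for x, continuous (fun _ : rV => t)} by exact: (@cst_continuous rV R t x).
    have h2 : {for x, continuous (id : rV -> rV)} by exact: cvg_id.
    exact: cvg_comp (cvg_pair h1 h2) ctx.
  by exists C => x /xlevel_dom x0 Bx; apply: (HC (t, x)) => //; apply/slab_dom.
elim: N k f => [|N IH] k f F; first by split => //; apply: L; exact: ck_lev F.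
apply: (Sx_make (d := fun i x => Dx i f (t, x))).
- by apply: L; exact: ck_lev F.
- by move=> i; apply: IH; exact: St_Dx.
- by move=> i x x0; apply/is_derive_Dx; exact: St_is_derive_x F _ _.
Qed.

Lemma St_lift N k h : Sx N k h -> St d N k (fun z => h z.2).
Proof.
have L k' (g : rV -> R) : lev xlevel k' g -> lev (tlevel d) k' (fun z => g z.2).
  move=> [c [C HC]]; split => [[t x] /slab_dom[/= td x0]|].
    have cx : {for x, continuous g} by apply: c; apply/xlevel_dom.
    have hs : (snd : V -> rV) z @[z --> (t, x)] --> x by exact: cvg_snd.
    exact: cvg_comp hs cx.
  by exists C => -[t x] /slab_dom[/= td x0] Bx; apply: HC => //; apply/xlevel_dom.
elim: N k h => [|N IH] k h H; first by split => //; apply: L; exact: ck_lev H.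
apply: (@St_make _ _ _ (fun=> 0) (fun i z => 'D_(e_ i) h z.2)).
- by apply: L; exact: ck_lev H.
- by apply: (@ck_le _ _ _ _ _ _ _ 0) => //; exact: ck_cst.
- by move=> i; exact: (IH k.+1 ('D_(e_ i) h) (Sx_D i H)).
- by move=> t x _ _; exact: (is_derive_cst (h x) t (1 : R)).
- by move=> i t x _ x0; exact: Sx_derive H x0.
Qed.

Lemma St_time N : St d N 0 (fun z : V => z.1).
Proof.
have L : lev (tlevel d) 0 (fun z : V => z.1).
  split => [z _|]; first exact: cvg_fst.
  by exists d => z /slab_dom[z1 _] _; rewrite expr0 mulr1 ltW.
elim: N => [|N IH]; first by split.
have Z k : St d N k (fun _ : V => (0 : R)).
  by apply: (@ck_le _ _ _ _ _ _ _ 0) => //; exact: ck_cst.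
exact: (St_make L (ck_cst _ _ _ N (1 : R)) (fun _ : 'I_n => Z _)
  (fun t x _ _ => is_derive_id t (1 : R)) (fun i t x _ _ => is_derive_cst t x (e_ i))).
Qed.

End slab.

Section slab_laplacian.
Context {R : realType} {n : nat}.
Local Notation rV := 'rV[R]_n.
Local Notation e_ i := (delta_mx ord0 i : rV).
Local Notation mu := (@lebesgue_measure_rV R n).
Local Notation B := (@eball R n).
Local Notation intB f := (mu.-integrable B (fun x => (f x)%:E)).
Local Notation V := (R * rV)%type.
Variable d : R.
Implicit Types (f g : V -> R) (h : rV -> R) (t : R) (x : rV).

Lemma slab_Dx_ext f g i z : (forall y, lev_dom (tlevel d) y -> f y = g y) ->
  lev_dom (tlevel d) z -> Dx i f z = Dx i g z.
Proof.
by move=> fg Oz; apply: near_eq_derive; exact: near_open_eq (@lev_open _ _ (tlevel d)) fg Oz.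
Qed.

Lemma St_comm N k f i z : St d N.+2 k f -> lev_dom (tlevel d) z ->
  Dt (Dx i f) z = Dx i (Dt f) z.
Proof.
move=> F Oz.
have Fx : St d N.+1 k.+1 (Dx i f) := St_Dx i F.
have Ft : St d N.+1 k (Dt f) := St_Dt F.
have [z1 z2] : `|z.1| < d /\ z.2 != 0 by apply/slab_dom.
have c1 : {for z, continuous (Dt (Dx i f))} := St_continuous (St_Dt Fx) z1 z2.
have c2 : {for z, continuous (Dx i (Dt f))} := St_continuous (St_Dx i Ft) z1 z2.
have ix g M l : St d M.+1 l g -> forall y, lev_dom (tlevel d) y ->
    is_derive y ((0, e_ i) : V) g (Dx i g y).
  by move=> G y /slab_dom[y1 y2]; exact: St_is_derive_x G y1 y2.
have it g M l : St d M.+1 l g -> forall y, lev_dom (tlevel d) y ->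
    is_derive y ((1, 0) : V) g (Dt g y).
  by move=> G y /slab_dom[y1 y2]; exact: St_is_derive_t G y1 y2.
exact: (@derive_comm R V (lev_dom (tlevel d)) ((0, e_ i) : V) ((1, 0) : V) f
  (@lev_open _ _ (tlevel d)) z Oz (ix _ _ _ F) (it _ _ _ F) (it _ _ _ Fx) (ix _ _ _ Ft) c1 c2).
Qed.

Definition slap f : V -> R := fun z => \sum_i Dx i (Dx i f) z.

Lemma slapE f t x : slap f (t, x) = lap (fun y => f (t, y)) x.
Proof.
rewrite lapE; apply: eq_bigr => i _; rewrite DxE; congr ('D_(e_ i) _ x).
by apply/funext => y; rewrite DxE.
Qed.

Lemma slap2E f t x : slap (slap f) (t, x) = lap (lap (fun y => f (t, y))) x.
Proof. by rewrite slapE; congr (lap _ x); apply/funext => y; exact: slapE. Qed.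

Lemma St_slap N k f : St d N.+2 k f -> St d N k.+2 (slap f).
Proof. by move=> F; apply: ck_sum => i; exact: St_Dx i (St_Dx i F). Qed.

Lemma slap_ext f g z : (forall y, lev_dom (tlevel d) y -> f y = g y) ->
  lev_dom (tlevel d) z -> slap f z = slap g z.
Proof.
move=> fg Oz; apply: eq_bigr => i _; apply: slab_Dx_ext Oz => y Oy.
exact: slab_Dx_ext.
Qed.

Lemma Dt_slap N k f z : St d N.+3 k f -> lev_dom (tlevel d) z ->
  Dt (slap f) z = slap (Dt f) z.
Proof.
move=> F Oz.
have H i : is_derive z ((1, 0) : V) (Dx i (Dx i f)) (Dt (Dx i (Dx i f)) z).
  by have [z1 z2] := (slab_dom d z).1 Oz; exact: St_is_derive_t (St_Dx i (St_Dx i F)) z1 z2.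
have [_ E] := is_derive_fsum (index_enum 'I_n) H.
rewrite [LHS]E; apply: eq_bigr => i _; rewrite (St_comm i (St_Dx i F) Oz).
by apply: slab_Dx_ext Oz => y Oy; exact: St_comm F Oy.
Qed.

Lemma Dt_slap2 N k f z : St d N.+1.+4 k f -> lev_dom (tlevel d) z ->
  Dt (slap (slap f)) z = slap (slap (Dt f)) z.
Proof.
move=> F Oz; rewrite (Dt_slap (St_slap F) Oz); apply: slap_ext Oz => y Oy.
exact: Dt_slap F Oy.
Qed.

Hypothesis n9 : (9 <= n)%N.
Let n0 : (0 < n)%N. Proof. exact: leq_trans n9. Qed.

(** Differentiating in time does not raise the order, so C rho^k with k <= 8 dominates the time
    derivative uniformly in the slab. *)
Lemma is_derive_IB N k f t : (k <= 8)%N -> St d N.+1 k f -> `|t| < d ->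
  is_derive t (1 : R) (fun s => IB (fun x => f (s, x))) (IB (fun x => Dt f (t, x))).
Proof.
move=> k8 F td; have Ft := St_Dt F.
have S s : `|s| < d -> Sx N.+1 k (fun x => f (s, x)) by move=> sd; exact: St_slice sd F.
(* At the origin [f] need not be differentiable in time; changing this one value, which is
   negligible, makes the hypotheses hold at every point of the ball. *)
pose F0 (s : R) x := if x == 0 then 0 else f (s, x).
have E (g : rV -> R) (g' : rV -> R) M l : Sx M l g -> Sx M l g' -> (forall x, x != 0 -> g x = g' x) -> IB g = IB g'.
  move=> G G' gg; apply: IB_ae; [exact: Sx_measurable G|exact: Sx_measurable G'|].
  by apply: aeB_imp (aeB_nonzero n0) => x _; exact: gg.
have F0E s x : x != 0 -> f (s, x) = F0 s x by rewrite /F0 => /negbTE ->.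
have S0 s : `|s| < d -> Sx N.+1 k (F0 s).
  by move=> sd; apply: Sx_ext (S s sd) => x; exact: F0E.
have EF s : `|s| < d -> IB (fun x => f (s, x)) = IB (F0 s).
  by move=> sd; apply: E (S s sd) (S0 s sd) _ => x; exact: F0E.
have [C C0 HC] := St_bound Ft.
pose u := (- d); pose I : set R := `]u, d[%classic.
have II s : I s -> `|s| < d by rewrite /I /= in_itv/= -ltr_norml.
have It : I t by rewrite /I /= in_itv/= -ltr_norml.
have dF s x : `|s| < d -> is_derive s (1 : R) (F0 ^~ x) (if x == 0 then 0 else Dt f (s, x)).
  move=> sd; rewrite /F0; case: (eqVneq x 0) => [_|x0]; first exact: (is_derive_cst (0 : R) s (1 : R)).
  exact: ((is_derive_Dt f s x _).1 (St_is_derive_t (z := (s, x)) F sd x0)).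
have dF' s x : I s -> B x -> derivable (F0 ^~ x) s (1 : R) by move=> /II sd _; have [] := dF s x sd.
have d1 s x : `|s| < d -> partial1of2 F0 s x = if x == 0 then 0 else Dt f (s, x).
  by move=> sd; rewrite partial1of2E; have [_] := dF s x sd.
have iG : intB (fun x => C * rho x ^+ k).
  by apply: intB_scale; exact: (@Sx_integrable R n n9 0 k _ k8 (Sx_rhoX 0 k)).
have G0 x : 0 <= C * rho x ^+ k by rewrite mulr_ge0// exprn_ge0// rho_ge0.
have ub s x : I s -> B x -> `|partial1of2 F0 s x| <= C * rho x ^+ k.
  move=> /II sd Bx; rewrite d1//; case: (eqVneq x 0) => [_|x0]; first by rewrite normr0.
  exact: HC.
have iF s : I s -> intB (F0 s) by move=> /II sd; exact: (@Sx_integrable R n n9 N.+1 k (F0 s) k8 (S0 s sd)).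
have D1 := derivable_under_integral eball_measurable It iF dF' G0 iG ub.
have D2 := differentiation_under_integral eball_measurable It iF dF' G0 iG ub.
have D : is_derive t (1 : R) (fun s => IB (F0 s)) (IB (fun x => Dt f (t, x))).
  apply: DeriveDef; first exact: D1.
  rewrite -derive1E [LHS]D2; apply: (E _ _ N k) => [||x x0].
  - apply: Sx_ext (St_slice td Ft) => x x0.
    by rewrite d1// (negbTE x0).
  - exact: St_slice td Ft.
  - by rewrite d1// (negbTE x0).
apply: near_eq_is_derive D.
apply: filterS (near_in_itvoo It) => s Is; rewrite EF//; exact: II.
Qed.

End slab_laplacian.

Section derive_square.
Context {R : realType} {W : normedModType R}.
Implicit Types (f g : W -> R) (x v : W).

Lemma is_derive_fsqr f x v (a : R) : is_derive x v f a ->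
  is_derive x v (fun y => f y ^+ 2) (2 * (f x * a)).
Proof.
move=> fa; have h := is_derive_fmul fa fa.
have -> : (fun y => f y ^+ 2) = fun y => f y * f y by apply/funext => y; rewrite expr2.
by apply: (is_derive_eq h); ring.
Qed.

Lemma is_derive_double_fmul f g x v (a b : R) : is_derive x v f a -> is_derive x v g b ->
  g x = a -> is_derive x v (fun y => 2 * (f y * g y)) (2 * (a ^+ 2 + f x * b)).
Proof.
move=> fa gb ga; have h := is_derive_fmul (is_derive_cst (2 : R) x v) (is_derive_fmul fa gb).
by apply: (is_derive_eq h); rewrite /= ga; ring.
Qed.

End derive_square.

(** * Renormalised segments *)

Section normalized_path.
Context {R : realType}.
Variables a b al be : R.

Let Q (t : R) : R := 1 + 2 * t * al + t ^+ 2 * be.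
Let P (t : R) : R := (Num.sqrt (Q t))^-1.

(** A component of the projection of u + t phi onto the sphere, for |u| = 1: here a = u_j, b =
    phi_j, al = u.phi and be = |phi|^2, and the squared norm of u + t phi is [Q t]. *)
Definition npath (t : R) : R := (a + t * b) * P t.
Definition dnpath (t : R) : R :=
  b * P t + (a + t * b) * (- (P t ^+ 3 * (al + t * be))).

Let is_derive_P t : 0 < Q t -> is_derive t (1 : R) P (- (P t ^+ 3 * (al + t * be))).
Proof.
move=> Q0; have dQ : is_derive t (1 : R) Q (2 * al + 2 * t * be).
  have i1 := is_derive_id t (1 : R).
  have h1 := is_derive_fmul (is_derive_fmul (is_derive_cst (2 : R) t (1 : R)) i1) (is_derive_cst al t (1 : R)).
  have h2 := is_derive_fmul (is_derive_fmul i1 i1) (is_derive_cst be t (1 : R)).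
  have h := is_derive_fadd (is_derive_fadd (is_derive_cst (1 : R) t (1 : R)) h1) h2.
  have -> : Q = fun s => 1 + 2 * s * al + s * s * be by apply/funext => s; rewrite /Q expr2.
  by apply: (is_derive_eq h); rewrite /=; ring.
by have h := is_derive_rsqrt Q0 dQ; apply: (is_derive_eq h); rewrite -/(P t); field.
Qed.

Let is_derive_lin t : is_derive t (1 : R) (fun s => a + s * b) b.
Proof.
have h := is_derive_fadd (is_derive_cst a t (1 : R))
  (is_derive_fmul (is_derive_id t (1 : R)) (is_derive_cst b t (1 : R))).
by apply: (is_derive_eq h); rewrite /=; ring.
Qed.

Lemma is_derive_npath t : 0 < Q t -> is_derive t (1 : R) npath (dnpath t).
Proof. by move=> Q0; exact: is_derive_fmul (is_derive_lin t) (is_derive_P Q0). Qed.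

Let Q0 : Q 0 = 1. Proof. by rewrite /Q; ring. Qed.
Let P0 : P 0 = 1. Proof. by rewrite /P Q0 sqrtr1 invr1. Qed.

Lemma npath0 : npath 0 = a. Proof. by rewrite /npath P0; ring. Qed.
Lemma dnpath0 : dnpath 0 = b - al * a. Proof. by rewrite /dnpath P0; ring. Qed.

Lemma is_derive_dnpath0 :
  is_derive (0 : R) (1 : R) dnpath (- 2 * al * b + (3 * al ^+ 2 - be) * a).
Proof.
have dP : is_derive (0 : R) (1 : R) P (- (P 0 ^+ 3 * (al + 0 * be))) by apply: is_derive_P; rewrite Q0.
have h1 := is_derive_fmul (is_derive_cst b (0 : R) (1 : R)) dP.
have h3 := is_derive_fmul dP (is_derive_fmul dP dP).
have h4 := is_derive_fadd (is_derive_cst al (0 : R) (1 : R))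
  (is_derive_fmul (is_derive_id (0 : R) (1 : R)) (is_derive_cst be (0 : R) (1 : R))).
have h := is_derive_fadd h1 (is_derive_fmul (is_derive_lin 0) (is_derive_fopp (is_derive_fmul h3 h4))).
have -> : dnpath = fun s => b * P s + (a + s * b) * - (P s * (P s * P s) * (al + s * be)).
  by apply/funext => s; rewrite /dnpath !exprS expr0 mulr1.
by apply: (is_derive_eq h); rewrite /= P0; ring.
Qed.

End normalized_path.

Section energy.
Context {R : realType} {n : nat}.
Hypothesis n9 : (9 <= n)%N.
Local Notation rV := 'rV[R]_n.
Local Notation e_ i := (delta_mx ord0 i : rV).
Local Notation mu := (@lebesgue_measure_rV R n).
Local Notation B := (@eball R n).
Local Notation intB f := (mu.-integrable B (fun x => (f x)%:E)).
Local Notation V := (R * rV)%type.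
Let n0 : (0 < n)%N. Proof. exact: leq_trans n9. Qed.

Lemma E4ext_Sx m (v : rV -> 'rV[R]_m) : (forall j, Sx 4 0 (coordf v j)) ->
  E4ext v = IB (fun x => \sum_j lap (lap (coordf v j)) x ^+ 2).
Proof.
move=> Sv; rewrite E4ext_weak_bilap; apply: IB_ae.
- apply: measurable_sum => j; apply: measurable_funX.
  by have [] := weak_bilap_L2 (Sx_sobolev n9 (leqnn 4) (Sv j)).
- apply: measurable_sum => j; apply: measurable_funX.
  exact: Sx_measurable (Sx_lap (Sx_lap (Sv j))).
- have := aeB_forall (fun j => weak_bilap_Sx n9 (Sv j)).
  by apply: aeB_imp => x _ H; apply: eq_bigr => j _; rewrite H.
Qed.

Lemma green_eqc_sum (psi : 'I_(n + 1) -> rV -> R) :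
  (forall j, Sx 4 0 (psi j)) -> (forall j, csupp (psi j)) ->
  IB (fun x => \sum_j lap (lap (eqc j)) x * lap (lap (psi j)) x) =
  lap4_const (n := n) * IB (fun x => rho x ^+ 8 * \sum_j eqc j x * psi j x).
Proof.
move=> S c.
have i1 j : intB (fun x => lap (lap (eqc j)) x * lap (lap (psi j)) x).
  apply: (@Sx_integrable R n n9 0 (4 + 4)) => //.
  by apply: Sx_mul; [exact: Sx_lap (Sx_lap (Sx_eqc 4 j))|exact: Sx_lap (Sx_lap (S j))].
have S2 j : Sx 0 (8 + (0 + 0)) (fun x => rho x ^+ 8 * (eqc j x * psi j x)).
  apply: Sx_mul; first exact: Sx_rhoX.
  by apply: Sx_mul; [exact: Sx_eqc|exact: Sx_leN (S j)].
have i2 j : intB (fun x => rho x ^+ 8 * (eqc j x * psi j x)).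
  exact: (@Sx_integrable R n n9 0 (8 + (0 + 0)) _ _ (S2 j)).
rewrite IB_sum// (_ : (fun x => rho x ^+ 8 * _) =
    fun x => \sum_j rho x ^+ 8 * (eqc j x * psi j x)); last first.
  by apply/funext => x; rewrite mulr_sumr.
rewrite IB_sum// mulr_sumr; apply: eq_bigr => j _.
rewrite (green2 n9 (Sx_eqc 8 j) (S j) (c j)) -IB_scale//.
apply: (IB_Sx_ext n9 (N := 0) (M := 0) (k := 8 + 0) (l := 8)).
- apply: Sx_mul; last exact: Sx_leN (S j).
  exact: Sx_lap (Sx_lap (Sx_lap (Sx_lap (Sx_eqc 8 j)))).
- exact: Sx_scale.
- by move=> x x0 _; rewrite lap4_eqc//; ring.
Qed.

Section slab_energy.
Variables (m : nat) (d : R) (F : 'I_m -> V -> R).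
Hypothesis SF : forall N j, St d N 0 (F j).

(** The energy density followed by its first two time derivatives, see [Dtg] and [Dtg1]. Each is a
    sum of products of two bilaplacians of order 4, hence of order 8. *)
Let g (z : V) := \sum_j slap (slap (F j)) z ^+ 2.
Let g1 (z : V) := \sum_j 2 * (slap (slap (F j)) z * slap (slap (Dt (F j))) z).
Let g2 (z : V) := \sum_j 2 * (slap (slap (Dt (F j))) z ^+ 2 +
  slap (slap (F j)) z * slap (slap (Dt (Dt (F j)))) z).

Let S2 N j : St d N 4 (slap (slap (F j))).
Proof. exact: St_slap (St_slap (SF N.+4 j)). Qed.
Let S2t N j : St d N 4 (slap (slap (Dt (F j)))).
Proof. exact: St_slap (St_slap (St_Dt (SF N.+1.+4 j))). Qed.

Let dS2 j z : lev_dom (tlevel d) z ->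
  is_derive z ((1, 0) : V) (slap (slap (F j))) (slap (slap (Dt (F j))) z).
Proof.
move=> Oz; have [z1 z2] := (slab_dom d z).1 Oz.
by rewrite -(Dt_slap2 (SF 5 j) Oz); exact: St_is_derive_t (S2 1 j) z1 z2.
Qed.

Let dS2t j z : lev_dom (tlevel d) z ->
  is_derive z ((1, 0) : V) (slap (slap (Dt (F j)))) (slap (slap (Dt (Dt (F j)))) z).
Proof.
move=> Oz; have [z1 z2] := (slab_dom d z).1 Oz.
by rewrite -(Dt_slap2 (St_Dt (SF 6 j)) Oz); exact: St_is_derive_t (S2t 1 j) z1 z2.
Qed.

Let Sg N : St d N 8 g.
Proof. by apply: ck_sum => j; exact: (ck_exp 2 (S2 N j)). Qed.
Let Sg1 N : St d N 8 g1.
Proof. by apply: ck_sum => j; apply: ck_scale; exact: (ck_mul (S2 N j) (S2t N j)). Qed.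

Let Dtg z : lev_dom (tlevel d) z -> Dt g z = g1 z.
Proof.
move=> Oz; have H j : is_derive z ((1, 0) : V) (fun y => slap (slap (F j)) y ^+ 2)
    (2 * (slap (slap (F j)) z * slap (slap (Dt (F j))) z)).
  exact: is_derive_fsqr (dS2 j Oz).
by have [_] := is_derive_fsum (index_enum 'I_m) H.
Qed.

Let Dtg1 z : lev_dom (tlevel d) z -> Dt g1 z = g2 z.
Proof.
move=> Oz; have H j : is_derive z ((1, 0) : V)
    (fun y => 2 * (slap (slap (F j)) y * slap (slap (Dt (F j))) y))
    (2 * (slap (slap (Dt (F j))) z ^+ 2 + slap (slap (F j)) z * slap (slap (Dt (Dt (F j)))) z)).
  exact: is_derive_double_fmul (dS2 j Oz) (dS2t j Oz) erefl.
by have [_] := is_derive_fsum (index_enum 'I_m) H.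
Qed.

Let dom t x : `|t| < d -> x != 0 -> lev_dom (tlevel d) ((t, x) : V).
Proof. by move=> td x0; apply/slab_dom. Qed.

Let IB_slab (f h : V -> R) N M t : `|t| < d -> St d N 8 f -> St d M 8 h ->
  (forall z, lev_dom (tlevel d) z -> f z = h z) ->
  IB (fun x => f (t, x)) = IB (fun x => h (t, x)).
Proof.
move=> td Sf Sh fh; apply: (IB_Sx_ext n9 (St_slice td Sf) (St_slice td Sh)) => //.
by move=> x x0 _; apply/fh/dom.
Qed.

Definition slab_energy (t : R) : R := IB (fun x => g (t, x)).
Definition slab_energy1 (t : R) : R := IB (fun x => g1 (t, x)).
Definition slab_energy2 (t : R) : R := IB (fun x => g2 (t, x)).

Lemma is_derive_slab_energy t : `|t| < d ->
  is_derive t (1 : R) slab_energy (slab_energy1 t).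
Proof.
move=> td; have h := is_derive_IB n9 (leqnn 8) (Sg 1) td.
by apply: (is_derive_eq h); exact: IB_slab td (St_Dt (Sg 1)) (Sg1 0) Dtg.
Qed.

Lemma is_derive_slab_energy1 t : `|t| < d ->
  is_derive t (1 : R) slab_energy1 (slab_energy2 t).
Proof.
move=> td; have h := is_derive_IB n9 (leqnn 8) (Sg1 1) td.
apply: (is_derive_eq h); apply: (IB_slab td (St_Dt (Sg1 1)) _ Dtg1).
exact: ck_ext Dtg1 (St_Dt (Sg1 1)).
Qed.

Lemma slab_energyE t : slab_energy t =
  IB (fun x => \sum_j lap (lap (fun y => F j (t, y))) x ^+ 2).
Proof.
by congr IB; apply/funext => x; apply: eq_bigr => j _; rewrite slap2E.
Qed.

Lemma slab_energy1E t : slab_energy1 t =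
  IB (fun x => \sum_j 2 * (lap (lap (fun y => F j (t, y))) x *
                           lap (lap (fun y => Dt (F j) (t, y))) x)).
Proof.
by congr IB; apply/funext => x; apply: eq_bigr => j _; rewrite !slap2E.
Qed.

Lemma slab_energy2E t : slab_energy2 t =
  IB (fun x => \sum_j 2 * (lap (lap (fun y => Dt (F j) (t, y))) x ^+ 2 +
    lap (lap (fun y => F j (t, y))) x * lap (lap (fun y => Dt (Dt (F j)) (t, y))) x)).
Proof.
by congr IB; apply/funext => x; apply: eq_bigr => j _; 
  congr (2 * (_ ^+ 2 + _ * _)); exact: slap2E.
Qed.

End slab_energy.

End energy.

(** * Variations of the equator map *)

Section variation.
Context {R : realType} {n : nat}.
Hypothesis n9 : (9 <= n)%N.
Local Notation rV := 'rV[R]_n.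
Local Notation mu := (@lebesgue_measure_rV R n).
Local Notation B := (@eball R n).
Local Notation intB f := (mu.-integrable B (fun x => (f x)%:E)).
Local Notation V := (R * rV)%type.
Let n0 : (0 < n)%N. Proof. exact: leq_trans n9. Qed.

Variable phi : rV -> 'rV[R]_(n + 1).
Hypothesis tphi : test_map phi.
Let f j : rV -> R := coordf phi j.
Let sf j : smooth (f j). Proof. by have [] := tphi j. Qed.
Let cf j : csupp (f j). Proof. exact: test_fun_csupp. Qed.

(** With u the equator map, [al] is u.phi, [be] is |phi|^2, [q] is |u + t phi|^2, and [F j] is a
    component of the variation as a function of (t, x). *)
Let al x := \sum_j eqc j x * f j x.
Let be x := \sum_j f j x ^+ 2.
Let q (z : V) := \sum_j (eqc j z.2 + z.1 * f j z.2) ^+ 2.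
Let F j (z : V) := (eqc j z.2 + z.1 * f j z.2) * (Num.sqrt (q z))^-1.
Let energy t := E4ext (sphere_variation (@equator_map R n) phi t).

Let variationE t j : coordf (sphere_variation (@equator_map R n) phi t) j = fun x => F j (t, x).
Proof.
apply/funext => x; rewrite /coordf /sphere_variation /sphere_proj mxE mulrC.
have E i : (@equator_map R n x + t *: phi x) ord0 i = eqc i x + t * f i x.
  by rewrite mxE [X in _ + X]mxE.
by rewrite /F E /enorm; congr (_ * (Num.sqrt _)^-1); apply: eq_bigr => i _; rewrite E.
Qed.

Let qE t x : x != 0 -> q (t, x) = 1 + 2 * t * al x + t ^+ 2 * be x.
Proof.
move=> x0; transitivity (\sum_j eqc j x ^+ 2 + 2 * t * al x + t ^+ 2 * be x); last first.
  by rewrite sum_eqc_sqr.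
rewrite /q /al /be !mulr_sumr -!big_split/=.
by apply: eq_bigr => j _; ring.
Qed.

Let FE t j x : x != 0 -> F j (t, x) = npath (eqc j x) (f j x) (al x) (be x) t.
Proof. by move=> x0; rewrite /F qE. Qed.

Let csupp_bounded (h : rV -> R) : smooth h -> csupp h -> exists2 C : R, 0 <= C & forall x, `|h x| <= C.
Proof.
move=> sh ch; have [C C0 HC] := continuous_ball_bounded (smooth_continuous sh).
exists C => // x; have [Bx|/(csuppW ch) ->] := ltP (enorm x) 1; first exact: HC.
by rewrite normr0.
Qed.

Let eqc_le1 (j : 'I_(n + 1)) (x : rV) : `|eqc j x| <= 1 :> R.
Proof.
case: (split_ordP j) => i ->; first by rewrite eqc_lshift dirx_le1.
by rewrite eqc_rshift normr0.
Qed.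

(** Keeps u + t phi away from 0 uniformly in x. If [A] bounds |u.phi|, the choice of [d] gives |t
    u.phi| <= 1/4, and q >= 1 + 2t u.phi. *)
Let variation_slab : exists2 d : R, 0 < d &
  forall t x, `|t| < d -> x != 0 -> 1 / 4 <= q (t, x).
Proof.
have H j : exists C : R, 0 <= C /\ forall x, `|f j x| <= C.
  by have [C ? ?] := csupp_bounded (sf j) (cf j); exists C.
have [C HC] := choice H.
pose A := \sum_j C j; have A0 : 0 <= A by apply: sumr_ge0 => j _; have [] := HC j.
have alA x : `|al x| <= A.
  apply: le_trans (ler_norm_sum _ _ _) _; apply: ler_sum => j _.
  by rewrite normrM -[leRHS]mul1r ler_pM ?eqc_le1//; have [_] := HC j; apply.
have be0 x : 0 <= be x by apply: sumr_ge0 => j _; exact: sqr_ge0.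
exists (4 * (A + 1))^-1; first by rewrite invr_gt0 mulr_gt0// ltr_wpDl.
move=> t x td x0; rewrite qE//.
have : `|t * al x| <= 1 / 4.
  rewrite normrM; apply: (@le_trans _ _ ((4 * (A + 1))^-1 * (A + 1))).
    by apply: ler_pM => //; [exact: ltW|apply: le_trans (alA x) _; rewrite lerDl].
  by rewrite invfM mulfVK ?gt_eqF ?ltr_wpDl// div1r.
rewrite ler_norml => /andP[h _].
have := mulr_ge0 (sqr_ge0 t) (be0 x); rewrite -mulrA; lra.
Qed.

Section in_slab.
Variable d : R.
Hypothesis d0 : 0 < d.
Hypothesis q_ge : forall t x, `|t| < d -> x != 0 -> 1 / 4 <= q (t, x).

Let q_gt0 z : lev_dom (tlevel d) z -> 0 < q z.
Proof.
case: z => t x /slab_dom[/= td x0]; apply: lt_le_trans (q_ge td x0).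
by rewrite divr_gt0.
Qed.

Let St_num N j : St d N 0 (fun z : V => eqc j z.2 + z.1 * f j z.2).
Proof.
apply: ck_add; first exact: St_lift (Sx_eqc N j).
apply: (@ck_mul _ _ _ _ _ _ N 0 0); first exact: St_time.
exact: St_lift (smooth_Sx N (sf j)).
Qed.

Let St_q N : St d N 0 q.
Proof. by apply: ck_sum => j; exact: (ck_exp 2 (St_num N j)). Qed.

Let St_F N j : St d N 0 (F j).
Proof.
apply: (@ck_mul _ _ _ _ _ _ N 0 0 _ _ (St_num N j)); apply: ck_rsqrt (St_q N) => //.
split => [z Oz|].
  have c1 : {for z, continuous q} by have /ck_lev[c _] := St_q 0; exact: c.
  have c2 : {for q z, continuous (@Num.sqrt R)} by exact: sqrt_continuous.
  have c3 : (Num.sqrt (q y) @[y --> z] --> Num.sqrt (q z)) := continuous_comp c1 c2.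
  by apply: cvgV c3; rewrite gt_eqF// sqrtr_gt0 q_gt0.
(* 2 is the inverse square root of the lower bound 1/4 for [q]. *)
exists 2 => -[t x] /slab_dom[/= td x0] _; rewrite expr0 mulr1.
rewrite ger0_norm ?invr_ge0 ?sqrtr_ge0//.
have h : 1 / 2 <= Num.sqrt (q (t, x)).
  rewrite -[leLHS]ger0_norm; last by rewrite divr_ge0.
  rewrite -sqrtr_sqr ler_sqrt; last by apply: le_trans (q_ge td x0); rewrite divr_ge0.
  by apply: le_trans (q_ge td x0); lra.
rewrite -[leRHS]invrK lef_pV2 ?posrE ?invr_gt0//; first by rewrite -div1r.
by apply: lt_le_trans h; rewrite divr_gt0.
Qed.

Let F0 j x : x != 0 -> F j (0, x) = eqc j x.
Proof. by move=> x0; rewrite FE// npath0. Qed.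

Let Dt_FE t j x : `|t| < d -> x != 0 ->
  Dt (F j) (t, x) = dnpath (eqc j x) (f j x) (al x) (be x) t.
Proof.
move=> td x0; rewrite DtE.
have -> : (fun s => F j (s, x)) = npath (eqc j x) (f j x) (al x) (be x).
  by apply/funext => s; rewrite FE.
have q0 := @q_gt0 (t, x) ((slab_dom d (t, x)).2 (conj td x0)); rewrite qE// in q0.
by have [_] := is_derive_npath (eqc j x) (f j x) q0.
Qed.

Let Dt_F0 j x : x != 0 -> Dt (F j) (0, x) = f j x - al x * eqc j x.
Proof. by move=> x0; rewrite Dt_FE ?normr0// dnpath0. Qed.

Let Dtt_F0 j x : x != 0 ->
  Dt (Dt (F j)) (0, x) = - 2 * al x * f j x + (3 * al x ^+ 2 - be x) * eqc j x.
Proof.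
move=> x0; rewrite DtE.
have [_ <-] := is_derive_dnpath0 (eqc j x) (f j x) (al x) (be x).
apply: near_eq_derive.
by apply: filterS (nbhs0_lt d0) => s sd; rewrite Dt_FE.
Qed.

Let variation_Sx t j : `|t| < d ->
  Sx 4 0 (coordf (sphere_variation (@equator_map R n) phi t) j).
Proof. by move=> td; rewrite variationE; exact: St_slice td (St_F 4 j). Qed.

Lemma variation_sobolev t : `|t| < d ->
  sobolev_sphere 4 (sphere_variation (@equator_map R n) phi t).
Proof.
move=> td; split; first by move=> j; exact: (@Sx_sobolev R n n9 4 _ (leqnn 4) (variation_Sx j td)).
have := aeB_nonzero (R := R) n0; rewrite /aeB; apply: filterS => x x0 Bx.
apply/esphereP; under eq_bigr => j _ do rewrite -[_ ord0 j]/(coordf _ j x) variationE /F exprMn.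
have q0 := @q_gt0 (t, x) ((slab_dom d (t, x)).2 (conj td (x0 Bx))).
by rewrite -mulr_suml -/(q (t, x)) exprVn sqr_sqrtr ?ltW// divff// gt_eqF.
Qed.

Let energyE t : `|t| < d -> energy t = slab_energy F t.
Proof.
move=> td; rewrite /energy (E4ext_Sx n9); last by move=> j; exact: variation_Sx.
rewrite slab_energyE; congr IB; apply/funext => x; apply: eq_bigr => j _.
by rewrite variationE.
Qed.

Let psi j x := f j x - al x * eqc j x.

Let d00 : `|0 : R| < d. Proof. by rewrite normr0. Qed.
Let St_tF N j : St d N 0 (Dt (F j)). Proof. exact: St_Dt (St_F N.+1 j). Qed.
Let St_ttF N j : St d N 0 (Dt (Dt (F j))). Proof. exact: St_Dt (St_tF N.+1 j). Qed.

Let lap2_F0 j x : x != 0 -> lap (lap (fun y => F j (0, y))) x = lap (lap (eqc j)) x.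
Proof.
move=> x0; apply: lap_ext x0 => y y0; apply: lap_ext y0 => z z0; exact: F0.
Qed.

(** One radius for all components, taken nonnegative so that points beyond it are not the origin,
    where the formulas for the time derivatives of [F j] would fail. *)
Let phi_csupp : exists c : R, [/\ 0 <= c, c < 1 & forall j x, c < enorm x -> f j x = 0].
Proof.
have H j : exists c : R, c < 1 /\ forall x, c < enorm x -> f j x = 0.
  by have [c c1 Hc] := cf j; exists c.
have [c Hc] := choice H; exists (\big[Num.max/0]_j c j); split.
- exact: bigmax_ge_id.
- by apply/bigmax_ltP; split => // j _; have [] := Hc j.
- move=> j x cx; have [_] := Hc j; apply; apply: le_lt_trans cx.
  exact: le_bigmax.
Qed.

Let csupp_slice (h : rV -> R) : (forall x, x != 0 -> (forall j, f j x = 0) -> h x = 0) -> csupp h.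
Proof.
move=> H; have [c [c0 c1 Hc]] := phi_csupp; exists c => // x cx; apply: H.
  by rewrite -enorm_gt0; exact: le_lt_trans cx.
by move=> j; exact: Hc.
Qed.

Let al0 x : (forall j, f j x = 0) -> al x = 0.
Proof. by move=> H; rewrite /al big1// => j _; rewrite H mulr0. Qed.
Let be0 x : (forall j, f j x = 0) -> be x = 0.
Proof. by move=> H; rewrite /be big1// => j _; rewrite H expr0n. Qed.

Let sum_eqc_psi x : x != 0 -> \sum_j eqc j x * Dt (F j) (0, x) = 0.
Proof.
move=> x0; have H (a : R) : \sum_j eqc j x * (f j x - a * eqc j x) =
    (\sum_j eqc j x * f j x) - a * \sum_j eqc j x ^+ 2.
  by rewrite !mulr_sumr -sumrB/=; apply: eq_bigr => j _; ring.
under eq_bigr => j _ do rewrite Dt_F0//.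
by rewrite H sum_eqc_sqr// -/(al x) mulr1 subrr.
Qed.

(** In agreement with |F|^2 = 1 differentiated twice: u.F_tt = -|F_t|^2, and F_t = phi - (u.phi)u
    has squared norm [be - al^2]. *)
Let sum_eqc_Dtt x : x != 0 -> \sum_j eqc j x * Dt (Dt (F j)) (0, x) = al x ^+ 2 - be x.
Proof.
move=> x0; have H (a b : R) : \sum_j eqc j x * (- 2 * a * f j x + (3 * a ^+ 2 - b) * eqc j x) =
    - 2 * a * (\sum_j eqc j x * f j x) + (3 * a ^+ 2 - b) * \sum_j eqc j x ^+ 2.
  by rewrite !mulr_sumr -big_split/=; apply: eq_bigr => j _; ring.
under eq_bigr => j _ do rewrite Dtt_F0//.
by rewrite H sum_eqc_sqr// -/(al x); ring.
Qed.

Let S4 j : Sx 0 4 (lap (lap (@eqc R n j))).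
Proof. exact: Sx_lap (Sx_lap (Sx_eqc 4 j)). Qed.
Let S4t j : Sx 0 4 (lap (lap (fun x => Dt (F j) (0, x)))).
Proof. exact: Sx_lap (Sx_lap (St_slice d00 (St_tF 4 j))). Qed.
Let S4tt j : Sx 0 4 (lap (lap (fun x => Dt (Dt (F j)) (0, x)))).
Proof. exact: Sx_lap (Sx_lap (St_slice d00 (St_ttF 4 j))). Qed.
Let S4F j : Sx 0 4 (lap (lap (fun x => F j (0, x)))).
Proof. exact: Sx_lap (Sx_lap (St_slice d00 (St_F 4 j))). Qed.

Let c1 j : csupp (fun x => Dt (F j) (0, x)).
Proof.
by apply: csupp_slice => x x0 H; rewrite Dt_F0// H al0// mul0r subr0.
Qed.

Let c2 j : csupp (fun x => Dt (Dt (F j)) (0, x)).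
Proof.
by apply: csupp_slice => x x0 H; rewrite Dtt_F0// H al0// be0// mulr0 expr0n/= mulr0 subr0 mul0r addr0.
Qed.

Let S8 (h : 'I_(n + 1) -> rV -> R) : (forall j, Sx 0 4 (h j)) ->
  Sx 0 8 (fun x => \sum_j lap (lap (eqc j)) x * h j x).
Proof. by move=> Sh; apply: Sx_sum => j; exact: Sx_mul (S4 j) (Sh j). Qed.

Let Srho (h : 'I_(n + 1) -> rV -> R) : (forall j, Sx 0 0 (h j)) ->
  Sx 0 (8 + 0) (fun x => rho x ^+ 8 * \sum_j eqc j x * h j x).
Proof.
move=> Sh; apply: Sx_mul; first exact: Sx_rhoX.
by apply: Sx_sum => j; exact: (@Sx_mul R n 0 0 0 _ _ (Sx_eqc 0 j) (Sh j)).
Qed.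

Let green1 : IB (fun x => \sum_j lap (lap (eqc j)) x * lap (lap (fun y => Dt (F j) (0, y))) x) = 0.
Proof.
rewrite (green_eqc_sum n9 (fun j => St_slice d00 (St_tF 4 j)) c1).
have C0 : Sx 0 0 (fun _ : rV => (0 : R)) by exact: ck_cst.
rewrite (IB_Sx_ext n9 (Srho (fun j => St_slice d00 (St_tF 0 j))) C0) ?IB_0 ?mulr0//.
by move=> x x0 _; rewrite sum_eqc_psi// mulr0.
Qed.

Let al_Sx : Sx 0 0 al.
Proof.
apply: Sx_sum => j; exact: (@Sx_mul R n 0 0 0 _ _ (Sx_eqc 0 j) (smooth_Sx 0 (sf j))).
Qed.

Let be_Sx : Sx 0 0 be.
Proof. by apply: Sx_sum => j; exact: (Sx_exp 2 (smooth_Sx 0 (sf j))). Qed.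

Let green2 : IB (fun x => \sum_j lap (lap (eqc j)) x * lap (lap (fun y => Dt (Dt (F j)) (0, y))) x) =
  lap4_const (n := n) * IB (fun x => rho x ^+ 8 * (al x ^+ 2 - be x)).
Proof.
rewrite (green_eqc_sum n9 (fun j => St_slice d00 (St_ttF 4 j)) c2); congr (_ * _).
have S : Sx 0 (8 + 0) (fun x => rho x ^+ 8 * (al x ^+ 2 - be x)).
  apply: Sx_mul; first exact: Sx_rhoX.
  by apply: Sx_sub => //; exact: (Sx_exp 2 al_Sx).
apply: (IB_Sx_ext n9 (Srho (fun j => St_slice d00 (St_ttF 0 j))) S).
by move=> x x0 _; rewrite sum_eqc_Dtt.
Qed.

Let psi_Sx j : Sx 4 0 (psi j).
Proof. by apply: Sx_ext (St_slice d00 (St_tF 4 j)) => x x0; exact: Dt_F0. Qed.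

Let lap2_psi j x : x != 0 -> lap (lap (fun y => Dt (F j) (0, y))) x = lap (lap (psi j)) x.
Proof.
move=> x0; apply: lap_ext x0 => y y0; apply: lap_ext y0 => z z0; exact: Dt_F0.
Qed.

Let energy1_0 : slab_energy1 F 0 = 0.
Proof.
have SA := S8 S4t.
have SB : Sx 0 8 (fun x => \sum_j 2 * (lap (lap (fun y => F j (0, y))) x *
    lap (lap (fun y => Dt (F j) (0, y))) x)).
  by apply: Sx_sum => j; apply: Sx_scale; exact: (Sx_mul (S4F j) (S4t j)).
have E : forall x, x != 0 -> B x -> \sum_j 2 * (lap (lap (fun y => F j (0, y))) x *
      lap (lap (fun y => Dt (F j) (0, y))) x) =
    2 * \sum_j lap (lap (eqc j)) x * lap (lap (fun y => Dt (F j) (0, y))) x.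
  by move=> x x0 _; rewrite mulr_sumr; apply: eq_bigr => j _; rewrite lap2_F0.
rewrite slab_energy1E (IB_Sx_ext n9 SB (Sx_scale 2 SA) E) IB_scale ?green1 ?mulr0//.
exact: (@Sx_integrable R n n9 0 8 _ _ SA).
Qed.

Let energy2_0 : slab_energy2 F 0 = 2 * (IB (fun x => \sum_j lap (lap (psi j)) x ^+ 2) +
  lap4_const (n := n) * IB (fun x => rho x ^+ 8 * (al x ^+ 2 - be x))).
Proof.
have SA := S8 S4tt.
have SC : Sx 0 8 (fun x => \sum_j lap (lap (psi j)) x ^+ 2).
  by apply: Sx_sum => j; exact: (Sx_exp 2 (Sx_lap (Sx_lap (psi_Sx j)))).
rewrite slab_energy2E -green2 -IB_add; last 2 first.
- exact: (@Sx_integrable R n n9 0 8 _ _ SC).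
- exact: (@Sx_integrable R n n9 0 8 _ _ SA).
rewrite -IB_scale; last exact: (@Sx_integrable R n n9 0 8 _ _ (Sx_add SC SA)).
have SB : Sx 0 8 (fun x => \sum_j 2 * (lap (lap (fun y => Dt (F j) (0, y))) x ^+ 2 +
    lap (lap (fun y => F j (0, y))) x * lap (lap (fun y => Dt (Dt (F j)) (0, y))) x)).
  apply: Sx_sum => j; apply: Sx_scale; apply: Sx_add; first exact: (Sx_exp 2 (S4t j)).
  exact: (Sx_mul (S4F j) (S4tt j)).
have E : forall x, x != 0 -> B x -> \sum_j 2 * (lap (lap (fun y => Dt (F j) (0, y))) x ^+ 2 +
      lap (lap (fun y => F j (0, y))) x * lap (lap (fun y => Dt (Dt (F j)) (0, y))) x) =
    2 * (\sum_j lap (lap (psi j)) x ^+ 2 +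
      \sum_j lap (lap (eqc j)) x * lap (lap (fun y => Dt (Dt (F j)) (0, y))) x).
  move=> x x0 _; rewrite -big_split/= mulr_sumr; apply: eq_bigr => j _.
  by rewrite lap2_F0// lap2_psi.
exact: (IB_Sx_ext n9 SB (Sx_scale 2 (Sx_add SC SA)) E).
Qed.

Lemma in_slab_variation : exists E1 : R -> R,
  [/\ forall t, `|t| < d -> is_derive t (1 : R) energy (E1 t), E1 0 = 0 &
   is_derive (0 : R) (1 : R) E1 (2 * (IB (fun x => \sum_j lap (lap (psi j)) x ^+ 2) +
     lap4_const (n := n) * IB (fun x => rho x ^+ 8 * (al x ^+ 2 - be x))))].
Proof.
exists (slab_energy1 F); split; [|exact: energy1_0|].
  move=> t td; apply: near_eq_is_derive (is_derive_slab_energy n9 St_F td).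
  have It : `]-d, d[%classic t by rewrite /= in_itv/= -ltr_norml.
  apply: filterS (near_in_itvoo It) => s; rewrite /= in_itv/= -ltr_norml => sd.
  by rewrite energyE.
have h := is_derive_slab_energy1 n9 St_F d00.
exact: (is_derive_eq h energy2_0).
Qed.

End in_slab.

(** A single function [E1] is the derivative on a whole neighbourhood of 0: its value at 0 gives
    harmonicity and its derivative at 0 the second variation. *)
Lemma equator_variation : exists d : R, exists E1 : R -> R,
  [/\ 0 < d,
      forall t, `|t| < d -> sobolev_sphere 4 (sphere_variation (@equator_map R n) phi t),
      forall t, `|t| < d ->
        is_derive t (1 : R) (fun t => E4ext (sphere_variation (@equator_map R n) phi t)) (E1 t),
      E1 0 = 0 &
      is_derive (0 : R) (1 : R) E1
        (2 * (IB (fun x => \sum_j lap (lap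
                (fun x => coordf phi j x - (\sum_i eqc i x * coordf phi i x) * eqc j x)) x ^+ 2) +
          lap4_const (n := n) * IB (fun x => rho x ^+ 8 *
            ((\sum_j eqc j x * coordf phi j x) ^+ 2 - \sum_j coordf phi j x ^+ 2))))].
Proof.
have [d d0 q_ge] := variation_slab; have [E1 [H1 H2 H3]] := in_slab_variation d0 q_ge.
by exists d, E1; split => // t td; exact: variation_sobolev q_ge _ td.
Qed.

End variation.

Theorem equator_four_harmonic (R : realType) (n : nat) : (9 <= n)%N ->
  four_harmonic (@equator_map R n).
Proof.
move=> n9; split; first exact: equator_sobolev_sphere.
move=> phi tphi; have [d [E1 [d0 H1 H2 E10 _]]] := equator_variation n9 tphi; split.
  by apply: filterS (nbhs0_lt d0) => t; exact: H1.
have d00 : `|0 : R| < d by rewrite normr0.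
exact: (is_derive_eq (H2 0 d00) E10).
Qed.

(** * Instability *)

Section smooth_closure.
Context {R : realType} {n : nat}.
Local Notation rV := 'rV[R]_n.
Local Notation e_ i := (delta_mx ord0 i : rV).
Implicit Types (f g : rV -> R) (x : rV).

Lemma smooth_cst (c : R) : smooth (fun _ : rV => c).
Proof. by apply: smooth_ck_smooth => N; exact: ck_cst. Qed.

Lemma smooth_coord i : smooth (fun x : rV => x ord0 i).
Proof. by apply: smooth_ck_smooth => N; exact: smooth_ck_coord. Qed.

Lemma smooth_sqnorm : smooth (fun x : rV => enorm x ^+ 2).
Proof. by apply: smooth_ck_smooth => N; exact: smooth_ck_sqnorm. Qed.

Lemma smooth_scale (c : R) f : smooth f -> smooth (fun x => c * f x).
Proof. by move=> sf; apply: smooth_mul sf; exact: smooth_cst. Qed.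

Lemma smooth_sub f g : smooth f -> smooth g -> smooth (fun x => f x - g x).
Proof.
by move=> sf sg; apply: smooth_ck_smooth => N; apply: ck_sub; exact: smooth_smooth_ck.
Qed.

Lemma smooth_exp m f : smooth f -> smooth (fun x => f x ^+ m).
Proof.
move=> sf; apply: smooth_ck_smooth => N.
by have := ck_exp m (smooth_smooth_ck N sf); rewrite muln0.
Qed.

Lemma smooth_flat f : smooth f -> smooth (fun x => flat 0 (f x)).
Proof.
move=> sf; apply: smooth_ck_smooth => N; apply: (smooth1_comp (h := flat 0)).
  exact: flat_smooth1.
by move=> M; exact: smooth_smooth_ck.
Qed.

Lemma smooth_inv f : smooth f -> (forall x, f x != 0) -> smooth (fun x => (f x)^-1).
Proof.
move=> sf f0; apply: smooth_ck_smooth => N.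
apply: (@ck_inv _ _ _ _ _ (smooth_level rV) N f) => //; last exact: smooth_smooth_ck.
move=> x; have cf : f y @[y --> x] --> f x by exact: (smooth_continuous sf).
exact: cvgV (f0 x) cf.
Qed.

Lemma smooth_rsqrt f : smooth f -> (forall x, 0 < f x) ->
  smooth (fun x => (Num.sqrt (f x))^-1).
Proof.
move=> sf f0; apply: smooth_ck_smooth => N.
apply: (@ck_rsqrt _ _ _ _ _ (smooth_level rV) N f) => //; last exact: smooth_smooth_ck.
move=> x; have c1 : {for x, continuous f} by exact: (smooth_continuous sf).
have c2 : {for f x, continuous (@Num.sqrt R)} by exact: sqrt_continuous.
have c3 : (Num.sqrt (f y) @[y --> x] --> Num.sqrt (f x)) := continuous_comp c1 c2.
by apply: cvgV c3; rewrite gt_eqF// sqrtr_gt0 f0.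
Qed.

Lemma is_derive_dilate (a : R) f i x : smooth f ->
  is_derive x (e_ i) (fun y => f (a *: y)) (a * 'D_(e_ i) f (a *: x)).
Proof.
move=> sf; apply/is_derive_line.
have h1 : is_derive (a * 0 : R) (1 : R) (fun s : R => f (s *: e_ i + a *: x)) ('D_(e_ i) f (a *: x)).
  by rewrite mulr0; exact: ((is_derive_line f (a *: x) (e_ i) _).1 (smooth_derive i (a *: x) sf)).
have h2 : is_derive (0 : R) (1 : R) (fun s : R => a * s) (0 * 0 + a * 1).
  exact: is_derive_fmul (is_derive_cst a (0 : R) (1 : R)) (is_derive_id (0 : R) (1 : R)).
have h := is_derive_fcomp (f := fun s : R => a * s) h1 h2.
have -> : (fun s : R => f (a *: (s *: e_ i + x))) = fun s : R => f ((a * s) *: e_ i + a *: x).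
  by apply/funext => s; rewrite scalerDr scalerA.
by apply: (is_derive_eq h); rewrite mul0r add0r mulr1 mulrC.
Qed.

Lemma D_dilate (a : R) f i : smooth f ->
  'D_(e_ i) (fun y => f (a *: y)) = fun x => a * 'D_(e_ i) f (a *: x).
Proof. by move=> sf; apply/funext => x; have [_] := is_derive_dilate a i x sf. Qed.

Lemma smooth_dilate (a : R) f : smooth f -> smooth (fun x => f (a *: x)).
Proof.
move=> sf; apply: smooth_ck_smooth => N.
have C g : smooth g -> continuous (fun x : rV => g (a *: x)).
  move=> /smooth_continuous cg x.
  have h1 : {for x, continuous (fun y : rV => a *: y)} by exact: scaler_continuous.
  exact: continuous_comp h1 (cg _).
elim: N f sf => [|N IH] f sf; first by split => //; exact: C.
apply: (@ck_make _ _ _ _ _ _ _ _ _ (fun i x => a * 'D_(e_ i) f (a *: x))).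
- exact: C.
- by move=> i; apply: ck_scale; exact: (IH _ (smooth_D i sf)).
- by move=> i x _; exact: is_derive_dilate.
Qed.

Lemma smooth_D_scale (c : R) f i : smooth f ->
  'D_(e_ i) (fun y => c * f y) = fun x => c * 'D_(e_ i) f x.
Proof.
move=> sf; apply/funext => x.
have h := is_derive_fmul (is_derive_cst c x (e_ i)) (smooth_derive i x sf).
by have [_ ->] := h; rewrite mul0r add0r.
Qed.

Lemma lap_dilate (a : R) f : smooth f ->
  lap (fun y => f (a *: y)) = fun x => a ^+ 2 * lap f (a *: x).
Proof.
move=> sf; apply/funext => x; rewrite !lapE mulr_sumr; apply: eq_bigr => i _.
have s1 := smooth_D i sf.
have E2 : 'D_(e_ i) (fun y => a * 'D_(e_ i) f (a *: y)) =
    fun y => a * 'D_(e_ i) (fun z => 'D_(e_ i) f (a *: z)) y.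
  exact: (@smooth_D_scale a (fun z => 'D_(e_ i) f (a *: z)) i (smooth_dilate a s1)).
rewrite expr2 -mulrA; exact: etrans (congr1 (fun g : rV -> R => 'D_(e_ i) g x) (D_dilate a i sf))
  (etrans (congr1 (@^~ x) E2) (congr1 (fun g : rV -> R => a * g x) (D_dilate a i s1))).
Qed.

Lemma smooth_lap_scale (c : R) f : smooth f ->
  lap (fun y => c * f y) = fun x => c * lap f x.
Proof.
move=> sf; apply/funext => x; rewrite !lapE mulr_sumr; apply: eq_bigr => i _.
exact: etrans (congr1 (fun g : rV -> R => 'D_(e_ i) g x) (smooth_D_scale c i sf))
  (congr1 (@^~ x) (smooth_D_scale c i (smooth_D i sf))).
Qed.

Lemma smooth_D_sub f g i : smooth f -> smooth g ->
  'D_(e_ i) (fun y => f y - g y) = fun x => 'D_(e_ i) f x - 'D_(e_ i) g x.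
Proof.
move=> sf sg; apply/funext => x.
by have [_ ->] := is_derive_fadd (smooth_derive i x sf) (is_derive_fopp (smooth_derive i x sg)).
Qed.

Lemma smooth_lap_sub f g : smooth f -> smooth g ->
  lap (fun y => f y - g y) = fun x => lap f x - lap g x.
Proof.
move=> sf sg; apply/funext => x; rewrite !lapE -sumrB; apply: eq_bigr => i _.
exact: etrans (congr1 (fun h : rV -> R => 'D_(e_ i) h x) (smooth_D_sub i sf sg))
  (congr1 (@^~ x) (smooth_D_sub i (smooth_D i sf) (smooth_D i sg))).
Qed.

Lemma lap2_dilate (a : R) f : smooth f ->
  lap (lap (fun y => f (a *: y))) = fun x => a ^+ 4 * lap (lap f) (a *: x).
Proof.
move=> sf; have E2 : lap (fun y => a ^+ 2 * lap f (a *: y)) =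
    fun y => a ^+ 2 * lap (fun z => lap f (a *: z)) y.
  exact: (@smooth_lap_scale (a ^+ 2) (fun z => lap f (a *: z)) (smooth_dilate a (smooth_lap sf))).
rewrite (lap_dilate a sf) E2 (lap_dilate a (smooth_lap sf)); by apply/funext => x; rewrite mulrA -exprD.
Qed.

Lemma lap_eq_on (Om : set rV) f g x : open Om -> (forall z, Om z -> f z = g z) ->
  Om x -> lap f x = lap g x.
Proof.
move=> oO fg Ox; rewrite !lapE; apply: eq_bigr => i _.
have E : forall z, Om z -> 'D_(e_ i) f z = 'D_(e_ i) g z.
  by move=> z Oz; apply: near_eq_derive; exact: near_open_eq oO fg Oz.
by apply: near_eq_derive; exact: near_open_eq oO E Ox.
Qed.

Lemma lap2_eq_on (Om : set rV) f g x : open Om -> (forall z, Om z -> f z = g z) ->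
  Om x -> lap (lap f) x = lap (lap g) x.
Proof. by move=> oO fg; apply: lap_eq_on => // z; exact: lap_eq_on. Qed.

Lemma open_enorm_lt (c : R) : open [set x : rV | enorm x < c].
Proof.
rewrite (_ : mkset _ = @enorm R n @^-1` `]-oo, c[%classic).
  by move: (@enorm_continuous R n) => /continuousP; apply; exact: interval_open.
by apply/seteqP; split => x /=; rewrite in_itv.
Qed.

Lemma open_enorm_gt (c : R) : open [set x : rV | c < enorm x].
Proof.
rewrite (_ : mkset _ = @enorm R n @^-1` `]c, +oo[%classic).
  by move: (@enorm_continuous R n) => /continuousP; apply; exact: interval_open.
by apply/seteqP; split => x /=; rewrite in_itv/= andbT.
Qed.

(** Turns the exponent (n-8)/2 of [rho], a half-integer for odd [n], into the natural exponent
    n-8. *)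
Definition wr x : R := Num.sqrt (rho x).

Lemma wr_ge0 x : 0 <= wr x. Proof. exact: sqrtr_ge0. Qed.
Lemma wr_sqr x : wr x ^+ 2 = rho x. Proof. by rewrite sqr_sqrtr// rho_ge0. Qed.

Lemma is_derive_wrX k i x : x != 0 ->
  is_derive x (e_ i) (fun z => wr z ^+ k) (- (k%:R / 2 * (dirx i x * (rho x * wr x ^+ k)))).
Proof.
move=> x0; have r0 := rho_gt0 x0.
have w0 : wr x != 0 by rewrite gt_eqF// sqrtr_gt0.
have d1 : is_derive x (e_ i) wr (- (2^-1 * (dirx i x * (rho x * wr x)))).
  have h := is_derive_fcomp (is_derive1_sqrt r0) (is_derive_rho i x0).
  by apply: (is_derive_eq h); rewrite -/(wr x) -(wr_sqr x); field.
elim: k => [|k IH].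
  rewrite !mul0r oppr0 (_ : (fun _ => _) = cst 1); first exact: is_derive_cst.
  by apply/funext => z; rewrite expr0.
rewrite (_ : (fun _ => _) = fun z => wr z * wr z ^+ k); last first.
  by apply/funext => z; rewrite exprS.
have h := is_derive_fmul d1 IH; apply: (is_derive_eq h).
by rewrite !exprS -addn1 natrD; field.
Qed.

(** The radial formula: the Laplacian of rho^b is b(b+2-n) rho^(b+2), here with b = k/2. *)
Lemma lap_scale_wrX (c : R) k f x : x != 0 ->
  (forall z, z != 0 -> f z = c * wr z ^+ k) ->
  lap f x = - (c * (k%:R / 2) * (n%:R - 2 - k%:R / 2)) * wr x ^+ (k + 4).
Proof.
move=> x0 /lap_ext -> //; rewrite lapE.
have D1 i z : z != 0 -> is_derive z (e_ i) (fun z => c * wr z ^+ k)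
    (- (c * (k%:R / 2)) * (dirx i z * (rho z * wr z ^+ k))).
  move=> z0; have h := is_derive_fmul (is_derive_cst c z (e_ i)) (is_derive_wrX k i z0).
  by apply: (is_derive_eq h); rewrite /=; ring.
have D2 i : 'D_(e_ i) ('D_(e_ i) (fun z => c * wr z ^+ k)) x =
    - (c * (k%:R / 2)) * (rho x ^+ 2 * wr x ^+ k) *
      (1 - (2 + k%:R / 2) * dirx i x ^+ 2).
  rewrite (@D_ext _ _ _ (fun z => - (c * (k%:R / 2)) * (dirx i z * (rho z * wr z ^+ k))))//; last first.
    by move=> z z0; exact: D_val (D1 i z z0).
  apply: D_val.
  have h1 := is_derive_fmul (is_derive_dirx i i x0)
    (is_derive_fmul (is_derive_rho i x0) (is_derive_wrX k i x0)).
  have h := is_derive_fmul (is_derive_cst (- (c * (k%:R / 2))) x (e_ i)) h1.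
  by apply: (is_derive_eq h); rewrite /= eqxx [true%:R]mulr1n; ring.
under eq_bigr => i _ do rewrite D2.
rewrite -mulr_sumr sumrB -mulr_sumr sum_dirx_sqr// sumr_const card_ord.
by rewrite exprD -(wr_sqr x) -!exprM; ring.
Qed.

Lemma lap2_wrX k x : x != 0 -> lap (lap (fun z => wr z ^+ k)) x =
  (k%:R / 2) * (n%:R - 2 - k%:R / 2) * ((k%:R + 4) / 2) * (n%:R - 2 - (k%:R + 4) / 2) *
  wr x ^+ (k + 8).
Proof.
move=> x0; rewrite (@lap_scale_wrX (- (1 * (k%:R / 2) * (n%:R - 2 - k%:R / 2))) (k + 4))//; last first.
  by move=> z z0; rewrite (@lap_scale_wrX 1 k)// => y _; rewrite mul1r.
by rewrite -addnA natrD; congr (_ * _); ring.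
Qed.

End smooth_closure.

(** * Smooth cutoffs of a homogeneous function *)

Section cutoffs.
Context {R : realType} {n : nat}.
Local Notation rV := 'rV[R]_n.
Implicit Types (f g : rV -> R) (x : rV).

Lemma test_fun_sobolev0 f : (9 <= n)%N -> test_fun f -> sobolev0 4 f.
Proof.
move=> n9 tf; have [sf _ _] := tf.
have S : sobolev 4 f := @Sx_sobolev R n n9 4 _ (leqnn 4) (smooth_Sx 4 sf).
split => // e e0; exists f => // s s4.
have [Lw _] := sobolev_weak_partial S s4.
have Lp : L2 (iter_partial s f) := smooth_L2 (smooth_iter_partial s sf).
have wp : is_weak_partial s f (iter_partial s f).
  rewrite -(smooth_iter_partial_rev s sf); apply: (@Sx_is_weak_partial R n n9 s 0).
    by rewrite (leq_trans s4).
  exact: smooth_Sx.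
have ae0 := weak_partial_ae Lp wp.
have mB := @eball_measurable R n.
have [mw _] := Lw; have [mp _] := Lp.
rewrite (ae_eq_integral (cst 0%E)) //.
- by rewrite integral0 lte_fin.
- by apply/measurable_EFinP; apply: measurable_funX; exact: measurable_funB.
- move: ae0; rewrite /aeB; apply: filterS => x h Bx.
  by rewrite h// subrr expr0n.
Qed.

(** A smooth substitute for |x|^2 that is positive everywhere and exact once |x|^2 >= c, so that
    negative powers of it are smooth. *)
Definition reg (c : R) x : R := enorm x ^+ 2 + flat 0 (c - enorm x ^+ 2).

Lemma reg_gt0 c x : 0 < c -> 0 < reg c x.
Proof.
move=> c0; have [h|h] := ltP (enorm x ^+ 2) c.
  by rewrite ltr_wpDl ?sqr_ge0// flat0_gt0// subr_gt0.
by rewrite ltr_wpDr ?flat_ge0//; exact: lt_le_trans h.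
Qed.

Lemma regE c x : c <= enorm x ^+ 2 -> reg c x = enorm x ^+ 2.
Proof. by move=> h; rewrite /reg flat_le0 ?addr0// subr_le0. Qed.

Lemma smooth_reg c : smooth (reg c).
Proof.
apply: smooth_add; first exact: smooth_sqnorm.
by apply: smooth_flat; apply: smooth_sub; [exact: smooth_cst|exact: smooth_sqnorm].
Qed.

Definition reg_rho (c : R) x : R := (Num.sqrt (reg c x))^-1.

Lemma smooth_reg_rho c : 0 < c -> smooth (reg_rho c).
Proof. by move=> c0; apply: smooth_rsqrt; [exact: smooth_reg|move=> x; exact: reg_gt0]. Qed.

Lemma reg_rhoE c x : c <= enorm x ^+ 2 -> reg_rho c x = rho x.
Proof. by move=> h; rewrite /reg_rho regE// sqrtr_sqr ger0_norm// enorm_ge0. Qed.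

(** Away from the origin [reg * reg_rho] is |x|^2 / |x| = |x|, so that closure under inverse square
    roots suffices once more. *)
Definition reg_wr (c : R) x : R := (Num.sqrt (reg c x * reg_rho c x))^-1.

Lemma smooth_reg_wr c : 0 < c -> smooth (reg_wr c).
Proof.
move=> c0; apply: smooth_rsqrt.
  by apply: smooth_mul; [exact: smooth_reg|exact: smooth_reg_rho].
by move=> x; rewrite mulr_gt0 ?reg_gt0// invr_gt0 sqrtr_gt0 reg_gt0.
Qed.

Lemma reg_wrE c x : 0 < c -> c <= enorm x ^+ 2 -> reg_wr c x = wr x.
Proof.
move=> c0 h; have x0 : enorm x != 0.
  by apply: contraTneq (lt_le_trans c0 h) => ->; rewrite expr0n ltxx.
rewrite /reg_wr reg_rhoE// regE// /wr /rho expr2 mulfK//.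
by rewrite sqrtrV// enorm_ge0.
Qed.

Definition step x : R := flat 0 (enorm x ^+ 2 - 1 / 4) /
  (flat 0 (enorm x ^+ 2 - 1 / 4) + flat 0 (1 / 2 - enorm x ^+ 2)).

Let step_den x : 0 < flat 0 (enorm x ^+ 2 - 1 / 4) + flat 0 (1 / 2 - enorm x ^+ 2).
Proof.
have [h|h] := ltP (1 / 4) (enorm x ^+ 2).
  by rewrite ltr_wpDr ?flat_ge0// flat0_gt0// subr_gt0.
by rewrite ltr_wpDl ?flat_ge0// flat0_gt0// subr_gt0; apply: le_lt_trans h _; lra.
Qed.

Lemma smooth_step : smooth step.
Proof.
have s1 : smooth (fun x => flat 0 (enorm x ^+ 2 - 1 / 4)).
  by apply: smooth_flat; apply: smooth_sub; [exact: smooth_sqnorm|exact: smooth_cst].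
apply: smooth_mul => //; apply: smooth_inv; last by move=> x; rewrite gt_eqF// step_den.
apply: smooth_add => //.
by apply: smooth_flat; apply: smooth_sub; [exact: smooth_cst|exact: smooth_sqnorm].
Qed.

Lemma step0 x : enorm x ^+ 2 <= 1 / 4 -> step x = 0.
Proof. by move=> h; rewrite /step flat_le0 ?mul0r// subr_le0. Qed.

Lemma step1 x : 1 / 2 <= enorm x ^+ 2 -> step x = 1.
Proof.
move=> h; rewrite /step (@flat_le0 R 0 (1 / 2 - enorm x ^+ 2)) ?subr_le0// addr0 divff// gt_eqF// flat0_gt0//.
by rewrite subr_gt0; apply: lt_le_trans h; lra.
Qed.

(** The power rho^((n-8)/2) switched on between the radii 1/2 and 3/4. The regularisation changes
    [wr] only for |x|^2 < 1/4, where [step] vanishes. *)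
Definition zeta x : R := reg_wr (1 / 4) x ^+ (n - 8) * step x.

Let q4 : 0 < 1 / 4 :> R. Proof. by lra. Qed.

Lemma smooth_zeta : smooth zeta.
Proof. by apply: smooth_mul smooth_step; apply: smooth_exp; exact: smooth_reg_wr. Qed.

Let sqr_le x (c : R) : 0 <= c -> enorm x <= c -> enorm x ^+ 2 <= c ^+ 2.
Proof. by move=> c0 h; rewrite lerXn2r// nnegrE// enorm_ge0. Qed.

Let sqr_ge x (c : R) : 0 <= c -> c <= enorm x -> c ^+ 2 <= enorm x ^+ 2.
Proof. by move=> c0 h; rewrite lerXn2r// nnegrE// enorm_ge0. Qed.

Lemma zeta0 x : enorm x <= 1 / 2 -> zeta x = 0.
Proof.
move=> h; rewrite /zeta step0 ?mulr0//; apply: le_trans (sqr_le _ h) _; lra.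
Qed.

Lemma zeta1 x : 3 / 4 <= enorm x -> zeta x = wr x ^+ (n - 8).
Proof.
move=> h; have h2 : 1 / 2 <= enorm x ^+ 2.
  by apply: le_trans (sqr_ge _ h); lra.
by rewrite /zeta step1// mulr1 reg_wrE//; apply: le_trans h2; lra.
Qed.

(** Equal to [rellich_const 0 * rellich_const 4]; here it arises as the factor of the bilaplacian on
    [wr ^+ (n - 8)]. *)
Definition rellich : R := n%:R * (n%:R - 4) * (n%:R + 4) * (n%:R - 8) / 16.

Lemma lap2_zeta0 x : enorm x < 1 / 2 -> lap (lap zeta) x = 0.
Proof.
move=> h; rewrite (@lap2_eq_on _ _ _ _ (fun=> 0) _ (@open_enorm_lt _ _ (1 / 2)))//.
  by rewrite (_ : lap (fun=> 0) = fun=> 0) ?lap0//; apply/funext => z; exact: lap0.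
by move=> z /= /ltW; exact: zeta0.
Qed.

Lemma lap2_zeta1 x : (8 <= n)%N -> 3 / 4 < enorm x ->
  lap (lap zeta) x = rellich * wr x ^+ n.
Proof.
move=> n8 h; rewrite (@lap2_eq_on _ _ _ _ (fun z => wr z ^+ (n - 8)) _ (@open_enorm_gt _ _ (3 / 4)))//.
  rewrite lap2_wrX; last by rewrite -enorm_gt0; apply: lt_trans h; lra.
  by rewrite subnK// natrB// /rellich; congr (_ * _); field.
by move=> z /= /ltW; exact: zeta1.
Qed.

(** Continuity gives the bound on the ball, where [wr >= 1] off the origin, and the explicit formula
    outside. The whole space is needed because [zeta] will be evaluated at dilated points. *)
Lemma lap2_zeta_bound : (8 <= n)%N -> exists2 M : R, 0 <= M &
  forall x, x != 0 -> `|lap (lap zeta) x| <= M * wr x ^+ n.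
Proof.
move=> n8; have [C C0 HC] := continuous_ball_bounded
  (smooth_continuous (smooth_lap (smooth_lap smooth_zeta))).
exists (C + `|rellich|) => [|x x0]; first by rewrite addr_ge0.
have w0 : 0 <= wr x ^+ n by rewrite exprn_ge0// wr_ge0.
have [Bx|x1] := ltP (enorm x) 1.
  rewrite mulrDl; apply: (@le_trans _ _ (C * wr x ^+ n)); last by rewrite lerDl mulr_ge0.
  apply: le_trans (HC x Bx) _; rewrite ler_peMr// exprn_ege1//.
  by rewrite -[leLHS]sqrtr1 ler_sqrt ?rho_ge0// rho_ge1.
rewrite lap2_zeta1//; last by apply: lt_le_trans x1; lra.
by rewrite normrM (ger0_norm w0) ler_wpM2r// lerDr.
Qed.

End cutoffs.

(** * Variations in the direction of the poles *)

Section normal_variation.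
Context {R : realType} {n : nat}.
Hypothesis n9 : (9 <= n)%N.
Local Notation rV := 'rV[R]_n.

Variables (h : rV -> R) (c : R).
Hypotheses (th : test_fun h) (c0 : 0 < c).
Hypothesis h0 : forall x, enorm x ^+ 2 <= c -> h x = 0.

Definition normal_field (x : rV) : 'rV[R]_(n + 1) := row_mx 0 (const_mx (h x)).

Let phi_l i : coordf normal_field (lshift 1 i) = fun=> 0.
Proof. by apply/funext => x; rewrite /coordf /normal_field row_mxEl mxE. Qed.

Let phi_r i : coordf normal_field (rshift n i) = h.
Proof. by apply/funext => x; rewrite /coordf /normal_field row_mxEr mxE. Qed.

Lemma normal_field_test_map : test_map normal_field.
Proof.
move=> j; case: (split_ordP j) => i ->; rewrite ?phi_r// phi_l.
by apply: csupp_test_fun; [exact: smooth_cst|exact: csupp0].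
Qed.

Let sh : smooth h. Proof. by have [] := th. Qed.

(** The normalising factor off the origin: the field is orthogonal to the equator map, so the
    squared norm of the sum is 1 + t^2 h^2. *)
Let p (t : R) (x : rV) : R := (Num.sqrt (1 + t ^+ 2 * h x ^+ 2))^-1.

Let smooth_p t : smooth (p t).
Proof.
apply: smooth_rsqrt => [|x]; last by rewrite ltr_wpDr// mulr_ge0// sqr_ge0.
apply: smooth_add; first exact: smooth_cst.
by apply: smooth_scale; exact: smooth_exp.
Qed.

Let p0 t x : h x = 0 -> p t x = 1.
Proof. by move=> hx; rewrite /p hx expr0n mulr0 addr0 sqrtr1 invr1. Qed.

Let variationE t j x : x != 0 ->
  coordf (sphere_variation (@equator_map R n) normal_field t) j x =
  (eqc j x + t * coordf normal_field j x) * p t x.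
Proof.
move=> x0; rewrite /coordf /sphere_variation /sphere_proj mxE mulrC.
have E i : (@equator_map R n x + t *: normal_field x) ord0 i = eqc i x + t * coordf normal_field i x.
  by rewrite mxE [X in _ + X]mxE.
rewrite E /enorm; congr (_ * (Num.sqrt _)^-1); under eq_bigr => i _ do rewrite E.
rewrite big_split_ord/= big_ord1 eqc_rshift phi_r add0r exprMn; congr (_ + _).
rewrite -(sum_dirx_sqr x0); apply: eq_bigr => i _.
by rewrite eqc_lshift phi_l mulr0 addr0.
Qed.

(** [h] vanishes near the origin, so the variation leaves the singular part of the equator map
    untouched: [p t] is 1 there, and [reg_rho] may replace [rho]. The difference is thus a genuine
    test function. *)
Let variation_diff t j : exists2 g, test_fun g &
  coordf (sphere_variation (@equator_map R n) normal_field t \- @equator_map R n) j = g.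
Proof.
have D (x : rV) : coordf (sphere_variation (@equator_map R n) normal_field t \- @equator_map R n) j x =
    coordf (sphere_variation (@equator_map R n) normal_field t) j x - eqc j x.
  by rewrite /coordf /= mxE [X in _ + X]mxE.
(* The equality is one of functions, so the origin counts: the equator map, the field and their
   normalised sum are all 0 there, the inverse of 0 being 0. *)
have h00 : h 0 = 0.
  by apply: h0; rewrite (_ : enorm 0 = 0) ?expr0n ?ltW//; apply/eqP; rewrite enorm_eq0.
have e0 : @equator_map R n 0 = 0.
  by rewrite /equator_map scaler0 row_mx0.
have f0 : normal_field 0 = 0.
  by rewrite /normal_field h00 (_ : const_mx 0 = 0) ?row_mx0//; apply/matrixP => a b; rewrite !mxE.
have D0 : coordf (sphere_variation (@equator_map R n) normal_field t \- @equator_map R n) j 0 = 0.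
  by rewrite D /eqc /coordf /sphere_variation /sphere_proj e0 f0 scaler0 addr0 scaler0 subrr.
have csp (g : rV -> R) : (forall x : rV, h x = 0 -> g x = 0) -> csupp g.
  by move=> H; have [d d1 Hd] := test_fun_csupp th; exists d => // x /Hd; exact: H.
case: (split_ordP j) => i ji.
  exists (fun x : rV => x ord0 i * (reg_rho c x * (p t x - 1))).
    apply: csupp_test_fun.
      apply: smooth_mul; first exact: smooth_coord.
      apply: smooth_mul; first exact: smooth_reg_rho.
      by apply: smooth_sub => //; exact: smooth_cst.
    by apply: csp => x hx; rewrite p0// subrr !mulr0.
  apply/funext => x; have [->|x0] := eqVneq x 0; first by rewrite D0 mxE mul0r.
  rewrite D variationE// ji eqc_lshift phi_l mulr0 addr0.
  have [xc|xc] := leP (enorm x ^+ 2) c.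
    by rewrite p0 ?h0// mulr1 !subrr !mulr0.
  by rewrite reg_rhoE ?ltW// /dirx /rho; ring.
exists (fun x : rV => t * (h x * p t x)).
  apply: csupp_test_fun; first by apply: smooth_scale; exact: smooth_mul.
  by apply: csp => x ->; rewrite mul0r mulr0.
apply/funext => x; have [->|x0] := eqVneq x 0; first by rewrite D0 h00 mul0r mulr0.
by rewrite D variationE// ji eqc_rshift phi_r; ring.
Qed.

Lemma normal_variation_sobolev0 t :
  sobolev0_map 4 (sphere_variation (@equator_map R n) normal_field t \- @equator_map R n).
Proof. by move=> j; have [g tg ->] := variation_diff t j; exact: test_fun_sobolev0. Qed.

Lemma normal_second_derivative : is_second_derivative
  (fun t => E4ext (sphere_variation (@equator_map R n) normal_field t)) 0
  (2 * (IB (fun x => lap (lap h) x ^+ 2) -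
        lap4_const (n := n) * IB (fun x => rho x ^+ 8 * h x ^+ 2))).
Proof.
have [d [E1 [d0 _ H2 _ H3]]] := equator_variation n9 normal_field_test_map.
split; first by apply: filterS (nbhs0_lt d0) => s /H2[].
have al0 (x : rV) : \sum_j eqc j x * coordf normal_field j x = 0.
  rewrite big_split_ord/= big_ord1 eqc_rshift mul0r addr0 big1// => i _.
  by rewrite phi_l mulr0.
have E : \forall s \near (0 : R), E1 s =
    derive1 (fun t => E4ext (sphere_variation (@equator_map R n) normal_field t)) s.
  by apply: filterS (nbhs0_lt d0) => s /H2[_ <-]; rewrite derive1E.
apply: (near_eq_is_derive E); apply: (is_derive_eq H3); congr (2 * (_ + _)).
  congr IB; apply/funext => x; rewrite big_split_ord/= big_ord1 big1 ?add0r => [|i _].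
    congr (lap _ x ^+ 2); congr lap; apply/funext => y.
    by rewrite al0 mul0r subr0 phi_r.
  rewrite (_ : (fun x => _) = fun=> 0).
    by rewrite (_ : lap (fun=> 0) = fun=> 0) ?lap0 ?expr0n//; apply/funext => z; exact: lap0.
  by apply/funext => y; rewrite al0 mul0r subr0 phi_l.
rewrite -mulrN; congr (_ * _).
have S : Sx 0 (8 + 0) (fun x => rho x ^+ 8 * h x ^+ 2).
  by apply: Sx_mul; [exact: Sx_rhoX|exact: (Sx_exp 2 (smooth_Sx 0 sh))].
rewrite -mulN1r -IB_scale; last exact: (@Sx_integrable R n n9 0 (8 + 0) _ _ S).
congr IB; apply/funext => x; rewrite al0 expr0n/= sub0r big_split_ord/= big_ord1 phi_r.
rewrite big1 ?add0r; first by ring.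
by move=> i _; rewrite phi_l expr0n.
Qed.

Lemma normal_unstable :
  IB (fun x => lap (lap h) x ^+ 2) - lap4_const (n := n) * IB (fun x => rho x ^+ 8 * h x ^+ 2) < 0 ->
  ~ stable (@equator_map R n).
Proof.
move=> neg st.
have H : \forall t \near (0 : R),
    sobolev0_map 4 (sphere_variation (@equator_map R n) normal_field t \- @equator_map R n).
  by apply: filterS (nbhs0_lt (@ltr01 R)) => t _; exact: normal_variation_sobolev0.
have := st _ normal_field_test_map H _ normal_second_derivative.
by rewrite leNgt pmulr_rlt0// neg.
Qed.

End normal_variation.

(** * The annular test function *)

Section annular.
Context {R : realType} {n : nat}.
Hypothesis n9 : (9 <= n)%N.
Local Notation rV := 'rV[R]_n.
Let n8 : (8 <= n)%N. Proof. exact: ltnW. Qed.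
Variable s : R.
Hypothesis s2 : 2 <= s.
Let s0 : 0 < s. Proof. by apply: lt_le_trans s2; lra. Qed.
Let ss0 : 0 < s ^+ 2. Proof. exact: exprn_gt0. Qed.
Let ss4 : 4 <= s ^+ 2. Proof. by have := s2; nra. Qed.

Lemma enorm_scale (a : R) (x : rV) : 0 <= a -> enorm (a *: x) = a * enorm x.
Proof.
move=> a0; rewrite /enorm (_ : \sum_i _ = a ^+ 2 * \sum_i x ord0 i ^+ 2).
  by rewrite sqrtrM ?sqr_ge0// sqrtr_sqr ger0_norm.
by rewrite mulr_sumr; apply: eq_bigr => i _; rewrite mxE exprMn.
Qed.

Let enorm_ss (x : rV) : enorm (s ^+ 2 *: x) = s ^+ 2 * enorm x.
Proof. by rewrite enorm_scale// ltW. Qed.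

Let wr_ss (x : rV) : wr (s ^+ 2 *: x) = wr x / s.
Proof.
have E : (s ^+ 2 * enorm x)^-1 = (enorm x)^-1 * s^-1 ^+ 2 by rewrite invfM exprVn mulrC.
rewrite /wr /rho enorm_ss E sqrtrM ?invr_ge0 ?enorm_ge0//.
by rewrite sqrtr_sqr ger0_norm// invr_ge0 ltW.
Qed.

(* As [zeta] is [wr^(n-8)] away from the origin and [wr] is homogeneous of degree
   -1/2, the two terms cancel far out and the first one is [wr^(n-8)] on the
   annulus [1/s^2 <= |x| <= 1/2]. *)
Definition annular (x : rV) : R := s ^+ (n - 8) * zeta (s ^+ 2 *: x) - zeta x.

Lemma smooth_annular : smooth annular.
Proof.
apply: smooth_sub; last exact: smooth_zeta.
by apply: smooth_scale; apply: smooth_dilate; exact: smooth_zeta.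
Qed.

Let wrX_ss k (x : rV) : s ^+ k * wr (s ^+ 2 *: x) ^+ k = wr x ^+ k.
Proof. by rewrite wr_ss -exprMn mulrCA divff ?mulr1// gt_eqF. Qed.

Lemma annular_inner (x : rV) : s ^+ 2 * enorm x <= 1 / 2 -> annular x = 0.
Proof.
move=> h; have h2 : enorm x <= 1 / 2.
  by apply: le_trans h; rewrite ler_peMl ?enorm_ge0//; have := ss4; lra.
by rewrite /annular !zeta0 ?enorm_ss// mulr0 subr0.
Qed.

Lemma annular_outer (x : rV) : 3 / 4 <= enorm x -> annular x = 0.
Proof.
move=> h; have h2 : 3 / 4 <= s ^+ 2 * enorm x.
  by apply: le_trans h _; rewrite ler_peMl ?enorm_ge0//; have := ss4; lra.
by rewrite /annular !zeta1 ?enorm_ss// wrX_ss subrr.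
Qed.

Lemma annular_test_fun : test_fun annular.
Proof.
apply: csupp_test_fun; first exact: smooth_annular.
by exists (3 / 4) => [|x /ltW]; [lra|exact: annular_outer].
Qed.

Lemma annular_plateau (x : rV) : 1 <= s ^+ 2 * enorm x -> enorm x <= 1 / 2 ->
  annular x = wr x ^+ (n - 8).
Proof.
move=> h h2; rewrite /annular (zeta0 h2) subr0 zeta1 ?enorm_ss ?wrX_ss//.
by apply: le_trans h; lra.
Qed.

Lemma lap2_annular : lap (lap annular) = fun x => s ^+ n * lap (lap zeta) (s ^+ 2 *: x) - lap (lap zeta) x.
Proof.
pose zd : rV -> R := fun x => zeta (s ^+ 2 *: x).
pose zs : rV -> R := fun x => s ^+ (n - 8) * zd x.
have sz : smooth (zeta : rV -> R) := @smooth_zeta R n.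
have szd : smooth zd := smooth_dilate (s ^+ 2) sz.
have szs : smooth zs := smooth_scale (s ^+ (n - 8)) szd.
have E1 : lap annular = fun x : rV => lap zs x - lap zeta x := smooth_lap_sub szs sz.
have E2 : lap (lap annular) = fun x : rV => lap (lap zs) x - lap (lap zeta) x.
  by rewrite E1; exact: smooth_lap_sub (smooth_lap szs) (smooth_lap sz).
have E3 : lap zs = fun x : rV => s ^+ (n - 8) * lap zd x := smooth_lap_scale _ szd.
have E4 : lap (lap zs) = fun x : rV => s ^+ (n - 8) * lap (lap zd) x.
  by rewrite E3; exact: smooth_lap_scale _ (smooth_lap szd).
have E5 : lap (lap zd) = fun x : rV => (s ^+ 2) ^+ 4 * lap (lap zeta) (s ^+ 2 *: x) :=
  lap2_dilate (s ^+ 2) sz.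
rewrite E2 E4 E5; apply/funext => x.
by rewrite mulrA -exprM -exprD subnK.
Qed.

Variables (M l : R).
Hypotheses (M0 : 0 <= M) (l0 : 0 <= l).
Hypothesis HM : forall x : rV, x != 0 -> `|lap (lap zeta) x| <= M * wr x ^+ n.

Definition annular_density (x : rV) : R := lap (lap annular) x ^+ 2 - l * (rho x ^+ 8 * annular x ^+ 2).

Let wrn (x : rV) : (wr x ^+ n) ^+ 2 = rho x ^+ n.
Proof. by rewrite exprAC wr_sqr. Qed.

Lemma annular_density_inner (x : rV) : s ^+ 2 * enorm x < 1 / 2 -> annular_density x = 0.
Proof.
move=> h; have h2 : enorm x < 1 / 2.
  by apply: le_lt_trans h; rewrite ler_peMl ?enorm_ge0//; have := ss4; lra.
rewrite /annular_density annular_inner ?ltW// lap2_annular !lap2_zeta0 ?enorm_ss//.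
by rewrite mulr0 subr0 expr0n/= !mulr0 subr0.
Qed.

(** By homogeneity the bound M [wr]^n on the bilaplacian of [zeta] is invariant under the dilation,
    so it holds for both terms of [lap2_annular] independently of [s]. *)
Lemma annular_density_le (x : rV) : x != 0 -> annular_density x <= (2 * M) ^+ 2 * rho x ^+ n.
Proof.
move=> x0; have r0 : 0 <= rho x ^+ 8 * annular x ^+ 2.
  by rewrite mulr_ge0 ?sqr_ge0// exprn_ge0// rho_ge0.
apply: (@le_trans _ _ (lap (lap annular) x ^+ 2)).
  by rewrite /annular_density gerBl mulr_ge0.
rewrite -(wrn x) -exprMn -real_normK ?num_real// lerXn2r ?nnegrE//.
  by rewrite !mulr_ge0// exprn_ge0// wr_ge0.
rewrite lap2_annular; apply: le_trans (ler_normB _ _) _.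
have sx0 : s ^+ 2 *: x != 0 by rewrite scaler_eq0 negb_or gt_eqF.
rewrite -mulrA mulr_natl mulr2n; apply: lerD; last exact: HM.
rewrite normrM ger0_norm ?exprn_ge0 ?(ltW s0)// -(wrX_ss n x) mulrCA.
by rewrite ler_wpM2l ?exprn_ge0 ?(ltW s0)//; exact: HM.
Qed.

Lemma annular_density_plateau (x : rV) : 1 <= s ^+ 2 * enorm x -> enorm x < 1 / 2 ->
  annular_density x = (rellich (n := n) ^+ 2 - l) * rho x ^+ n.
Proof.
move=> h h2; rewrite /annular_density annular_plateau// ?ltW// lap2_annular (lap2_zeta0 h2) subr0.
rewrite lap2_zeta1 ?enorm_ss//; last by apply: lt_le_trans h; lra.
rewrite mulrCA wrX_ss exprMn wrn exprAC wr_sqr -exprD subnKC//; ring.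
Qed.

End annular.

(** * Logarithmic growth of the plateau *)

Section instability.
Context {R : realType} {n : nat}.
Hypothesis n9 : (9 <= n)%N.
Local Notation rV := 'rV[R]_n.
Local Notation mu := (@lebesgue_measure_rV R n).
Local Notation B := (@eball R n).
Local Notation intB f := (mu.-integrable B (fun x => (f x)%:E)).
Let n0 : (0 < n)%N. Proof. exact: leq_trans n9. Qed.
Let nR : (9 : R) <= n%:R. Proof. by rewrite ler_nat. Qed.
Let nR0 : (0 : R) < n%:R. Proof. by apply: lt_le_trans nR; rewrite ltr0n. Qed.

Definition cube (a b : R) : set rV := rect (fun=> `]a, b[%classic).

Lemma measurable_cube a b : measurable (cube a b).
Proof. by apply: measurable_rect => i; exact: measurable_itv. Qed.

Lemma indic_cube_integrable a b : intB (fun x => \1_(cube a b) x : R).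
Proof.
apply: (@intB_le R n _ (fun=> 1)); last first.
- by move=> x _; rewrite indicE; case: (x \in _); rewrite ?normr1 ?normr0.
- exact: intB_cst.
- by apply: measurable_indic; exact: measurable_cube.
Qed.

Lemma IB_indic_cube a b :
  IB (fun x => \1_(cube a b) x : R) = fine (mu (cube a b `&` B)).
Proof.
by rewrite /IB /Rintegral integral_indic//; [exact: eball_measurable|exact: measurable_cube].
Qed.

Lemma IB_indic_cube_le a b : a <= b -> IB (fun x => \1_(cube a b) x : R) <= (b - a) ^+ n.
Proof.
move=> ab; rewrite IB_indic_cube -lee_fin -(lebesgue_measure_rV_cube (n := n) ab).
have h : (mu (cube a b `&` B) <= mu (cube a b))%E.
  apply: le_measure; rewrite ?inE//; last exact: measurable_cube.
  by apply: measurableI; [exact: measurable_cube|exact: eball_measurable].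
rewrite fineK//; rewrite ge0_fin_numE//; apply: le_lt_trans h _.
by rewrite /cube lebesgue_measure_rV_cube// ltry.
Qed.

Lemma IB_indic_cube_sub a b : a <= b -> cube a b `<=` B ->
  IB (fun x => \1_(cube a b) x : R) = (b - a) ^+ n.
Proof.
by move=> ab sB; rewrite IB_indic_cube (setIidl sB) /cube lebesgue_measure_rV_cube.
Qed.

Lemma cube_enorm_le a b (x : rV) : 0 <= a -> cube a b x -> enorm x <= n%:R * b.
Proof.
move=> a0 xC.
have xi i : 0 <= x ord0 i <= b.
  by have := xC i; rewrite /= in_itv/= => /andP[h1 h2]; rewrite (ltW h2) (le_trans a0 (ltW h1)).
have b0 : 0 <= b by have /andP[h1 h2] := xi (Ordinal n0); exact: le_trans h2.
rewrite -ler_sqr ?nnegrE ?enorm_ge0 ?mulr_ge0// enorm_sqr.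
apply: (@le_trans _ _ (\sum_(i < n) b ^+ 2)).
  by apply: ler_sum => i _; have /andP[h1 h2] := xi i; rewrite lerXn2r// nnegrE.
have -> : \sum_(i < n) b ^+ 2 = n%:R * b ^+ 2 by rewrite sumr_const card_ord mulr_natl.
have -> : (n%:R * b) ^+ 2 = (n%:R * n%:R) * b ^+ 2 by ring.
by apply: ler_wpM2r; [exact: sqr_ge0|rewrite ler_peMl// ler1n].
Qed.

(** The cubes [C k] with side from [c k / 2] to [c k] stand in for dyadic shells: they are disjoint,
    and on them 2^-k / (8n) < |x| <= 2^-k / 4. This avoids polar coordinates. *)
Let c (k : nat) : R := 2 ^- k / (4 * n%:R).
Let c0 k : 0 < c k.
Proof. by rewrite /c divr_gt0 ?mulr_gt0// invr_gt0 exprn_gt0. Qed.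
Let C k := cube (c k / 2) (c k).

Let nz : n%:R != 0 :> R. Proof. by rewrite gt_eqF. Qed.
Let p2 k : (2 : R) ^+ k != 0. Proof. by rewrite expf_neq0// pnatr_eq0. Qed.

Let C_enorm_le k (x : rV) : C k x -> enorm x <= 2 ^- k / 4.
Proof.
move=> xC; have := cube_enorm_le (ltW (divr_gt0 (c0 k) (ltr0Sn _ 1))) xC.
suff -> : n%:R * c k = 2 ^- k / 4 by [].
by rewrite /c; field; rewrite ?nz ?p2.
Qed.

Let C_enorm_gt k (x : rV) : C k x -> 2 ^- k / (8 * n%:R) < enorm x.
Proof.
move=> /(_ (Ordinal n0)); rewrite /= in_itv/= => /andP[h _].
have -> : 2 ^- k / (8 * n%:R) = c k / 2.
  by rewrite /c; field; rewrite ?nz ?p2.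
by apply: lt_le_trans h _; apply: le_trans (ler_coord_enorm x _); exact: ler_norm.
Qed.

Let pow2V_le1 k : (2 ^- k : R) <= 1.
Proof. by rewrite invf_le1 ?exprn_gt0// exprn_ege1// ler1n. Qed.

Let C_half k (x : rV) : C k x -> enorm x < 1 / 2.
Proof.
by move=> /C_enorm_le h; apply: le_lt_trans h _; have := pow2V_le1 k; lra.
Qed.

Let C_disj j k (x : rV) : C j x -> C k x -> j = k.
Proof.
have H i l : (i < l)%N -> C i x -> C l x -> False.
  move=> il /(_ (Ordinal n0)) + /(_ (Ordinal n0)); rewrite /= !in_itv/=.
  move=> /andP[h1 _] /andP[_ h2]; have := lt_trans h1 h2; apply/negP; rewrite -leNgt.
  rewrite /c mulrAC ler_wpM2r ?invr_ge0 ?mulr_ge0//.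
  rewrite -invfM -exprSr lef_pV2 ?posrE ?exprn_gt0//.
  by apply: ler_weXn2l => //; rewrite ler1n.
move=> xj xk; have [||//] := ltngtP j k; first by move=> /H/(_ xj xk).
by move=> /H/(_ xk xj).
Qed.

(** A step function below rho^n. Each term has the same integral (4 2^k)^n (c k / 2)^n = (1/(2n))^n,
    so the total grows linearly in the number [L] of scales: this is the logarithm. *)
Let S L (x : rV) : R := \sum_(k < L) (4 * 2 ^+ k) ^+ n * \1_(C k) x.

Let S_out L (x : rV) : (forall k : 'I_L, ~ C k x) -> S L x = 0.
Proof.
move=> H; rewrite /S big1// => k _.
by rewrite indicE memNset ?mulr0//; exact: H.
Qed.

Let S_in L (k : 'I_L) (x : rV) : C k x -> S L x <= rho x ^+ n.
Proof.
move=> xC; rewrite /S (bigD1 k)//= big1 ?addr0 => [|j jk]; last first.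
  rewrite indicE memNset ?mulr0// => xj; move/eqP: jk; apply.
  by apply/val_inj; exact: C_disj xj xC.
have e0 : 0 < enorm x.
  by apply: le_lt_trans (C_enorm_gt xC); rewrite divr_ge0 ?mulr_ge0// invr_ge0 exprn_ge0.
rewrite indicE mem_set// mulr1 lerXn2r ?nnegrE ?rho_ge0 ?mulr_ge0 ?exprn_ge0//.
rewrite /rho -[leLHS]invrK lef_pV2 ?posrE ?invr_gt0 ?mulr_gt0 ?exprn_gt0//.
by rewrite invfM mulrC; exact: C_enorm_le.
Qed.

Let S_int L : intB (S L).
Proof. by apply: intB_sum => k; apply: intB_scale; exact: indic_cube_integrable. Qed.

Let kap : R := (2 * n%:R)^-1 ^+ n.

Let IB_S L : IB (S L) = L%:R * kap.
Proof.
rewrite /S IB_sum; last by move=> k; apply: intB_scale; exact: indic_cube_integrable.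
rewrite (eq_bigr (fun=> kap)) => [|k _]; first by rewrite sumr_const card_ord mulr_natl.
rewrite IB_scale ?indic_cube_integrable// IB_indic_cube_sub.
- rewrite -exprMn /kap; congr (_ ^+ n); rewrite /c; field.
  by rewrite ?nz ?p2.
- by have := c0 k; lra.
- by move=> x /C_half h; apply: lt_trans h _; lra.
Qed.

Variables (M l : R).
Hypotheses (M0 : 0 <= M) (l0 : 0 <= l).
Hypothesis HM : forall x : rV, x != 0 -> `|lap (lap zeta) x| <= M * wr x ^+ n.
Hypothesis Kl : rellich (n := n) ^+ 2 < l.

(** Chosen so that [s L * enorm x >= 1] on every [C k] with k < L; as [s L >= 1], these cubes lie in
    the plateau. *)
Let s L : R := 8 * n%:R * 2 ^+ L.

Let pow2_ge1 L : (1 : R) <= 2 ^+ L. Proof. by rewrite exprn_ege1// ler1n. Qed.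
Let s2 L : 2 <= s L. Proof. by rewrite /s; have := pow2_ge1 L; have := nR; nra. Qed.
Let s0 L : 0 < s L. Proof. by apply: lt_le_trans (s2 L); rewrite ltr0n. Qed.
Let ss0 L : 0 < s L ^+ 2. Proof. exact: exprn_gt0. Qed.

(** A majorant of the density. The two cubes contain the transition regions, where rho is at most 2
    s^2 and 2 respectively; each of these terms has integral at most (2M)^2 8^n, whatever [L] is. *)
Let G L (x : rV) : R :=
  (2 * M) ^+ 2 * ((2 * s L ^+ 2) ^+ n * \1_(cube (- (2 / s L ^+ 2)) (2 / s L ^+ 2)) x +
                  2 ^+ n * \1_(cube (-2) 2) x) -
  (l - rellich (n := n) ^+ 2) * S L x.

Let in_cube (a : R) (x : rV) : enorm x < a -> (\1_(cube (- a) a) x : R) = 1.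
Proof.
move=> xa; rewrite indicE mem_set// => i /=; rewrite in_itv/= -ltr_norml.
exact: le_lt_trans (ler_coord_enorm x i) xa.
Qed.

Let density_le L (x : rV) : B x -> annular_density (s L) l x <= G L x.
Proof.
move=> Bx; have M20 : 0 <= (2 * M) ^+ 2 by exact: sqr_ge0.
have G1 : 0 <= (2 * s L ^+ 2) ^+ n * \1_(cube (- (2 / s L ^+ 2)) (2 / s L ^+ 2)) x.
  by rewrite mulr_ge0 ?exprn_ge0 ?mulr_ge0 ?(ltW (ss0 L))// indicE ler0n.
have G2 : 0 <= 2 ^+ n * \1_(cube (-2) 2) x :> R by rewrite mulr_ge0 ?exprn_ge0// indicE ler0n.
have r0 : 0 <= rho x ^+ n by rewrite exprn_ge0// rho_ge0.
have Kl' : 0 <= l - rellich (n := n) ^+ 2 by rewrite subr_ge0 ltW.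
have [[k xC]|nC] := pselect (exists k : 'I_L, C k x).
  have h1 : 1 <= s L ^+ 2 * enorm x.
    have h := C_enorm_gt xC.
    have e1 : 1 <= s L * (2 ^- k / (8 * n%:R)).
      have -> : s L * (2 ^- k / (8 * n%:R)) = 2 ^+ L / 2 ^+ k.
        by rewrite /s; field; rewrite ?nz ?p2.
      rewrite ler_pdivlMr ?exprn_gt0// mul1r.
      by apply: ler_weXn2l; [rewrite ler1n|exact: ltnW].
    apply: (le_trans e1); apply: (@le_trans _ _ (s L * enorm x)).
      by rewrite ler_wpM2l ?(ltW (s0 L))// ltW.
    rewrite expr2 -mulrA ler_peMl//; first by rewrite mulr_ge0 ?enorm_ge0// ltW.
    by apply: le_trans (s2 L); rewrite ler1n.
  rewrite (annular_density_plateau n9 (s2 L) _ h1 (C_half xC)) /G.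
  have h2 := ler_wpM2l Kl' (S_in xC).
  have h3 := mulr_ge0 M20 (addr_ge0 G1 G2).
  move: h2 h3; set X := (2 * M) ^+ 2 * _; set Y := _ * S L x => h2 h3.
  by rewrite -opprB mulNr; lra.
rewrite /G S_out ?mulr0 ?subr0; last by move=> k xC; apply: nC; exists k.
have GG := mulr_ge0 M20 (addr_ge0 G1 G2).
have [h|h] := ltP (s L ^+ 2 * enorm x) (1 / 2).
  by rewrite annular_density_inner.
have x0 : x != 0.
  rewrite -enorm_gt0 -(pmulr_rgt0 _ (ss0 L)); apply: lt_le_trans h; lra.
have H : annular_density (s L) l x <= (2 * M) ^+ 2 * rho x ^+ n.
  exact: (annular_density_le n9 (s2 L) M0 l0 HM x0).
have e0 : 0 < enorm x by rewrite enorm_gt0.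
have [h'|h'] := leP (s L ^+ 2 * enorm x) 1.
  apply: le_trans H _; apply: ler_wpM2l => //; apply: ler_wpDr => //.
  rewrite in_cube ?mulr1; last first.
    rewrite ltr_pdivlMr// mulrC; apply: le_lt_trans h' _; lra.
  rewrite lerXn2r ?nnegrE ?rho_ge0 ?mulr_ge0 ?(ltW (ss0 L))//.
  rewrite /rho -div1r ler_pdivrMr// -mulrA; lra.
(* On the part of the plateau outside the cubes the density is nonpositive and is simply dropped. *)
have [h2|h2] := ltP (enorm x) (1 / 2).
  rewrite (annular_density_plateau n9 (s2 L) _ (ltW h') h2); apply: le_trans GG.
  by rewrite -opprB mulNr oppr_le0 mulr_ge0.
apply: le_trans H _; apply: ler_wpM2l => //; apply: ler_wpDl => //.
rewrite in_cube ?mulr1; last by apply: lt_trans Bx _; lra.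
rewrite lerXn2r ?nnegrE ?rho_ge0//.
by rewrite /rho -div1r ler_pdivrMr//; lra.
Qed.

Let bad : R := (2 * M) ^+ 2 * (8 ^+ n + 8 ^+ n).

Let IB_G L : IB (G L) <= bad - (l - rellich (n := n) ^+ 2) * (L%:R * kap).
Proof.
have i1 := indic_cube_integrable (- (2 / s L ^+ 2)) (2 / s L ^+ 2).
have i2 := indic_cube_integrable (-2) 2.
have i3 := intB_scale ((2 * s L ^+ 2) ^+ n) i1.
have i4 := intB_scale (2 ^+ n) i2.
have i5 := intB_scale ((2 * M) ^+ 2) (intB_add i3 i4).
have i6 := intB_scale (l - rellich (n := n) ^+ 2) (@S_int L).
rewrite /G IB_sub// IB_scale ?intB_add// IB_scale// IB_S lerD2r.
apply: ler_wpM2l; first exact: sqr_ge0.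
rewrite IB_add// !IB_scale//; apply: lerD.
  have a0 : 0 <= 2 / s L ^+ 2 by rewrite divr_ge0// ltW.
  have ab : - (2 / s L ^+ 2) <= 2 / s L ^+ 2 by lra.
  apply: le_trans (ler_wpM2l _ (IB_indic_cube_le ab)) _.
    by rewrite exprn_ge0// mulr_ge0// ltW.
  rewrite -exprMn (_ : _ * _ = 8)//; field; exact: lt0r_neq0.
have ab : (-2 : R) <= 2 by lra.
apply: le_trans (ler_wpM2l _ (IB_indic_cube_le ab)) _; first by rewrite exprn_ge0.
by rewrite -exprMn (_ : _ * _ = 8)//; ring.
Qed.

Lemma annular_negative : exists2 L, 2 <= s L &
  IB (fun x : rV => lap (lap (annular (s L))) x ^+ 2) - l * IB (fun x : rV => rho x ^+ 8 * annular (s L) x ^+ 2) < 0.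
Proof.
have kap0 : 0 < kap by rewrite exprn_gt0// invr_gt0 mulr_gt0.
have Kl' : 0 < l - rellich (n := n) ^+ 2 by rewrite subr_gt0.
have p0 := mulr_gt0 Kl' kap0.
(* Enough scales for the plateau to outweigh the fixed contribution [bad] of the transitions. *)
pose L := (Num.truncn (bad / ((l - rellich (n := n) ^+ 2) * kap))).+1.
exists L; first exact: s2.
have se := @smooth_annular R n (s L).
have i1 : intB (fun x => lap (lap (annular (s L))) x ^+ 2).
  by apply: L2_sqr_integrable; apply: smooth_L2; apply: smooth_lap; exact: smooth_lap.
have i2 : intB (fun x => rho x ^+ 8 * annular (s L) x ^+ 2).
  apply: (@Sx_integrable R n n9 0 (8 + 0)) => //.
  by apply: Sx_mul; [exact: Sx_rhoX|exact: (Sx_exp 2 (smooth_Sx 0 se))].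
rewrite -IB_scale// -IB_sub//; last exact: intB_scale.
have iG : intB (G L).
  apply: intB_sub; apply: intB_scale; last exact: S_int.
  by apply: intB_add; apply: intB_scale; exact: indic_cube_integrable.
have i3 : intB (annular_density (s L) l) by apply: intB_sub => //; exact: intB_scale.
apply: le_lt_trans (IB_le i3 iG (@density_le L)) _.
apply: le_lt_trans (IB_G L) _.
have : bad / ((l - rellich (n := n) ^+ 2) * kap) < L%:R.
  by have := truncnS_gt (bad / ((l - rellich (n := n) ^+ 2) * kap)).
by rewrite ltr_pdivrMr// subr_lt0 mulrCA.
Qed.

End instability.

(** With X = n(n-8) and Z = (n^2-16)/16, the bounds X <= 84 and Z <= 45/4 are attained at n = 14;
    (45/4)^2 X^2 < 105(X+7)(X+15) holds for 0 < X <= 84. *)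
Lemma rellich_sqr_lt_lap4_const (R : realType) (n : nat) : (9 <= n < 15)%N ->
  rellich (R := R) (n := n) ^+ 2 < lap4_const (R := R) (n := n).
Proof.
move=> /andP[n9 n15].
have h9 : (9 : R) <= n%:R by rewrite ler_nat.
have h14 : n%:R <= (14 : R) by rewrite ler_nat.
have -> : rellich (R := R) (n := n) = n%:R * (n%:R - 8) * ((n%:R ^+ 2 - 16) / 16).
  by rewrite /rellich; field.
have e1 : 0 <= (14 - n%:R) * (n%:R - 9 : R) by rewrite mulr_ge0 ?subr_ge0.
have X0 : 0 < n%:R * (n%:R - 8) :> R by rewrite mulr_gt0//; lra.
have X84 : n%:R * (n%:R - 8) <= 84 :> R by nra.
have Z0 : 0 <= (n%:R ^+ 2 - 16) / 16 :> R by rewrite divr_ge0//; nra.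
have Z1 : (n%:R ^+ 2 - 16) / 16 <= 45 / 4 :> R by nra.
move: X0 X84 Z0 Z1; rewrite lap4_constE exprMn.
set X := _ * (n%:R - 8); set Z := (_ / 16) => X0 X84 Z0 Z1.
have : X ^+ 2 * Z ^+ 2 <= X ^+ 2 * (45 / 4) ^+ 2.
  by rewrite ler_wpM2l ?sqr_ge0// lerXn2r ?nnegrE//; lra.
by nra.
Qed.

Theorem equator_unstable (R : realType) (n : nat) : (9 <= n < 15)%N ->
  ~ stable (@equator_map R n).
Proof.
move=> n915; have /andP[n9 _] := n915.
have [M M0 HM] := @lap2_zeta_bound R n (ltnW n9).
have [L s2 neg] := annular_negative n9 M0 (lap4_const_ge0 n9) HM (rellich_sqr_lt_lap4_const R n915).
move: (8 * n%:R * 2 ^+ L) s2 neg => s s2 neg.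
have s0 : 0 < s by apply: lt_le_trans s2; rewrite ltr0n.
(* The squared radius below which [annular s] vanishes, since it does so for s^2 |x| <= 1/2. *)
apply: (@normal_unstable R n n9 (annular s) (((2 * s ^+ 2)^-1) ^+ 2)) => //.
- exact: annular_test_fun.
- by rewrite exprn_gt0// invr_gt0 mulr_gt0// exprn_gt0.
- move=> x h; apply: annular_inner => //.
  have : enorm x <= (2 * s ^+ 2)^-1.
    by rewrite -ler_sqr ?nnegrE ?enorm_ge0// invr_ge0 mulr_ge0// sqr_ge0.
  rewrite -div1r ler_pdivlMr ?mulr_gt0 ?exprn_gt0// => h'.
  by move: h'; generalize (s ^+ 2) (enorm x) => a b h'; lra.
Qed.

Theorem corollary1p6 (R : realType) (n : nat) :
  ((15 <= n)%N ->
     four_harmonic (@equator_map R n) /\ minimizing (@equator_map R n)) /\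
  ((9 <= n < 15)%N ->
     four_harmonic (@equator_map R n) /\ ~ stable (@equator_map R n)).
Proof.
split=> [n15|/[dup] n915 /andP[n9 _]]; split.
- by apply: equator_four_harmonic; exact: leq_trans n15.
- by apply: equator_minimizing => //; exact: leq_trans n15.
- exact: equator_four_harmonic.
- exact: equator_unstable.
Qed.
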